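(* Consider the hydrodynamic type system in Riemann invariants $$\frac{\partial X^1}{\partial t}=\lambda^1(X^1,X^2)\frac{\partial X^1}{\partial x},\qquad \frac{\partial X^2}{\partial t}=\lambda^2(X^1,X^2)\frac{\partial X^2}{\partial x},$$ with $\lambda^1\neq\lambda^2$, and put $$A=\frac{\partial_2\lambda^1}{\lambda^2-\lambda^1},\qquad B=\frac{\partial_1\lambda^2}{\lambda^1-\lambda^2},\qquad \partial_a=\frac{\partial}{\partial X^a},$$ where $A$ and $B$ are assumed non-vanishing. This system admits one, two or three Hamiltonian formulations (of Dubrovin--Novikov type) with hydrodynamic Hamiltonians if and only if the torsion-free affine connection $\nabla$ defined by its non-zero components $$\Gamma^1_{11}=\partial_1\ln A-2B,\quad \Gamma^2_{22}=\partial_2\ln B-2A,\quad \Gamma^1_{12}=\Gamma^1_{21}=-\Big(\tfrac12\partial_2\ln A+A\Big),\quad \Gamma^2_{12}=\Gamma^2_{21}=-\Big(\tfrac12\partial_1\ln B+B\Big)$$ admits, respectively, one, two or three independent linear first integrals.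
   Context: Everything is local: $X^1,X^2$ are coordinates on an open set $U\subset\mathbb{R}^2$, and $\partial_a\ln A$ means $A^{-1}\partial_aA$. **Hamiltonian formulation.** The system admits a Hamiltonian formulation of Dubrovin--Novikov type with a Hamiltonian of hydrodynamic type if it can be written as $$\frac{\partial X^a}{\partial t}=\Omega^{ab}\frac{\delta H}{\delta X^b},\qquad \Omega^{ab}=g^{ab}\frac{\partial}{\partial x}+b^{ab}_c\frac{\partial X^c}{\partial x},$$ where $H[X^1,X^2]=\int_{\mathbb{R}}\mathcal{H}(X^1,X^2)\,dx$ with density $\mathcal{H}$ not depending on derivatives of $X^a$, $g^{ab}$ and $b^{ab}_c$ are functions of $(X^1,X^2)$ with $(g^{ab})$ non-degenerate, and $$\{F,G\}=\int_{\mathbb{R}}\frac{\delta F}{\delta X^a}\Big(g^{ab}\frac{\partial}{\partial x}+b^{ab}_c\frac{\partial X^c}{\partial x}\Big)\frac{\delta G}{\delta X^b}\,dx$$ is a Poisson bracket. For non-degenerate $g^{ab}$, with $g_{ab}g^{bc}=\delta_a^c$ and $\gamma^b_{dc}$ defined by $b^{ab}_c=-g^{ad}\gamma^b_{dc}$: skew-symmetry of the bracket means that $g^{ab}$ is symmetric and the metric $g_{ab}dX^adX^b$ is parallel for the connection with Christoffel symbols $\gamma^c_{ab}$, and the Jacobi identity then holds iff this connection is torsion-free and the metric $g$ is flat. Thus $\Omega$ is determined by the flat contravariant metric $g^{ab}$, and the number of Hamiltonian formulations is the number of linearly independent such $g^{ab}$. **First integrals.** A linear first integral of $\nabla$ is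 a function $K_a(X)\dot X^a$ on the tangent bundle of $U$, with $K=K_adX^a$ a non-zero one-form, constant along all affinely parametrised geodesics $\ddot X^a+\Gamma^a_{bc}\dot X^b\dot X^c=0$; equivalently $\nabla_{(a}K_{b)}=0$ (round brackets denote symmetrisation). Independence means linear independence over $\mathbb{R}$.
   Formalization: Counts are of smooth germs at a point. The claim fails for n=1 (a first integral with an identically zero component gives no metric), so a first integral with both components non-zero at the point is also required; this is proved automatic for n=3 and to hold arbitrarily nearby for n=2. *)

(* Defs.v *)
From Stdlib Require Import Reals.
From Coquelicot Require Import Coquelicot.
Open Scope R_scope.

(* Everything is local: objects are functions of the coordinates (X^1, X^2)
   considered near a given point, i.e. up to equality on a neighbourhood of it
   ([locally_2d]).  Two such objects with the same germ are identified when
   linear independence is tested. *)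

Inductive idx := i1 | i2.

Definition sum2 (F : idx -> R) : R := F i1 + F i2.

Definition delta (a b : idx) : R :=
  match a, b with i1, i1 | i2, i2 => 1 | _, _ => 0 end.

Definition pd (a : idx) (f : R -> R -> R) : R -> R -> R :=
  match a with
  | i1 => fun u v => Derive (fun z => f z v) u
  | i2 => fun u v => Derive (fun z => f u z) v
  end.

Definition smooth_near (f : R -> R -> R) (x y : R) : Prop :=
  locally_2d (fun u v => forall n, ex_diff_n f n u v) x y.

(** Counting linearly independent germs *)

Definition lin_indep_near {I : Type} (n : nat) (w : nat -> I -> R -> R -> R)
  (x y : R) : Prop :=
  forall c : nat -> R,
    locally_2d (fun u v => forall a : I,
      sum_n_m (fun k => c k * w k a u v) 1 n = 0) x y ->
    forall k, (1 <= k <= n)%nat -> c k = 0.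

Definition has_indep {I : Type} (P : (I -> R -> R -> R) -> Prop) (n : nat)
  (x y : R) : Prop :=
  exists w : nat -> I -> R -> R -> R,
    (forall k, (1 <= k <= n)%nat -> P (w k)) /\ lin_indep_near n w x y.

Definition exactly_indep {I : Type} (P : (I -> R -> R -> R) -> Prop) (n : nat)
  (x y : R) : Prop :=
  has_indep P n x y /\ ~ has_indep P (S n) x y.

(** Hamiltonian formulations of Dubrovin-Novikov type *)

(* The operator g^{ab} d/dx + b^{ab}_c X^c_x along the field X, applied to a
   covector field eta along X.  Here and below [b a e c] is b^{ae}_c. *)
Definition Omega (g : idx * idx -> R -> R -> R)
  (b : idx -> idx -> idx -> R -> R -> R)
  (X eta : idx -> R -> R) (a : idx) (s : R) : R :=
  sum2 (fun e => g (a, e) (X i1 s) (X i2 s) * Derive (eta e) s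
    + sum2 (fun c => b a e c (X i1 s) (X i2 s) * Derive (X c) s) * eta e s).

(* For H[X] = int h(X) dx with h free of derivatives of X, the variational
   derivative of H with respect to X^e is the partial derivative of h. *)
Definition var_deriv (h : R -> R -> R) (X : idx -> R -> R) (e : idx) (s : R) : R :=
  pd e h (X i1 s) (X i2 s).

(* lam^a X^a_x = Omega^{ae} dH/dX^e for all fields passing through (u, v). *)
Definition generates_system_at (lam : idx -> R -> R -> R)
  (g : idx * idx -> R -> R -> R) (b : idx -> idx -> idx -> R -> R -> R)
  (h : R -> R -> R) (u v : R) : Prop :=
  forall (X : idx -> R -> R) (s : R),
    X i1 s = u -> X i2 s = v -> (forall c, ex_derive (X c) s) ->
    forall a, lam a u v * Derive (X a) s = Omega g b X (var_deriv h X) a s.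

(* The covariant derivative of the connection with Christoffel symbols
   gam^a_{dc} (written [gam a d c]) in the direction of X^c acts through the
   last lower slot. *)
Definition parallel_at (gam : idx -> idx -> idx -> R -> R -> R)
  (gl : idx -> idx -> R -> R -> R) (u v : R) : Prop :=
  forall a b c,
    pd c (gl a b) u v
    - sum2 (fun d => gam d a c u v * gl d b u v)
    - sum2 (fun d => gam d b c u v * gl a d u v) = 0.

Definition torsion_free_at (gam : idx -> idx -> idx -> R -> R -> R) (u v : R) : Prop :=
  forall c a b, gam c a b u v = gam c b a u v.

Definition flat_at (gam : idx -> idx -> idx -> R -> R -> R) (u v : R) : Prop :=
  forall d c a b,
    pd a (gam d c b) u v - pd b (gam d c a) u v
    + sum2 (fun e => gam d e a u v * gam e c b u v)
    - sum2 (fun e => gam d e b u v * gam e c a u v) = 0.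

(* Omega defines a Poisson bracket, for a non-degenerate g^{ab} with inverse
   gl_{ab} and b^{ae}_c = - g^{ad} gam^e_{dc}.  By Dubrovin-Novikov,
   skew-symmetry is: g symmetric and gl parallel for gam; the Jacobi identity
   is then: gam torsion-free and flat (gam being the Levi-Civita connection of
   gl, this is flatness of the metric). *)
Definition poisson_near (g : idx * idx -> R -> R -> R)
  (b : idx -> idx -> idx -> R -> R -> R) (x y : R) : Prop :=
  exists (gl : idx -> idx -> R -> R -> R) (gam : idx -> idx -> idx -> R -> R -> R),
    (forall a e, smooth_near (gl a e) x y) /\
    (forall a e c, smooth_near (gam a e c) x y) /\
    locally_2d (fun u v =>
      (forall a c, sum2 (fun e => gl a e u v * g (e, c) u v) = delta a c) /\
      (forall a e c, b a e c u v = - sum2 (fun d => g (a, d) u v * gam e d c u v)) /\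
      (forall a e, g (a, e) u v = g (e, a) u v) /\
      parallel_at gam gl u v /\
      torsion_free_at gam u v /\
      flat_at gam u v) x y.

Definition hamiltonian_formulation (lam : idx -> R -> R -> R) (x y : R)
  (g : idx * idx -> R -> R -> R) : Prop :=
  (forall p, smooth_near (g p) x y) /\
  exists (b : idx -> idx -> idx -> R -> R -> R) (h : R -> R -> R),
    (forall a e c, smooth_near (b a e c) x y) /\
    smooth_near h x y /\
    poisson_near g b x y /\
    locally_2d (generates_system_at lam g b h) x y.

(** Linear first integrals *)

Definition is_geodesic (Gam : idx -> idx -> idx -> R -> R -> R)
  (X V : idx -> R -> R) (s t : R) : Prop :=
  forall r, s < r < t -> forall a,
    is_derive (X a) r (V a r) /\
    is_derive (V a) r
      (- sum2 (fun b => sum2 (fun c =>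
           Gam a b c (X i1 r) (X i2 r) * V b r * V c r))).

(* The third clause: K_a (dX^a/dr) is constant along every affinely
   parametrised geodesic contained in a neighbourhood of (x, y). *)
Definition linear_first_integral (Gam : idx -> idx -> idx -> R -> R -> R)
  (x y : R) (K : idx -> R -> R -> R) : Prop :=
  (forall a, smooth_near (K a) x y) /\
  ~ locally_2d (fun u v => forall a, K a u v = 0) x y /\
  exists d : posreal,
    forall (X V : idx -> R -> R) (s t : R),
      is_geodesic Gam X V s t ->
      (forall r, s < r < t -> Rabs (X i1 r - x) < d /\ Rabs (X i2 r - y) < d) ->
      forall r r', s < r < t -> s < r' < t ->
        sum2 (fun a => K a (X i1 r) (X i2 r) * V a r) =
        sum2 (fun a => K a (X i1 r') (X i2 r') * V a r').

(** The connection attached to the system *)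

Definition coefA (lam : idx -> R -> R -> R) (u v : R) : R :=
  pd i2 (lam i1) u v / (lam i2 u v - lam i1 u v).

Definition coefB (lam : idx -> R -> R -> R) (u v : R) : R :=
  pd i1 (lam i2) u v / (lam i1 u v - lam i2 u v).

Definition dln (a : idx) (f : R -> R -> R) (u v : R) : R := / f u v * pd a f u v.

Definition connection (lam : idx -> R -> R -> R) (a b c : idx) (u v : R) : R :=
  let A := coefA lam in
  let B := coefB lam in
  match a, b, c with
  | i1, i1, i1 => dln i1 A u v - 2 * B u v
  | i2, i2, i2 => dln i2 B u v - 2 * A u v
  | i1, i1, i2 | i1, i2, i1 => - (1 / 2 * dln i2 A u v + A u v)
  | i2, i1, i2 | i2, i2, i1 => - (1 / 2 * dln i1 B u v + B u v)
  | i1, i2, i2 | i2, i1, i1 => 0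
  end.

(** Counts near a point, and non-degeneracy *)

Definition hamiltonian_number (lam : idx -> R -> R -> R) (n : nat) (x y : R) : Prop :=
  exactly_indep (hamiltonian_formulation lam x y) n x y.

Definition first_integral_number (Gam : idx -> idx -> idx -> R -> R -> R)
  (n : nat) (x y : R) : Prop :=
  exactly_indep (linear_first_integral Gam x y) n x y.

(* Under the correspondence K = (A g^{22}, B g^{11}) this is the requirement
   that some contravariant metric is non-degenerate at the point.  It is not
   automatic: for lam^1 - lam^2 = exp(-s^2)/s, d(lam^2)/ds = exp(-s^2), with
   s = X^1 + X^2 > 0, one has B = s and A = s + 1/s, the only linear first
   integrals are the multiples of (exp(-s^2)/s) dX^2, and no Hamiltonian
   formulation exists. *)
Definition nondegenerate_integral (Gam : idx -> idx -> idx -> R -> R -> R)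
  (x y : R) : Prop :=
  exists K, linear_first_integral Gam x y K /\ forall a, K a x y <> 0.

Definition degenerate_integral (Gam : idx -> idx -> idx -> R -> R -> R)
  (x y : R) : Prop :=
  exists K, linear_first_integral Gam x y K /\
    exists a, locally_2d (fun u v => K a u v = 0) x y.

(* Main.v *)
Require Import Defs.
From Stdlib Require Import Reals Lra Lia Classical.
From Coquelicot Require Import Coquelicot.
Open Scope R_scope.

(** The correspondence between contravariant metrics and first integrals is
    [K = (A g^22, B g^11)].

    A one-form is a linear first integral exactly when it satisfies the Killing equation:
    geodesics through a given point with a given velocity exist (Picard-Lindelof,
    [geodesic_exists]), and differentiating the constant [K_a V^a] along all of them gives
    the vanishing of the symmetrised covariant derivative ([first_integral_killing]); the
    converse is the chain rule.

    Given a Hamiltonian formulation, the system says that the covariant Hessian of the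
    density [h] is [diag (lam^1 g_11, lam^2 g_22)].  Its symmetry makes the metric
    diagonal, and the symmetry of its covariant derivative, which holds because the metric
    is flat, identifies [A] and [B] with the Christoffel symbols [Gamma^1_12] and
    [Gamma^2_12] ([hessian_codazzi]).  These two conditions and flatness are three equations
    on [P = g^11] and [Q = g^22], and they are the three Killing equations for [K]
    ([killing_form_of_metric]).

    Conversely, let [P] and [Q] solve the three equations and not vanish at the point.  The
    density is found by quadratures, because the connection of a plane metric in an
    orthonormal coframe is a single one-form, closed by flatness: rotating the coframe by
    its primitive [theta] makes it parallel, and then the gradient of the density and the
    density itself are primitives of closed forms ([hessian_potential],
    [flat_diagonal_hamiltonian]).

    So Hamiltonian formulations correspond to the Killing forms with both components
    nonzero at the point.  If there is one such form [K0], then any independent family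
    [w_k] of Killing forms can be replaced by [w_k + t K0] with [t] large, which is still
    independent and consists of such forms ([has_indep_nondegenerate]); this gives the
    equality of the counts.

    It remains to see when such a form exists.  The Killing equation prolongs to a closed
    linear system for [(K_1, K_2, d_1 K_2)], so a Killing form is determined by three
    numbers at a point ([killing_jet_zero]).  If every form were degenerate at the point,
    the same component would vanish there for all of them, and only two free numbers would
    remain; this excludes three independent forms.  If every form is degenerate at all
    nearby points, each has an identically vanishing component, because the zero set of
    [K_a] is a union of [a]-th coordinate lines; two independent forms cannot both be of
    that kind ([nowhere_nondegenerate]). *)

(** * Smooth functions of two variables on an open set *)

Definition open2 (D : R -> R -> Prop) : Prop :=
  forall u v, D u v -> locally_2d D u v.

Definition diff_on (D : R -> R -> Prop) (n : nat) (f : R -> R -> R) : Prop :=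
  forall u v, D u v -> ex_diff_n f n u v.

Definition smooth_on (D : R -> R -> Prop) (f : R -> R -> R) : Prop :=
  forall n, diff_on D n f.

Definition is_pd (a : idx) (f : R -> R -> R) (u v l : R) : Prop :=
  match a with
  | i1 => is_derive (fun z => f z v) u l
  | i2 => is_derive (fun z => f u z) v l
  end.

Definition box (x y d : R) (u v : R) : Prop := Rabs (u - x) < d /\ Rabs (v - y) < d.

Lemma open2_box x y d : open2 (box x y d).
Proof.
  intros u v [Hu Hv].
  assert (He : 0 < Rmin (d - Rabs (u - x)) (d - Rabs (v - y))).
  { apply Rmin_pos; lra. }
  exists (mkposreal _ He); simpl; intros u' v' Hu' Hv'.
  assert (H1 := Rmin_l (d - Rabs (u - x)) (d - Rabs (v - y))).
  assert (H2 := Rmin_r (d - Rabs (u - x)) (d - Rabs (v - y))).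
  split.
  - replace (u' - x) with ((u' - u) + (u - x)) by ring.
    apply Rle_lt_trans with (1 := Rabs_triang _ _); lra.
  - replace (v' - y) with ((v' - v) + (v - y)) by ring.
    apply Rle_lt_trans with (1 := Rabs_triang _ _); lra.
Qed.

Lemma box_center x y d : 0 < d -> box x y d x y.
Proof. intro; split; rewrite Rminus_diag, Rabs_R0; assumption. Qed.

Lemma locally_2d_box (P : R -> R -> Prop) x y :
  locally_2d P x y <-> exists d, 0 < d /\ forall u v, box x y d u v -> P u v.
Proof.
  split.
  - intros [d Hd]; exists d; split; [apply cond_pos|].
    intros u v [H1 H2]; apply Hd; assumption.
  - intros (d & Hd & H); exists (mkposreal d Hd); intros u v H1 H2.
    apply H; split; assumption.
Qed.

Lemma box_incl x y d d' u v : d <= d' -> box x y d u v -> box x y d' u v.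
Proof. intros Hd [H1 H2]; split; lra. Qed.

Lemma smooth_on_near D f x y : open2 D -> smooth_on D f -> D x y -> smooth_near f x y.
Proof.
  intros HD Hf Hxy; apply locally_2d_impl with (2 := HD x y Hxy).
  apply locally_2d_forall; intros u v Huv n; exact (Hf n u v Huv).
Qed.

Lemma smooth_on_incl (D D' : R -> R -> Prop) f :
  (forall u v, D u v -> D' u v) -> smooth_on D' f -> smooth_on D f.
Proof. intros H Hf n u v Huv; apply Hf, H, Huv. Qed.

Lemma is_pd_unique a f u v l : is_pd a f u v l -> pd a f u v = l.
Proof. destruct a; simpl; apply is_derive_unique. Qed.

Lemma is_pd_const a c u v : is_pd a (fun _ _ => c) u v 0.
Proof. destruct a; simpl; apply is_derive_Reals, derivable_pt_lim_const. Qed.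

Lemma is_pd_plus a f g u v l m :
  is_pd a f u v l -> is_pd a g u v m ->
  is_pd a (fun u v => f u v + g u v) u v (l + m).
Proof.
  destruct a; simpl; intros H1 H2.
  - exact (is_derive_plus (fun z => f z v) (fun z => g z v) u l m H1 H2).
  - exact (is_derive_plus (fun z => f u z) (fun z => g u z) v l m H1 H2).
Qed.

Lemma is_pd_mult a f g u v l m :
  is_pd a f u v l -> is_pd a g u v m ->
  is_pd a (fun u v => f u v * g u v) u v (l * g u v + f u v * m).
Proof.
  destruct a; simpl; intros H1 H2.
  - apply (is_derive_mult (fun z => f z v) (fun z => g z v)); trivial.
    intros; apply Rmult_comm.
  - apply (is_derive_mult (fun z => f u z) (fun z => g u z)); trivial.
    intros; apply Rmult_comm.
Qed.

Lemma is_pd_opp a f u v l :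
  is_pd a f u v l -> is_pd a (fun u v => - f u v) u v (- l).
Proof.
  destruct a; simpl; intros H.
  - exact (is_derive_opp (fun z => f z v) u l H).
  - exact (is_derive_opp (fun z => f u z) v l H).
Qed.

Lemma is_pd_inv a f u v l : f u v <> 0 ->
  is_pd a f u v l -> is_pd a (fun u v => / f u v) u v (- l * / f u v * / f u v).
Proof.
  intros Hf; replace (- l * / f u v * / f u v) with (- l / f u v ^ 2) by (field; trivial).
  destruct a; simpl; intros H.
  - apply (is_derive_inv (fun z => f z v)); trivial.
  - apply (is_derive_inv (fun z => f u z)); trivial.
Qed.

Lemma is_pd_ext a f g u v l : locally_2d (fun u v => f u v = g u v) u v ->
  is_pd a f u v l -> is_pd a g u v l.
Proof.
  intros H; destruct a; simpl; apply is_derive_ext_loc.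
  - exact (locally_2d_1d_const_y _ _ _ H).
  - exact (locally_2d_1d_const_x _ _ _ H).
Qed.

Lemma is_pd_comp a (phi : R -> R) f u v l m :
  is_derive phi (f u v) m -> is_pd a f u v l ->
  is_pd a (fun u v => phi (f u v)) u v (m * l).
Proof.
  destruct a; simpl; intros H1 H2; rewrite Rmult_comm.
  - apply (is_derive_comp phi (fun z => f z v)); assumption.
  - apply (is_derive_comp phi (fun z => f u z)); assumption.
Qed.

Lemma smooth_near_common (K : idx -> R -> R -> R) x y : (forall a, smooth_near (K a) x y) ->
  exists d, 0 < d /\ forall a, smooth_on (box x y d) (K a).
Proof.
  intro HK; generalize (locally_2d_and _ _ _ _ (HK i1) (HK i2)); intro H.
  apply locally_2d_box in H; destruct H as (d & Hd & H).
  exists d; split; trivial.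
  intros [|] n u v Huv; destruct (H u v Huv); trivial.
Qed.

Section Smooth.
Variable D : R -> R -> Prop.
Hypothesis HD : open2 D.

Lemma on_locally (P : R -> R -> Prop) u v :
  (forall u v, D u v -> P u v) -> D u v -> locally_2d P u v.
Proof.
  intros H Huv; apply locally_2d_impl with (2 := HD u v Huv).
  apply locally_2d_forall; exact H.
Qed.

Lemma diff_on_continuous n f u v : diff_on D n f -> D u v -> continuity_2d_pt f u v.
Proof. intros H Huv; generalize (H u v Huv); destruct n; intros [H' _]; exact H'. Qed.

Lemma diff_on_S n f : diff_on D (S n) f -> diff_on D n f.
Proof. intros H u v Huv; apply ex_diff_n_m with (S n); auto. Qed.

Lemma diff_on_is_pd n f a u v : diff_on D (S n) f -> D u v -> is_pd a f u v (pd a f u v).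
Proof.
  intros H Huv; destruct (H u v Huv) as (_ & H1 & H2 & _).
  destruct a; simpl; apply Derive_correct; assumption.
Qed.

Lemma diff_on_pd n f a : diff_on D (S n) f -> diff_on D n (pd a f).
Proof.
  intros H u v Huv; destruct (H u v Huv) as (_ & _ & _ & H1 & H2).
  destruct a; assumption.
Qed.

Lemma diff_on_ext n f g :
  (forall u v, D u v -> f u v = g u v) -> diff_on D n f -> diff_on D n g.
Proof.
  intros H Hf u v Huv; apply ex_diff_n_ext_loc with f; auto.
  apply on_locally; assumption.
Qed.

Lemma diff_on_intro n f (g : idx -> R -> R -> R) :
  (forall u v, D u v -> continuity_2d_pt f u v) ->
  (forall a u v, D u v -> is_pd a f u v (g a u v)) ->
  (forall a, diff_on D n (g a)) ->
  diff_on D (S n) f.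
Proof.
  intros Hc Hd Hg.
  assert (H : forall a, diff_on D n (pd a f)).
  { intro a; apply diff_on_ext with (2 := Hg a).
    intros u v Huv; symmetry; apply is_pd_unique, Hd, Huv. }
  intros u v Huv; split; [apply Hc, Huv|].
  repeat split.
  - exists (g i1 u v); exact (Hd i1 u v Huv).
  - exists (g i2 u v); exact (Hd i2 u v Huv).
  - exact (H i1 u v Huv).
  - exact (H i2 u v Huv).
Qed.

Lemma diff_on_const n c : diff_on D n (fun _ _ => c).
Proof.
  revert c; induction n as [|n IH]; intros c.
  - intros u v _; split; trivial; apply continuity_2d_pt_const.
  - apply diff_on_intro with (fun _ _ _ => 0).
    + intros; apply continuity_2d_pt_const.
    + intros; apply is_pd_const.
    + intros; apply IH.
Qed.

Lemma diff_on_plus n f g :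
  diff_on D n f -> diff_on D n g -> diff_on D n (fun u v => f u v + g u v).
Proof.
  revert f g; induction n as [|n IH]; intros f g Hf Hg.
  - intros u v Huv; split; trivial.
    apply continuity_2d_pt_plus; eapply diff_on_continuous; eassumption.
  - apply diff_on_intro with (fun a u v => pd a f u v + pd a g u v).
    + intros; apply continuity_2d_pt_plus; eapply diff_on_continuous; eassumption.
    + intros; apply is_pd_plus; eapply diff_on_is_pd; eassumption.
    + intros; apply IH; apply diff_on_pd; assumption.
Qed.

Lemma diff_on_mult n f g :
  diff_on D n f -> diff_on D n g -> diff_on D n (fun u v => f u v * g u v).
Proof.
  revert f g; induction n as [|n IH]; intros f g Hf Hg.
  - intros u v Huv; split; trivial.
    apply continuity_2d_pt_mult; eapply diff_on_continuous; eassumption.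
  - apply diff_on_intro with (fun a u v => pd a f u v * g u v + f u v * pd a g u v).
    + intros; apply continuity_2d_pt_mult; eapply diff_on_continuous; eassumption.
    + intros; apply is_pd_mult; eapply diff_on_is_pd; eassumption.
    + intros; apply diff_on_plus; apply IH;
        solve [apply diff_on_pd; assumption | apply diff_on_S; assumption].
Qed.

(** Bootstrapping: every derivative gained on the right-hand side of the system is gained
    on the left, so continuous solutions are as smooth as the coefficients. *)
Lemma diff_on_linear_system n (f : idx -> R -> R -> R)
  (M : idx -> idx -> idx -> R -> R -> R) :
  (forall a i j, smooth_on D (M a i j)) ->
  (forall i u v, D u v -> continuity_2d_pt (f i) u v) ->
  (forall a i u v, D u v ->
     is_pd a (f i) u v (sum2 (fun j => M a i j u v * f j u v))) ->
  forall i, diff_on D n (f i).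
Proof.
  intros HM Hc Hd; induction n as [|n IH]; intro i.
  - intros u v Huv; split; trivial; apply Hc, Huv.
  - apply diff_on_intro with (fun a u v => sum2 (fun j => M a i j u v * f j u v)).
    + apply Hc.
    + intros; apply Hd; assumption.
    + intros a; unfold sum2; apply diff_on_plus; apply diff_on_mult; try apply IH; apply HM.
Qed.

Lemma smooth_on_const c : smooth_on D (fun _ _ => c).
Proof. intro n; apply diff_on_const. Qed.

Lemma smooth_on_plus f g :
  smooth_on D f -> smooth_on D g -> smooth_on D (fun u v => f u v + g u v).
Proof. intros Hf Hg n; apply diff_on_plus; auto. Qed.

Lemma smooth_on_mult f g :
  smooth_on D f -> smooth_on D g -> smooth_on D (fun u v => f u v * g u v).
Proof. intros Hf Hg n; apply diff_on_mult; auto. Qed.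

Lemma smooth_on_ext f g :
  (forall u v, D u v -> f u v = g u v) -> smooth_on D f -> smooth_on D g.
Proof. intros H Hf n; apply diff_on_ext with f; auto. Qed.

Lemma smooth_on_opp f : smooth_on D f -> smooth_on D (fun u v => - f u v).
Proof.
  intros Hf; apply smooth_on_ext with (fun u v => (-1) * f u v).
  - intros; ring.
  - apply smooth_on_mult; trivial; apply smooth_on_const.
Qed.

Lemma smooth_on_minus f g :
  smooth_on D f -> smooth_on D g -> smooth_on D (fun u v => f u v - g u v).
Proof. intros Hf Hg; apply smooth_on_plus; trivial; apply smooth_on_opp; trivial. Qed.

Lemma smooth_on_pd a f : smooth_on D f -> smooth_on D (pd a f).
Proof. intros Hf n; apply diff_on_pd, Hf. Qed.

Lemma smooth_on_continuous f u v : smooth_on D f -> D u v -> continuity_2d_pt f u v.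
Proof. intros Hf; apply diff_on_continuous with 0%nat, Hf. Qed.

Lemma smooth_on_is_pd a f u v : smooth_on D f -> D u v -> is_pd a f u v (pd a f u v).
Proof. intros Hf; apply diff_on_is_pd with 0%nat, Hf. Qed.

Lemma smooth_on_inv f : smooth_on D f -> (forall u v, D u v -> f u v <> 0) ->
  smooth_on D (fun u v => / f u v).
Proof.
  intros Hf H0 n; induction n as [|n IH].
  - intros u v Huv; split; trivial; apply continuity_2d_pt_inv; auto.
    apply smooth_on_continuous; assumption.
  - apply diff_on_intro with (fun a u v => - pd a f u v * / f u v * / f u v).
    + intros; apply continuity_2d_pt_inv; auto.
      apply smooth_on_continuous; assumption.
    + intros; apply is_pd_inv; auto; apply smooth_on_is_pd; assumption.
    + intros a; repeat apply diff_on_mult; trivial.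
      apply smooth_on_opp, smooth_on_pd, Hf.
Qed.

Lemma smooth_on_div f g : smooth_on D f -> smooth_on D g ->
  (forall u v, D u v -> g u v <> 0) -> smooth_on D (fun u v => f u v / g u v).
Proof. intros; apply smooth_on_mult; trivial; apply smooth_on_inv; trivial. Qed.

Lemma smooth_on_sum2 (f : idx -> R -> R -> R) :
  (forall a, smooth_on D (f a)) -> smooth_on D (fun u v => sum2 (fun a => f a u v)).
Proof. intros H; apply smooth_on_plus; apply H. Qed.

Lemma pd_ext a f g u v : (forall u v, D u v -> f u v = g u v) -> D u v ->
  smooth_on D f -> pd a g u v = pd a f u v.
Proof.
  intros H Huv Hf; apply is_pd_unique, is_pd_ext with f.
  - apply on_locally; assumption.
  - apply smooth_on_is_pd; assumption.
Qed.

Lemma pd_comm f u v : smooth_on D f -> D u v -> pd i1 (pd i2 f) u v = pd i2 (pd i1 f) u v.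
Proof.
  intros Hf Huv; apply (Schwarz f u v).
  - apply on_locally with (2 := Huv); clear u v Huv; intros u v Huv.
    generalize (smooth_on_is_pd i1 f u v Hf Huv) (smooth_on_is_pd i2 f u v Hf Huv)
      (smooth_on_is_pd i1 _ u v (smooth_on_pd i2 f Hf) Huv)
      (smooth_on_is_pd i2 _ u v (smooth_on_pd i1 f Hf) Huv).
    simpl; intros H1 H2 H3 H4; repeat split; eexists; eassumption.
  - exact (smooth_on_continuous _ u v (smooth_on_pd i1 _ (smooth_on_pd i2 f Hf)) Huv).
  - exact (smooth_on_continuous _ u v (smooth_on_pd i2 _ (smooth_on_pd i1 f Hf)) Huv).
Qed.

End Smooth.

(** * Mean values, linear differential inequalities and closed forms *)

Lemma mean_value_bound (h dh : R -> R) (C s t : R) :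
  (forall r, Rmin s t <= r <= Rmax s t -> is_derive h r (dh r) /\ Rabs (dh r) <= C) ->
  Rabs (h t - h s) <= C * Rabs (t - s).
Proof.
  intros H.
  destruct (MVT_gen h s t dh) as (c & Hc & E).
  - intros r Hr; apply H; lra.
  - intros r Hr; apply continuity_pt_filterlim.
    apply (ex_derive_continuous h); exists (dh r); apply H; lra.
  - rewrite E, Rabs_mult; apply Rmult_le_compat_r; [apply Rabs_pos|].
    apply H, Hc.
Qed.

Lemma between_open (a b s t r : R) :
  a < s < b -> a < t < b -> Rmin s t <= r <= Rmax s t -> a < r < b.
Proof. unfold Rmin, Rmax; destruct (Rle_dec s t); lra. Qed.

Lemma between_box x d s t r : Rabs (s - x) < d -> Rabs (t - x) < d ->
  Rmin s t <= r <= Rmax s t -> Rabs (r - x) < d.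
Proof.
  intros Hs Ht Hr; apply Rabs_def2 in Hs; apply Rabs_def2 in Ht.
  assert (H : x - d < r < x + d) by (apply between_open with s t; lra).
  apply Rabs_def1; lra.
Qed.

Lemma geometric_bound_zero (z m : R) : (forall n, Rabs z <= m * (1 / 2) ^ n) -> z = 0.
Proof.
  intros H; destruct (Req_dec z 0) as [E|E]; trivial; exfalso.
  assert (Hz : 0 < Rabs z) by (apply Rabs_pos_lt; exact E).
  assert (L : is_lim_seq (fun n => m * (1 / 2) ^ n) 0).
  { replace (Finite 0) with (Rbar_mult m 0) by (simpl; f_equal; ring).
    apply is_lim_seq_scal_l, is_lim_seq_geom; rewrite Rabs_pos_eq; lra. }
  generalize (is_lim_seq_le _ _ (Rabs z) 0 H (is_lim_seq_const _) L).
  simpl; lra.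
Qed.

(** On an interval so short that [C * (b - a) <= 1 / 2], integrating the differential
    inequality from the zero halves any uniform bound for the family; hence the bound
    is zero. *)
Lemma ode_zero {I : Type} (f df : R -> I -> R) (a b t0 C m : R) :
  (forall t j, a < t < b -> is_derive (fun t => f t j) t (df t j)) ->
  (forall t c, a < t < b -> 0 <= c -> (forall j, Rabs (f t j) <= c) ->
     forall j, Rabs (df t j) <= C * c) ->
  (forall t j, a < t < b -> Rabs (f t j) <= m) ->
  0 <= C -> 0 <= m -> C * (b - a) <= 1 / 2 ->
  a < t0 < b -> (forall j, f t0 j = 0) ->
  forall t j, a < t < b -> f t j = 0.
Proof.
  intros Hd HC Hm HC0 Hm0 Hab Ht0 H0.
  assert (H : forall n t j, a < t < b -> Rabs (f t j) <= m * (1 / 2) ^ n).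
  { induction n as [|n IH]; intros t j Ht.
    - simpl; rewrite Rmult_1_r; auto.
    - assert (Hp : 0 <= m * (1 / 2) ^ n).
      { apply Rmult_le_pos; trivial; apply pow_le; lra. }
      replace (f t j) with (f t j - f t0 j) by (rewrite H0; ring).
      apply Rle_trans with (C * (m * (1 / 2) ^ n) * Rabs (t - t0)).
      + apply (mean_value_bound (fun t => f t j) (fun t => df t j)); intros r Hr.
        assert (a < r < b) by (apply between_open with t0 t; trivial).
        split; [apply Hd; trivial|]; apply HC; trivial; intro; apply IH; trivial.
      + apply Rle_trans with (C * (m * (1 / 2) ^ n) * (b - a)).
        * apply Rmult_le_compat_l; [apply Rmult_le_pos; trivial|].
          apply Rabs_le; lra.
        * simpl; replace (C * (m * (1 / 2) ^ n) * (b - a))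
            with ((m * (1 / 2) ^ n) * (C * (b - a))) by ring.
          replace (m * (1 / 2 * (1 / 2) ^ n)) with ((m * (1 / 2) ^ n) * (1 / 2)) by ring.
          apply Rmult_le_compat_l; trivial. }
  intros t j Ht; apply geometric_bound_zero with m; intro; apply H; trivial.
Qed.

Lemma smooth_on_continuous_line a D f u v : smooth_on D f -> D u v ->
  match a with
  | i1 => continuous (fun z => f z v) u
  | i2 => continuous (fun z => f u z) v
  end.
Proof.
  intros Hf Huv; generalize (smooth_on_is_pd D a f u v Hf Huv).
  destruct a; simpl; intros H;
    [apply (ex_derive_continuous (fun z => f z v)) | apply (ex_derive_continuous (fun z => f u z))];
    eexists; exact H.
Qed.

Lemma box_fst x y d u v : 0 < d -> box x y d u v -> box x y d u y.
Proof. intros Hd [H _]; split; trivial; rewrite Rminus_diag, Rabs_R0; trivial. Qed.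

(** The primitive is the integral along the path that runs first horizontally, then
    vertically; its horizontal derivative is found by differentiating under the integral
    sign, where closedness turns the integrand into a vertical derivative. *)
Lemma poincare (x y d : R) (al : idx -> R -> R -> R) : 0 < d ->
  (forall a, smooth_on (box x y d) (al a)) ->
  (forall u v, box x y d u v -> pd i2 (al i1) u v = pd i1 (al i2) u v) ->
  exists f, smooth_on (box x y d) f /\
    forall a u v, box x y d u v -> is_pd a f u v (al a u v).
Proof.
  intros Hd Hal Hcl.
  pose (f := fun u v => RInt (fun s => al i1 s y) x u + RInt (fun t => al i2 u t) y v).
  assert (Hx : Rabs (x - x) < d) by (rewrite Rminus_diag, Rabs_R0; trivial).
  assert (Hy : Rabs (y - y) < d) by (rewrite Rminus_diag, Rabs_R0; trivial).
  assert (I1 : forall u, Rabs (u - x) < d -> ex_RInt (fun s => al i1 s y) x u).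
  { intros u Hu; apply (ex_RInt_continuous (fun s => al i1 s y)); intros z Hz.
    apply (smooth_on_continuous_line i1 (box x y d) (al i1) z y); trivial.
    split; trivial; apply between_box with x u; trivial. }
  assert (I2 : forall u v, box x y d u v -> ex_RInt (fun t => al i2 u t) y v).
  { intros u v [Hu Hv]; apply (ex_RInt_continuous (fun t => al i2 u t)); intros z Hz.
    apply (smooth_on_continuous_line i2 (box x y d) (al i2) u z); trivial.
    split; trivial; apply between_box with y v; trivial. }
  assert (Hpd : forall a u v, box x y d u v -> is_pd a f u v (al a u v)).
  { intros [|] u v Huv; simpl; unfold f.
    - assert (E : al i1 u v = plus (al i1 u y) (RInt (fun t => Derive (fun z => al i2 z t) u) y v)).
      { rewrite (RInt_ext _ (Derive (fun t => al i1 u t))).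
        - rewrite RInt_Derive.
          + unfold plus; simpl; ring.
          + intros t Ht; eexists.
            apply (smooth_on_is_pd (box x y d) i2 (al i1) u t); trivial.
            destruct Huv; split; trivial; apply between_box with y v; trivial.
          + intros t Ht.
            apply (smooth_on_continuous_line i2 (box x y d) (pd i2 (al i1)) u t).
            * apply smooth_on_pd, Hal.
            * destruct Huv; split; trivial; apply between_box with y v; trivial.
        - intros t Ht; symmetry; apply (Hcl u t).
          destruct Huv; split; trivial; apply between_box with y v; trivial; lra. }
      rewrite E.
      apply (is_derive_plus (fun u => RInt (fun s => al i1 s y) x u)
               (fun u => RInt (fun t => al i2 u t) y v)).
      + apply (is_derive_RInt (fun s => al i1 s y) _ x u).
        * apply locally_2d_1d_const_y with (y := y) (P := fun u v =>
            is_RInt (fun s => al i1 s y) x u (RInt (fun s => al i1 s y) x u)).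
          apply on_locally with (D := box x y d) (3 := box_fst _ _ _ _ _ Hd Huv).
          -- apply open2_box.
          -- intros u' v' [Hu' _]; apply (RInt_correct (fun s => al i1 s y)), I1, Hu'.
        * apply (smooth_on_continuous_line i1 (box x y d) (al i1) u y); trivial.
          apply box_fst with v; trivial.
      + apply (is_derive_RInt_param (fun u t => al i2 u t)).
        * apply locally_2d_1d_const_y with (y := v) (P := fun u v => forall t : R,
            Rmin y v <= t <= Rmax y v -> ex_derive (fun u0 => al i2 u0 t) u).
          apply on_locally with (D := box x y d) (3 := Huv); [apply open2_box|].
          intros u' v' [Hu' Hv'] t Ht; eexists.
          apply (smooth_on_is_pd (box x y d) i1 (al i2) u' t); trivial.
          split; trivial; apply between_box with y v'; trivial.
        * intros t Ht.
          apply (smooth_on_continuous (box x y d) (pd i1 (al i2)) u t).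
          -- apply smooth_on_pd, Hal.
          -- destruct Huv; split; trivial; apply between_box with y v; trivial.
        * apply locally_2d_1d_const_y with (y := v) (P := fun u v =>
            ex_RInt (fun t => al i2 u t) y v).
          apply on_locally with (D := box x y d) (3 := Huv); [apply open2_box|]; trivial.
    - replace (al i2 u v) with (plus 0 (al i2 u v)) by (unfold plus; simpl; ring).
      apply (is_derive_plus (fun v => RInt (fun s => al i1 s y) x u)
               (fun v => RInt (fun t => al i2 u t) y v)).
      + apply is_derive_Reals, derivable_pt_lim_const.
      + apply (is_derive_RInt (fun s => al i2 u s) _ y v).
        * apply locally_2d_1d_const_x with (x := u) (P := fun u v =>
            is_RInt (fun s => al i2 u s) y v (RInt (fun s => al i2 u s) y v)).
          apply on_locally with (D := box x y d) (3 := Huv); [apply open2_box|].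
          intros u' v' Huv'; apply (RInt_correct (fun s => al i2 u' s)), I2, Huv'.
        * apply (smooth_on_continuous_line i2 (box x y d) (al i2) u v); trivial. }
  exists f; split; trivial.
  intros n; apply diff_on_S, diff_on_intro with al; trivial.
  - apply open2_box.
  - intros u v Huv; apply differentiable_continuity_pt.
    exists (al i1 u v), (al i2 u v); apply filterdiff_differentiable_pt_lim.
    apply (is_derive_filterdiff f u v (fun u v => al i1 u v) (al i2 u v)).
    + apply locally_2d_locally with (P := fun u v => is_derive (fun z => f z v) u (al i1 u v)).
      apply on_locally with (D := box x y d) (3 := Huv); [apply open2_box|].
      exact (Hpd i1).
    + exact (Hpd i2 u v Huv).
    + apply continuity_2d_pt_filterlim with (f := al i1).
      apply smooth_on_continuous with (D := box x y d); trivial.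
  - intros; apply Hal.
Qed.

Lemma smooth_on_differentiable D f u v : open2 D -> smooth_on D f -> D u v ->
  differentiable_pt_lim f u v (pd i1 f u v) (pd i2 f u v).
Proof.
  intros HD Hf Huv; apply filterdiff_differentiable_pt_lim.
  apply (is_derive_filterdiff f u v (pd i1 f) (pd i2 f u v)).
  - apply locally_2d_locally with (P := fun u v => is_derive (fun z => f z v) u (pd i1 f u v)).
    apply on_locally with (D := D) (3 := Huv); trivial.
    intros u' v' H; exact (smooth_on_is_pd D i1 f u' v' Hf H).
  - exact (smooth_on_is_pd D i2 f u v Hf Huv).
  - apply continuity_2d_pt_filterlim with (f := pd i1 f).
    apply smooth_on_continuous with (D := D); trivial; apply smooth_on_pd, Hf.
Qed.

Lemma is_derive_along D f (X : idx -> R -> R) (s l1 l2 : R) :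
  open2 D -> smooth_on D f -> D (X i1 s) (X i2 s) ->
  is_derive (X i1) s l1 -> is_derive (X i2) s l2 ->
  is_derive (fun r => f (X i1 r) (X i2 r)) s
    (pd i1 f (X i1 s) (X i2 s) * l1 + pd i2 f (X i1 s) (X i2 s) * l2).
Proof.
  intros HD Hf Hs H1 H2; apply is_derive_Reals.
  apply (derivable_pt_lim_comp_2d f (X i1) (X i2)).
  - apply smooth_on_differentiable with D; trivial.
  - apply is_derive_Reals; trivial.
  - apply is_derive_Reals; trivial.
Qed.

Lemma smooth_on_bounded D f x y : smooth_on D f -> D x y ->
  locally_2d (fun u v => Rabs (f u v) <= Rabs (f x y) + 1) x y.
Proof.
  intros Hf Hxy.
  apply locally_2d_impl with
    (2 := smooth_on_continuous D f x y Hf Hxy (mkposreal 1 Rlt_0_1)).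
  apply locally_2d_forall; simpl; intros u v H.
  replace (f u v) with (f u v - f x y + f x y) by ring.
  apply Rle_trans with (1 := Rabs_triang _ _); lra.
Qed.

(** * Existence of solutions of ordinary differential equations *)

Definition clamp (a b t : R) : R := Rmax a (Rmin b t).

Lemma clamp_range a b t : a <= b -> a <= clamp a b t <= b.
Proof. unfold clamp, Rmax, Rmin; intro; destruct (Rle_dec b t), (Rle_dec a _); lra. Qed.

Lemma clamp_id a b t : a <= t <= b -> clamp a b t = t.
Proof. unfold clamp, Rmax, Rmin; intro; destruct (Rle_dec b t), (Rle_dec a _); lra. Qed.

Lemma clamp_lipschitz a b s t : Rabs (clamp a b t - clamp a b s) <= Rabs (t - s).
Proof.
  unfold clamp, Rmax, Rmin;
    destruct (Rle_dec b t), (Rle_dec b s);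
    repeat match goal with |- context [Rle_dec a ?x] => destruct (Rle_dec a x) end;
    unfold Rabs; repeat destruct Rcase_abs; lra.
Qed.

Lemma lipschitz_continuous (h : R -> R) (L : R) :
  0 <= L -> (forall s t, Rabs (h t - h s) <= L * Rabs (t - s)) -> forall t, continuous h t.
Proof.
  intros HL H t; apply continuity_pt_filterlim; intros eps Heps.
  exists (eps / (L + 1)); split; [apply Rdiv_lt_0_compat; lra|].
  intros s [_ Hs]; simpl in *; unfold R_dist in *.
  apply Rle_lt_trans with (1 := H t s).
  apply Rle_lt_trans with (L * (eps / (L + 1))).
  - apply Rmult_le_compat_l; lra.
  - replace eps with ((L + 1) * (eps / (L + 1))) at 2 by (field; lra).
    apply Rmult_lt_compat_r; [apply Rdiv_lt_0_compat|]; lra.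
Qed.

Lemma abs_RInt_bound (g : R -> R) (a b C : R) : (forall t, continuous g t) ->
  (forall t, Rmin a b <= t <= Rmax a b -> Rabs (g t) <= C) ->
  Rabs (RInt g a b) <= C * Rabs (b - a).
Proof.
  intros Hg HC.
  assert (E : forall a b, ex_RInt g a b) by (intros; apply (ex_RInt_continuous g); auto).
  destruct (Rle_dec a b) as [Hab|Hab].
  - rewrite (Rabs_pos_eq (b - a)), Rmult_comm by lra.
    apply abs_RInt_le_const; trivial.
    intros t Ht; apply HC; rewrite Rmin_left, Rmax_right; lra.
  - rewrite <- (opp_RInt_swap g) by trivial.
    rewrite (Rabs_left (b - a)), Rmult_comm by lra.
    unfold opp; simpl; rewrite Rabs_Ropp.
    replace (- (b - a)) with (a - b) by ring.
    apply abs_RInt_le_const; trivial; [lra|].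
    intros t Ht; apply HC; rewrite Rmin_right, Rmax_left; lra.
Qed.

(** The states are families of reals indexed by an arbitrary type [J], and all estimates
    are uniform in the index, that is, in the sup norm. *)
Section Picard.
Context {J : Type}.
Variables (f : (J -> R) -> J -> R) (M : R) (z0 : J -> R).
Hypothesis HM : 0 < M.
Hypothesis f_bound : forall z j, Rabs (f z j) <= M.
Hypothesis f_lip : forall z w c, (forall j, Rabs (z j - w j) <= c) ->
  forall j, Rabs (f z j - f w j) <= M * c.

Let e := / (2 * M).

Lemma e_pos : 0 < e.
Proof. apply Rinv_0_lt_compat; lra. Qed.

(** Time is clamped so that the iterates are defined and contracting on the whole line. *)
Fixpoint picard_iter (k : nat) (t : R) (j : J) : R :=
  match k with
  | O => z0 j
  | S k => z0 j + RInt (fun s => f (picard_iter k s) j) 0 (clamp (- e) e t)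
  end.

Lemma lipschitz_field_continuous (z : R -> J -> R) j :
  (forall j s t, Rabs (z t j - z s j) <= M * Rabs (t - s)) ->
  forall t, continuous (fun s => f (z s) j) t.
Proof.
  intros Hz; apply lipschitz_continuous with (M * M).
  - apply Rmult_le_pos; lra.
  - intros s t; rewrite Rmult_assoc; apply f_lip; intro; apply Hz.
Qed.

Lemma RInt_field_lipschitz (z : R -> J -> R) j :
  (forall j s t, Rabs (z t j - z s j) <= M * Rabs (t - s)) ->
  forall s t, Rabs (RInt (fun s => f (z s) j) 0 (clamp (- e) e t)
                  - RInt (fun s => f (z s) j) 0 (clamp (- e) e s)) <= M * Rabs (t - s).
Proof.
  intros Hz s t.
  assert (Hc := lipschitz_field_continuous z j Hz).
  assert (E : forall a b, ex_RInt (fun s => f (z s) j) a b)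
    by (intros; apply (ex_RInt_continuous (fun s => f (z s) j)); auto).
  rewrite <- (RInt_Chasles (fun s => f (z s) j) 0 (clamp (- e) e s) (clamp (- e) e t)) by trivial.
  unfold plus; simpl; rewrite Rplus_minus_l.
  apply Rle_trans with (M * Rabs (clamp (- e) e t - clamp (- e) e s)).
  - apply abs_RInt_bound; auto.
  - apply Rmult_le_compat_l; [lra|]; apply clamp_lipschitz.
Qed.

Lemma picard_iter_lipschitz k j s t :
  Rabs (picard_iter k t j - picard_iter k s j) <= M * Rabs (t - s).
Proof.
  revert j s t; induction k as [|k IH]; intros j s t; simpl.
  - rewrite Rminus_diag, Rabs_R0; apply Rmult_le_pos; [lra|apply Rabs_pos].
  - match goal with |- Rabs ?x <= _ => replace x with
      (RInt (fun s => f (picard_iter k s) j) 0 (clamp (- e) e t)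
       - RInt (fun s => f (picard_iter k s) j) 0 (clamp (- e) e s)) by ring end.
    apply RInt_field_lipschitz; trivial.
Qed.

Lemma picard_contraction (z w : R -> J -> R) c :
  (forall j s t, Rabs (z t j - z s j) <= M * Rabs (t - s)) ->
  (forall j s t, Rabs (w t j - w s j) <= M * Rabs (t - s)) ->
  0 <= c -> (forall t j, Rabs (z t j - w t j) <= c) ->
  forall t j, Rabs (RInt (fun s => f (z s) j) 0 (clamp (- e) e t)
                  - RInt (fun s => f (w s) j) 0 (clamp (- e) e t)) <= c / 2.
Proof.
  intros Hz Hw Hc0 Hc t j.
  assert (Cz := lipschitz_field_continuous z j Hz).
  assert (Cw := lipschitz_field_continuous w j Hw).
  assert (Hm := RInt_minus (fun s => f (z s) j) (fun s => f (w s) j) 0 (clamp (- e) e t)).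
  unfold minus, plus, opp in Hm; simpl in Hm.
  unfold Rminus; rewrite <- Hm.
  2: apply (ex_RInt_continuous (fun s => f (z s) j)); auto.
  2: apply (ex_RInt_continuous (fun s => f (w s) j)); auto.
  apply Rle_trans with ((M * c) * Rabs (clamp (- e) e t - 0)).
  - apply abs_RInt_bound.
    + intros s; apply (continuous_minus (fun s => f (z s) j) (fun s => f (w s) j)); auto.
    + intros s _; apply f_lip; auto.
  - assert (He := e_pos); assert (Hr := clamp_range (- e) e t).
    apply Rle_trans with (M * c * e).
    + apply Rmult_le_compat_l; [apply Rmult_le_pos; lra|].
      apply Rabs_le; lra.
    + apply Req_le; unfold e; field; lra.
Qed.

Lemma picard_iter_step k t j :
  Rabs (picard_iter (S k) t j - picard_iter k t j) <= (1 / 2) ^ k.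
Proof.
  revert t j; induction k as [|k IH]; intros t j.
  - simpl; rewrite Rplus_minus_l.
    apply Rle_trans with (M * Rabs (clamp (- e) e t - 0)).
    + apply abs_RInt_bound; [intros; apply continuous_const|intros; apply f_bound].
    + assert (He := e_pos); assert (Hr := clamp_range (- e) e t).
      apply Rle_trans with (M * e).
      * apply Rmult_le_compat_l; [lra|]; apply Rabs_le; lra.
      * unfold e; replace (M * / (2 * M)) with (/ 2) by (field; lra); lra.
  - replace (picard_iter (S (S k)) t j - picard_iter (S k) t j) with
      (RInt (fun s => f (picard_iter (S k) s) j) 0 (clamp (- e) e t)
       - RInt (fun s => f (picard_iter k s) j) 0 (clamp (- e) e t)) by (simpl; ring).
    replace ((1 / 2) ^ S k) with ((1 / 2) ^ k / 2) by (simpl; field).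
    apply picard_contraction; trivial; try apply picard_iter_lipschitz.
    apply pow_le; lra.
Qed.

Lemma picard_iter_cauchy k n t j :
  Rabs (picard_iter (k + n) t j - picard_iter k t j) <= 2 * (1 / 2) ^ k - 2 * (1 / 2) ^ (k + n).
Proof.
  induction n as [|n IH].
  - rewrite Nat.add_0_r, !Rminus_diag, Rabs_R0; lra.
  - rewrite Nat.add_succ_r.
    replace (picard_iter (S (k + n)) t j - picard_iter k t j) with
      ((picard_iter (S (k + n)) t j - picard_iter (k + n) t j)
       + (picard_iter (k + n) t j - picard_iter k t j)) by ring.
    apply Rle_trans with (1 := Rabs_triang _ _).
    assert (H := picard_iter_step (k + n) t j).
    replace ((1 / 2) ^ S (k + n)) with ((1 / 2) ^ (k + n) / 2) by (simpl; field); lra.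
Qed.

Definition picard_limit (t : R) (j : J) : R := Lim_seq (fun k => picard_iter k t j).

Lemma picard_limit_correct t j : is_lim_seq (fun k => picard_iter k t j) (picard_limit t j).
Proof.
  apply Lim_seq_correct', ex_lim_seq_cauchy_corr; intros eps.
  assert (L : is_lim_seq (fun k => 4 * (1 / 2) ^ k) 0).
  { replace (Finite 0) with (Rbar_mult 4 0) by (simpl; f_equal; ring).
    apply is_lim_seq_scal_l, is_lim_seq_geom; rewrite Rabs_pos_eq; lra. }
  apply is_lim_seq_spec in L; destruct (L eps) as [N HN]; exists N.
  assert (B : forall n, (N <= n)%nat ->
    Rabs (picard_iter n t j - picard_iter N t j) <= 2 * (1 / 2) ^ N).
  { intros n Hn; replace n with (N + (n - N))%nat by lia.
    apply Rle_trans with (1 := picard_iter_cauchy N (n - N) t j).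
    assert (0 <= (1 / 2) ^ (N + (n - N))) by (apply pow_le; lra); lra. }
  intros n m Hn Hm.
  replace (picard_iter n t j - picard_iter m t j) with
    ((picard_iter n t j - picard_iter N t j) - (picard_iter m t j - picard_iter N t j)) by ring.
  apply Rle_lt_trans with (1 := Rabs_triang _ _); rewrite Rabs_Ropp.
  assert (H := HN N (le_n _)); apply Rabs_def2 in H.
  generalize (B n Hn) (B m Hm); lra.
Qed.

Lemma is_lim_seq_abs_le (u : nat -> R) (l b : R) :
  is_lim_seq u l -> eventually (fun k => Rabs (u k) <= b) -> Rabs l <= b.
Proof.
  intros Hu Hb.
  generalize (is_lim_seq_le_loc _ _ (Rabs l) b Hb (is_lim_seq_abs u l Hu) (is_lim_seq_const b)).
  trivial.
Qed.

Lemma picard_limit_near k t j : Rabs (picard_limit t j - picard_iter k t j) <= 2 * (1 / 2) ^ k.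
Proof.
  apply is_lim_seq_abs_le with (fun n => picard_iter n t j - picard_iter k t j).
  - apply is_lim_seq_minus'; [apply picard_limit_correct|apply is_lim_seq_const].
  - exists k; intros n Hn; replace n with (k + (n - k))%nat by lia.
    apply Rle_trans with (1 := picard_iter_cauchy k (n - k) t j).
    assert (0 <= (1 / 2) ^ (k + (n - k))) by (apply pow_le; lra); lra.
Qed.

Lemma picard_limit_lipschitz j s t :
  Rabs (picard_limit t j - picard_limit s j) <= M * Rabs (t - s).
Proof.
  apply is_lim_seq_abs_le with (fun n => picard_iter n t j - picard_iter n s j).
  - apply is_lim_seq_minus'; apply picard_limit_correct.
  - exists O; intros; apply picard_iter_lipschitz.
Qed.

Lemma picard_limit_fixed t j :
  picard_limit t j = z0 j + RInt (fun s => f (picard_limit s) j) 0 (clamp (- e) e t).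
Proof.
  apply Rminus_diag_uniq, geometric_bound_zero with 2; intro n.
  match goal with |- Rabs (?a - ?b) <= _ => replace (a - b) with
    ((picard_limit t j - picard_iter (S n) t j)
     + (RInt (fun s => f (picard_iter n s) j) 0 (clamp (- e) e t)
        - RInt (fun s => f (picard_limit s) j) 0 (clamp (- e) e t))) by (simpl; ring) end.
  apply Rle_trans with (1 := Rabs_triang _ _).
  assert (H1 := picard_limit_near (S n) t j).
  assert (Hp : 0 <= (1 / 2) ^ n) by (apply pow_le; lra).
  assert (H2 : Rabs (RInt (fun s => f (picard_iter n s) j) 0 (clamp (- e) e t)
        - RInt (fun s => f (picard_limit s) j) 0 (clamp (- e) e t)) <= 2 * (1 / 2) ^ n / 2).
  { apply picard_contraction.
    - intros; apply picard_iter_lipschitz.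
    - intros; apply picard_limit_lipschitz.
    - lra.
    - intros; rewrite Rabs_minus_sym; apply picard_limit_near. }
  rewrite <- tech_pow_Rmult in H1; lra.
Qed.

Lemma picard_lindelof : exists z : R -> J -> R, (forall j, z 0 j = z0 j) /\
  exists d, 0 < d /\
    forall t, Rabs t < d -> forall j, is_derive (fun s => z s j) t (f (z t) j).
Proof.
  assert (He := e_pos).
  exists picard_limit; split.
  - intro j; rewrite picard_limit_fixed, clamp_id by lra.
    rewrite RInt_point; unfold zero; simpl; ring.
  - exists e; split; trivial; intros t Ht j.
    assert (Hc := lipschitz_field_continuous picard_limit j picard_limit_lipschitz).
    apply Rabs_def2 in Ht.
    apply is_derive_ext_loc with
      (fun s => plus (z0 j) (RInt (fun s => f (picard_limit s) j) 0 s)).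
    + apply (locally_interval _ t (- e) e); try (simpl; lra).
      intros s H1 H2; simpl in H1, H2; rewrite picard_limit_fixed, clamp_id by lra; trivial.
    + replace (f (picard_limit t) j) with (plus 0 (f (picard_limit t) j))
        by (unfold plus; simpl; ring).
      apply (is_derive_plus (fun _ => z0 j) (fun s => RInt (fun s => f (picard_limit s) j) 0 s)).
      * apply is_derive_Reals, derivable_pt_lim_const.
      * apply (is_derive_RInt (fun s => f (picard_limit s) j) _ 0 t); trivial.
        apply filter_forall; intros s.
        apply (RInt_correct (fun s => f (picard_limit s) j)).
        apply (ex_RInt_continuous (fun s => f (picard_limit s) j)); auto.
Qed.
End Picard.

(** * Geodesics *)

Section Tame.
Context {J : Type}.
Variable S : (J -> R) -> Prop.

(** Bounded and Lipschitz with one common constant: unlike the Lipschitz property alone,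
    this is stable under products, hence holds for the quadratic geodesic field. *)
Definition tame (g : (J -> R) -> R) : Prop :=
  exists M, 0 <= M /\ (forall z, S z -> Rabs (g z) <= M) /\
    forall z w c, S z -> S w -> (forall j, Rabs (z j - w j) <= c) ->
      Rabs (g z - g w) <= M * c.

Lemma dist_nonneg (z w : J -> R) (c : R) : inhabited J ->
  (forall j, Rabs (z j - w j) <= c) -> 0 <= c.
Proof. intros [j] H; apply Rle_trans with (2 := H j), Rabs_pos. Qed.

Lemma tame_plus g h : tame g -> tame h -> tame (fun z => g z + h z).
Proof.
  intros (M & HM & B & L) (N & HN & B' & L'); exists (M + N); repeat split.
  - lra.
  - intros z Hz; apply Rle_trans with (1 := Rabs_triang _ _).
    apply Rplus_le_compat; auto.
  - intros z w c Hz Hw Hc.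
    replace (g z + h z - (g w + h w)) with ((g z - g w) + (h z - h w)) by ring.
    apply Rle_trans with (1 := Rabs_triang _ _); rewrite Rmult_plus_distr_r.
    apply Rplus_le_compat; auto.
Qed.

Lemma tame_opp g : tame g -> tame (fun z => - g z).
Proof.
  intros (M & HM & B & L); exists M; repeat split; trivial.
  - intros z Hz; rewrite Rabs_Ropp; auto.
  - intros z w c Hz Hw Hc.
    replace (- g z - - g w) with (- (g z - g w)) by ring; rewrite Rabs_Ropp; auto.
Qed.

Lemma tame_mult g h : inhabited J -> tame g -> tame h -> tame (fun z => g z * h z).
Proof.
  intros HJ (M & HM & B & L) (N & HN & B' & L'); exists (2 * M * N); repeat split.
  - apply Rmult_le_pos; lra.
  - intros z Hz; rewrite Rabs_mult.
    assert (0 <= M * N) by (apply Rmult_le_pos; trivial).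
    apply Rle_trans with (M * N); [|lra].
    apply Rmult_le_compat; auto using Rabs_pos.
  - intros z w c Hz Hw Hc.
    assert (Hc0 := dist_nonneg z w c HJ Hc).
    replace (g z * h z - g w * h w) with ((g z - g w) * h z + g w * (h z - h w)) by ring.
    apply Rle_trans with (1 := Rabs_triang _ _); rewrite !Rabs_mult.
    replace (2 * M * N * c) with ((M * c) * N + M * (N * c)) by ring.
    apply Rplus_le_compat; apply Rmult_le_compat; auto using Rabs_pos.
Qed.

Lemma tame_coord (z0 : J -> R) rho j : 0 <= rho ->
  (forall z, S z -> Rabs (z j - z0 j) <= rho) -> tame (fun z => z j).
Proof.
  intros Hr HS; exists (Rabs (z0 j) + rho + 1); assert (H0 := Rabs_pos (z0 j)).
  repeat split.
  - lra.
  - intros z Hz; replace (z j) with ((z j - z0 j) + z0 j) by ring.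
    apply Rle_trans with (1 := Rabs_triang _ _); generalize (HS z Hz); lra.
  - intros z w c Hz Hw Hc; apply Rle_trans with (1 := Hc j).
    assert (Hc0 := dist_nonneg z w c (inhabits j) Hc).
    rewrite <- (Rmult_1_l c) at 1; apply Rmult_le_compat_r; lra.
Qed.

End Tame.

Lemma smooth_lipschitz x y d f C u v u' v' :
  smooth_on (box x y d) f ->
  (forall a u v, box x y d u v -> Rabs (pd a f u v) <= C) ->
  box x y d u v -> box x y d u' v' ->
  Rabs (f u v - f u' v') <= C * Rabs (u - u') + C * Rabs (v - v').
Proof.
  intros Hf HC [Hu Hv] [Hu' Hv'].
  replace (f u v - f u' v') with ((f u v - f u' v) + (f u' v - f u' v')) by ring.
  apply Rle_trans with (1 := Rabs_triang _ _); apply Rplus_le_compat.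
  - apply (mean_value_bound (fun z => f z v) (fun z => pd i1 f z v)).
    intros r Hr; assert (box x y d r v) by (split; trivial; apply between_box with u' u; trivial).
    split; [apply (smooth_on_is_pd (box x y d) i1)|apply (HC i1)]; trivial.
  - apply (mean_value_bound (fun z => f u' z) (fun z => pd i2 f u' z)).
    intros r Hr; assert (box x y d u' r) by (split; trivial; apply between_box with v' v; trivial).
    split; [apply (smooth_on_is_pd (box x y d) i2)|apply (HC i2)]; trivial.
Qed.

Lemma locally_2d_forall_idx (P : idx -> R -> R -> Prop) x y :
  (forall a, locally_2d (P a) x y) -> locally_2d (fun u v => forall a, P a u v) x y.
Proof.
  intros H; apply locally_2d_impl with (2 := locally_2d_and _ _ _ _ (H i1) (H i2)).
  apply locally_2d_forall; intros u v [H1 H2] [|]; trivial.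
Qed.

Section Geodesic.
Variables (D : R -> R -> Prop) (Gam : idx -> idx -> idx -> R -> R -> R).
Hypothesis HD : open2 D.
Hypothesis HGam : forall a b c, smooth_on D (Gam a b c).

(** Positions are indexed by [(true, a)], velocities by [(false, a)]. *)
Definition geodesic_field (z : bool * idx -> R) (j : bool * idx) : R :=
  if fst j then z (false, snd j)
  else - sum2 (fun b => sum2 (fun c =>
         Gam (snd j) b c (z (true, i1)) (z (true, i2)) * z (false, b) * z (false, c))).

Definition cube (z0 : bool * idx -> R) (rho : R) (z : bool * idx -> R) : Prop :=
  forall j, Rabs (z j - z0 j) <= rho.

Lemma tame_smooth f z0 : smooth_on D f -> D (z0 (true, i1)) (z0 (true, i2)) ->
  exists rho0, 0 < rho0 /\ forall rho, 0 < rho <= rho0 ->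
    tame (cube z0 rho) (fun z => f (z (true, i1)) (z (true, i2))).
Proof.
  intros Hf H0.
  assert (HB : locally_2d (fun u v => D u v /\
     Rabs (f u v) <= Rabs (f (z0 (true, i1)) (z0 (true, i2))) + 1 /\
     forall a, Rabs (pd a f u v) <= Rabs (pd a f (z0 (true, i1)) (z0 (true, i2))) + 1)
     (z0 (true, i1)) (z0 (true, i2))).
  { repeat apply locally_2d_and; auto.
    - apply smooth_on_bounded with D; trivial.
    - apply locally_2d_forall_idx; intro a; apply smooth_on_bounded with D; trivial.
      apply smooth_on_pd; trivial. }
  apply locally_2d_box in HB; destruct HB as (d & Hd & HB).
  set (x := z0 (true, i1)) in *; set (y := z0 (true, i2)) in *.
  pose (C := Rabs (pd i1 f x y) + 1 + (Rabs (pd i2 f x y) + 1)).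
  assert (P1 := Rabs_pos (pd i1 f x y)); assert (P2 := Rabs_pos (pd i2 f x y)).
  assert (P3 := Rabs_pos (f x y)).
  exists (d / 2); split; [lra|]; intros rho Hrho.
  assert (Hbox : forall z, cube z0 rho z -> box x y d (z (true, i1)) (z (true, i2))).
  { intros z Hz; split; [generalize (Hz (true, i1))|generalize (Hz (true, i2))];
      unfold x, y; lra. }
  exists (Rabs (f x y) + 1 + 2 * C); repeat split.
  - unfold C; lra.
  - intros z Hz; destruct (HB _ _ (Hbox z Hz)) as (_ & H & _); unfold C; lra.
  - intros z w c Hz Hw Hc.
    apply Rle_trans with (C * Rabs (z (true, i1) - w (true, i1))
                          + C * Rabs (z (true, i2) - w (true, i2))).
    + apply smooth_lipschitz with x y d; auto.
      * apply smooth_on_incl with D; trivial; intros u v H; apply HB; trivial.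
      * intros [|] u v H; destruct (HB _ _ H) as (_ & _ & H');
          [generalize (H' i1)|generalize (H' i2)]; unfold C; lra.
    + assert (Hc0 : 0 <= c) by (apply Rle_trans with (2 := Hc (true, i1)), Rabs_pos).
      assert (HC : 0 <= C) by (unfold C; lra).
      assert (Q1 := Rmult_le_compat_l C _ _ HC (Hc (true, i1))).
      assert (Q2 := Rmult_le_compat_l C _ _ HC (Hc (true, i2))).
      assert (0 <= (Rabs (f x y) + 1) * c) by (apply Rmult_le_pos; lra).
      replace ((Rabs (f x y) + 1 + 2 * C) * c)
        with ((Rabs (f x y) + 1) * c + (C * c + C * c)) by ring; lra.
Qed.

Lemma small_radius_idx (P : idx -> R -> Prop) :
  (forall a, exists r0, 0 < r0 /\ forall r, 0 < r <= r0 -> P a r) ->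
  exists r0, 0 < r0 /\ forall r, 0 < r <= r0 -> forall a, P a r.
Proof.
  intros H; destruct (H i1) as (r1 & H1 & K1), (H i2) as (r2 & H2 & K2).
  exists (Rmin r1 r2); split; [apply Rmin_pos; trivial|].
  intros r Hr; assert (L1 := Rmin_l r1 r2); assert (L2 := Rmin_r r1 r2).
  intros [|]; [apply K1|apply K2]; lra.
Qed.

Lemma tame_geodesic_field z0 : D (z0 (true, i1)) (z0 (true, i2)) ->
  exists rho, 0 < rho /\ forall j, tame (cube z0 rho) (fun z => geodesic_field z j).
Proof.
  intros H0.
  destruct (small_radius_idx (fun a r => forall b c,
    tame (cube z0 r) (fun z => Gam a b c (z (true, i1)) (z (true, i2))))) as (r & Hr & H).
  { intro a; apply (small_radius_idx (fun b r => forall c, _)); intro b.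
    apply (small_radius_idx (fun c r => _)); intro c.
    apply tame_smooth; trivial. }
  exists r; split; trivial; specialize (H r (conj Hr (Rle_refl r))).
  assert (HJ : inhabited (bool * idx)) by exact (inhabits (true, i1)).
  assert (Hco : forall j, tame (cube z0 r) (fun z => z j)).
  { intro j; apply tame_coord with z0 r; [lra|]; intros z Hz; apply Hz. }
  intros [[|] a]; unfold geodesic_field, sum2; simpl; trivial.
  apply tame_opp; repeat apply tame_plus; repeat apply tame_mult; trivial.
Qed.

(** The geodesic field is Lipschitz only near the initial state.  Clamping the state to a
    cube makes it so everywhere, and a solution of the clamped equation stays inside the
    cube for a short time. *)
Lemma geodesic_exists u v (w : idx -> R) : D u v ->
  exists (X V : idx -> R -> R) (e : R), 0 < e /\
    X i1 0 = u /\ X i2 0 = v /\ (forall a, V a 0 = w a) /\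
    is_geodesic Gam X V (- e) e.
Proof.
  intros Huv.
  pose (z0 := fun j : bool * idx => if fst j then match snd j with i1 => u | i2 => v end
                                    else w (snd j)).
  destruct (tame_geodesic_field z0 Huv) as (rho & Hrho & HT).
  pose (cl := fun (z : bool * idx -> R) j => clamp (z0 j - rho) (z0 j + rho) (z j)).
  assert (Hcl : forall z, cube z0 rho (cl z)).
  { intros z j; assert (H := clamp_range (z0 j - rho) (z0 j + rho) (z j)).
    apply Rabs_le; unfold cl; lra. }
  assert (HM : exists M, 0 < M /\ forall j,
     (forall z, Rabs (geodesic_field (cl z) j) <= M) /\
     forall z z' c, (forall j, Rabs (z j - z' j) <= c) ->
       Rabs (geodesic_field (cl z) j - geodesic_field (cl z') j) <= M * c).
  { destruct (HT (true, i1)) as (M1 & N1 & B1 & L1), (HT (true, i2)) as (M2 & N2 & B2 & L2),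
      (HT (false, i1)) as (M3 & N3 & B3 & L3), (HT (false, i2)) as (M4 & N4 & B4 & L4).
    exists (M1 + M2 + M3 + M4 + 1); split; [lra|].
    assert (Hle : forall z z' c, (forall j, Rabs (z j - z' j) <= c) ->
       0 <= c /\ forall j, Rabs (cl z j - cl z' j) <= c).
    { intros z z' c Hc; split.
      - apply Rle_trans with (2 := Hc (true, i1)), Rabs_pos.
      - intro j; apply Rle_trans with (2 := Hc j), clamp_lipschitz. }
    intros [[|] [|]]; (split; [intro z; eapply Rle_trans; [eauto|lra]|]);
      intros z z' c Hc; destruct (Hle z z' c Hc) as [Hc0 Hc'];
      (eapply Rle_trans; [eauto|]); apply Rmult_le_compat_r; lra. }
  destruct HM as (M & HM & HMj).
  destruct (picard_lindelof (fun z j => geodesic_field (cl z) j) M z0 HM)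
    as (z & Hz0 & d & Hd & Hz).
  - intros z j; apply (HMj j).
  - intros z z' c Hc j; apply (HMj j); trivial.
  - assert (Hin : locally 0 (fun t => forall j, Rabs (z t j - z0 j) < rho)).
    { assert (Hj : forall j, locally 0 (fun t => Rabs (z t j - z0 j) < rho)).
      { intro j.
        assert (Hc : continuous (fun t => z t j) 0).
        { apply (ex_derive_continuous (fun t => z t j)); eexists; apply Hz.
          rewrite Rabs_R0; trivial. }
        assert (HP : locally (z 0 j) (fun r => Rabs (r - z0 j) < rho)).
        { exists (mkposreal rho Hrho); intros r Hr; rewrite Hz0 in Hr; exact Hr. }
        exact (Hc _ HP). }
      assert (H1 := filter_and _ _ (Hj (true, i1)) (Hj (true, i2))).
      assert (H2 := filter_and _ _ (Hj (false, i1)) (Hj (false, i2))).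
      generalize (filter_and _ _ H1 H2); apply filter_imp.
      intros t [[? ?] [? ?]] [[|] [|]]; trivial. }
    destruct Hin as [d' Hin].
    exists (fun a t => z t (true, a)), (fun a t => z t (false, a)), (Rmin d d').
    split; [apply Rmin_pos; trivial; apply cond_pos|].
    split; [rewrite Hz0; reflexivity|split; [rewrite Hz0; reflexivity|]].
    split; [intro a; rewrite Hz0; reflexivity|].
    intros r Hr0 a; assert (L1 := Rmin_l d d'); assert (L2 := Rmin_r d d').
    assert (Hr : Rabs r < d) by (apply Rabs_def1; lra).
    assert (Hr' : ball 0 d' r) by (change (Rabs (r - 0) < d'); apply Rabs_def1; lra).
    assert (Hid : forall j, cl (z r) j = z r j).
    { intro j; apply clamp_id.
      generalize (Hin r Hr' j); intro H'; apply Rabs_def2 in H'; lra. }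
    assert (Hx := Hz r Hr (true, a)); assert (Hv := Hz r Hr (false, a)).
    unfold geodesic_field, sum2 in Hx, Hv; simpl in Hx, Hv.
    rewrite !Hid in Hx; rewrite !Hid in Hv; unfold sum2; split; trivial.
Qed.
End Geodesic.

(** * Linear first integrals and the Killing equation *)

Definition killing_at (Gam : idx -> idx -> idx -> R -> R -> R)
  (K : idx -> R -> R -> R) (u v : R) : Prop :=
  forall a b, pd a (K b) u v + pd b (K a) u v
    = sum2 (fun c => (Gam c a b u v + Gam c b a u v) * K c u v).

Lemma is_derive_pairing D Gam K X V s t r : open2 D ->
  (forall a, smooth_on D (K a)) -> is_geodesic Gam X V s t -> s < r < t ->
  D (X i1 r) (X i2 r) ->
  is_derive (fun r => sum2 (fun a => K a (X i1 r) (X i2 r) * V a r)) r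
    (sum2 (fun a => sum2 (fun b => pd b (K a) (X i1 r) (X i2 r) * V a r * V b r))
     - sum2 (fun a => K a (X i1 r) (X i2 r) * sum2 (fun b => sum2 (fun c =>
           Gam a b c (X i1 r) (X i2 r) * V b r * V c r)))).
Proof.
  intros HD HK Hg Hr HX.
  destruct (Hg r Hr i1) as [X1 V1], (Hg r Hr i2) as [X2 V2].
  assert (HKa : forall a, is_derive (fun r => K a (X i1 r) (X i2 r)) r
    (pd i1 (K a) (X i1 r) (X i2 r) * V i1 r + pd i2 (K a) (X i1 r) (X i2 r) * V i2 r)).
  { intro a; apply is_derive_along with D; trivial. }
  assert (T1 := is_derive_mult (fun r => K i1 (X i1 r) (X i2 r)) (V i1) r _ _ (HKa i1) V1 Rmult_comm).
  assert (T2 := is_derive_mult (fun r => K i2 (X i1 r) (X i2 r)) (V i2) r _ _ (HKa i2) V2 Rmult_comm).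
  match type of T1 with is_derive _ _ ?x => match type of T2 with is_derive _ _ ?y =>
    evar_last; [exact (is_derive_plus _ _ r x y T1 T2)|] end end.
  unfold plus, mult, sum2; simpl; unfold sum2; ring.
Qed.

(** Differentiating the constant [K_a V^a] at a point of a geodesic gives the quadratic form
    of the symmetrised covariant derivative of [K] in the velocity; the velocity being
    arbitrary, the form vanishes. *)
Lemma first_integral_killing D Gam x y K : open2 D -> D x y ->
  (forall a b c, smooth_on D (Gam a b c)) ->
  linear_first_integral Gam x y K -> locally_2d (killing_at Gam K) x y.
Proof.
  intros HD Hxy HG (HK & _ & d & Hd).
  destruct (smooth_near_common K x y HK) as (d' & Hd' & HK').
  apply locally_2d_impl with (2 := HD x y Hxy).
  apply locally_2d_box; exists (Rmin d d').
  split; [apply Rmin_pos; trivial; apply cond_pos|].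
  intros u v Hb Huv.
  assert (Hb1 := box_incl _ _ _ _ _ _ (Rmin_l d d') Hb).
  assert (Hb2 := box_incl _ _ _ _ _ _ (Rmin_r d d') Hb).
  assert (Q : forall w : idx -> R,
    sum2 (fun a => sum2 (fun b => pd b (K a) u v * w a * w b))
     - sum2 (fun a => K a u v * sum2 (fun b => sum2 (fun c =>
           Gam a b c u v * w b * w c))) = 0).
  { intro w; destruct (geodesic_exists D Gam HD HG u v w Huv)
      as (X & V & e & He & E1 & E2 & EV & Hg).
    assert (HL : locally 0 (fun r => - e < r < e /\ box x y d (X i1 r) (X i2 r))).
    { assert (H0 : - e < 0 < e) by lra.
      assert (C : forall a, continuous (X a) 0).
      { intro a; apply (ex_derive_continuous (X a)); eexists; apply (Hg 0 H0 a). }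
      assert (L1 : locally (X i1 0) (fun z => Rabs (z - x) < d)).
      { apply locally_2d_1d_const_y with (y := v) (P := fun z _ => Rabs (z - x) < d).
        rewrite E1; apply locally_2d_impl with (2 := open2_box x y d u v Hb1).
        apply locally_2d_forall; intros ? ? [H _]; trivial. }
      assert (L2 : locally (X i2 0) (fun z => Rabs (z - y) < d)).
      { apply locally_2d_1d_const_x with (x := u) (P := fun _ z => Rabs (z - y) < d).
        rewrite E2; apply locally_2d_impl with (2 := open2_box x y d u v Hb1).
        apply locally_2d_forall; intros ? ? [_ H]; trivial. }
      apply filter_and; [|apply filter_and; [exact (C i1 _ L1)|exact (C i2 _ L2)]].
      apply (locally_interval _ 0 (- e) e); simpl; try lra; intros; lra. }
    destruct HL as [e' HL].
    assert (Hs : forall r, - e' < r < e' -> - e < r < e /\ box x y d (X i1 r) (X i2 r)).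
    { intros r Hr; apply HL; change (Rabs (r - 0) < e'); apply Rabs_def1; lra. }
    assert (He' := cond_pos e').
    assert (Hg' : is_geodesic Gam X V (- e') e').
    { intros r Hr; apply Hg, Hs, Hr. }
    assert (H0 : - e' < 0 < e') by lra.
    assert (Hbx : box x y d' (X i1 0) (X i2 0)) by (rewrite E1, E2; trivial).
    assert (T := is_derive_pairing (box x y d') Gam K X V (- e') e' 0
      (open2_box x y d') HK' Hg' H0 Hbx).
    apply is_derive_unique in T; revert T.
    unfold sum2; rewrite E1, E2, !EV; intros <-.
    assert (T0 : is_derive (fun r => sum2 (fun a => K a (X i1 r) (X i2 r) * V a r)) 0 0).
    { apply is_derive_ext_loc with
        (fun _ => sum2 (fun a => K a (X i1 0) (X i2 0) * V a 0)).
      - apply (locally_interval _ 0 (- e') e'); simpl; try lra; intros r Hr1 Hr2.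
        apply (Hd X V (- e') e' Hg'); try lra.
        intros r' Hr'; apply Hs, Hr'.
      - apply is_derive_Reals, derivable_pt_lim_const. }
    apply is_derive_unique in T0; exact T0. }
  (* three velocities determine a binary quadratic form *)
  assert (Q1 := Q (fun a => match a with i1 => 1 | i2 => 0 end)).
  assert (Q2 := Q (fun a => match a with i1 => 0 | i2 => 1 end)).
  assert (Q3 := Q (fun a => match a with i1 => 1 | i2 => 1 end)).
  unfold sum2 in Q1, Q2, Q3.
  intros [|] [|]; unfold sum2; lra.
Qed.

Lemma killing_first_integral Gam x y K :
  (forall a, smooth_near (K a) x y) ->
  ~ locally_2d (fun u v => forall a, K a u v = 0) x y ->
  locally_2d (killing_at Gam K) x y -> linear_first_integral Gam x y K.
Proof.
  intros HK H0 Hkill; split; [trivial|split; trivial].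
  generalize (locally_2d_and _ _ _ _ Hkill (locally_2d_and _ _ _ _ (HK i1) (HK i2))); intro H.
  apply locally_2d_box in H; destruct H as (d & Hd & H).
  assert (HK' : forall a, smooth_on (box x y d) (K a)).
  { intros [|] n u v Huv; destruct (H u v Huv) as (_ & ? & ?); trivial. }
  exists (mkposreal d Hd); simpl; intros X V s t Hg Hb.
  assert (Hder : forall r, s < r < t ->
    is_derive (fun r => sum2 (fun a => K a (X i1 r) (X i2 r) * V a r)) r 0).
  { intros r Hr; assert (Hbr : box x y d (X i1 r) (X i2 r)) by exact (Hb r Hr).
    assert (T := is_derive_pairing (box x y d) Gam K X V s t r
      (open2_box x y d) HK' Hg Hr Hbr).
    evar_last; [exact T|].
    destruct (H _ _ Hbr) as (Hk & _).
    assert (K11 := Hk i1 i1); assert (K12 := Hk i1 i2); assert (K22 := Hk i2 i2).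
    unfold sum2 in *.
    set (k1 := K i1 (X i1 r) (X i2 r)) in *; set (k2 := K i2 (X i1 r) (X i2 r)) in *.
    match goal with |- ?x = 0 =>
      replace x with
       ((pd i1 (K i1) (X i1 r) (X i2 r) - (Gam i1 i1 i1 (X i1 r) (X i2 r) * k1
          + Gam i2 i1 i1 (X i1 r) (X i2 r) * k2)) * (V i1 r * V i1 r)
        + (pd i2 (K i2) (X i1 r) (X i2 r) - (Gam i1 i2 i2 (X i1 r) (X i2 r) * k1
          + Gam i2 i2 i2 (X i1 r) (X i2 r) * k2)) * (V i2 r * V i2 r)
        + (pd i1 (K i2) (X i1 r) (X i2 r) + pd i2 (K i1) (X i1 r) (X i2 r)
           - ((Gam i1 i1 i2 (X i1 r) (X i2 r) + Gam i1 i2 i1 (X i1 r) (X i2 r)) * k1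
          + (Gam i2 i1 i2 (X i1 r) (X i2 r) + Gam i2 i2 i1 (X i1 r) (X i2 r)) * k2))
          * (V i1 r * V i2 r)) by ring end.
    rewrite K12.
    replace (pd i1 (K i1) (X i1 r) (X i2 r)) with (Gam i1 i1 i1 (X i1 r) (X i2 r) * k1
          + Gam i2 i1 i1 (X i1 r) (X i2 r) * k2) by lra.
    replace (pd i2 (K i2) (X i1 r) (X i2 r)) with (Gam i1 i2 i2 (X i1 r) (X i2 r) * k1
          + Gam i2 i2 i2 (X i1 r) (X i2 r) * k2) by lra.
    ring. }
  intros r r' Hr Hr'.
  assert (Hconst : forall p q, s < p -> p < q -> q < t ->
    sum2 (fun a => K a (X i1 p) (X i2 p) * V a p) =
    sum2 (fun a => K a (X i1 q) (X i2 q) * V a q)).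
  { intros p q Hp Hpq Hq.
    apply (eq_is_derive (fun r => sum2 (fun a => K a (X i1 r) (X i2 r) * V a r))); trivial.
    intros r0 Hr0; apply Hder; lra. }
  destruct (Rtotal_order r r') as [Hl|[->|Hl]]; trivial.
  - apply Hconst; lra.
  - symmetry; apply Hconst; lra.
Qed.

(** * Killing one-forms are determined by finitely many data at a point *)

Lemma Rabs_plus_le a b p q : Rabs a <= p -> Rabs b <= q -> Rabs (a + b) <= p + q.
Proof. intros; apply Rle_trans with (1 := Rabs_triang _ _); lra. Qed.

Lemma Rabs_mult_le a b p q : Rabs a <= p -> Rabs b <= q -> Rabs (a * b) <= p * q.
Proof. intros; rewrite Rabs_mult; apply Rmult_le_compat; auto using Rabs_pos. Qed.

(** Uniqueness along the horizontal line through the centre, then along vertical lines. *)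
Lemma linear_system_zero {I : Type} (f : I -> R -> R -> R) x y d C m :
  0 < d -> 0 <= C -> 0 <= m -> C * (2 * d) <= 1 / 2 ->
  (forall a i u v, box x y d u v -> is_pd a (f i) u v (pd a (f i) u v)) ->
  (forall u v c, box x y d u v -> 0 <= c -> (forall i, Rabs (f i u v) <= c) ->
     forall a i, Rabs (pd a (f i) u v) <= C * c) ->
  (forall i u v, box x y d u v -> Rabs (f i u v) <= m) ->
  (forall i, f i x y = 0) -> forall i u v, box x y d u v -> f i u v = 0.
Proof.
  intros Hd HC Hm HCd Hpd Hb Hfm H0.
  assert (Hbx : forall u, x - d < u < x + d -> Rabs (u - x) < d)
    by (intros; apply Rabs_def1; lra).
  assert (Hby : forall v, y - d < v < y + d -> Rabs (v - y) < d)
    by (intros; apply Rabs_def1; lra).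
  assert (Hyy : Rabs (y - y) < d) by (apply Hby; lra).
  assert (Hrow : forall u i, x - d < u < x + d -> f i u y = 0).
  { apply (ode_zero (fun u i => f i u y) (fun u i => pd i1 (f i) u y)
             (x - d) (x + d) x C m); trivial.
    - intros u i Hu; apply (Hpd i1); split; auto.
    - intros u c Hu Hc Hf i; apply Hb; trivial; split; auto.
    - intros u i Hu; apply Hfm; split; auto.
    - replace (x + d - (x - d)) with (2 * d) by ring; trivial.
    - lra. }
  intros i u v [Hu Hv]; apply Rabs_def2 in Hu; apply Rabs_def2 in Hv.
  assert (Hu' : Rabs (u - x) < d) by (apply Rabs_def1; lra).
  apply (ode_zero (fun v i => f i u v) (fun v i => pd i2 (f i) u v)
             (y - d) (y + d) y C m); trivial; try lra.
  - intros w j Hw; apply (Hpd i2); split; auto.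
  - intros w c Hw Hc Hf j; apply Hb; trivial; split; auto.
  - intros w j Hw; apply Hfm; split; auto.
  - intro j; apply Hrow; lra.
Qed.

Section Killing.
Variables (D : R -> R -> Prop) (Gam : idx -> idx -> idx -> R -> R -> R).
Hypothesis HD : open2 D.
Hypothesis HGam : forall a b c, smooth_on D (Gam a b c).

(** The Killing equation prolongs to a closed linear system for [K] and [F = d_1 K_2]:
    the derivatives of [F] are obtained by differentiating the three Killing equations. *)
Definition killing_jet (K : idx -> R -> R -> R) (i : option idx) : R -> R -> R :=
  match i with Some a => K a | None => pd i1 (K i2) end.

Definition killing_rhs (K : idx -> R -> R -> R) (a b : idx) (u v : R) : R :=
  sum2 (fun c => (Gam c a b u v + Gam c b a u v) * K c u v).

(** With [K] and [F] bounded by [c], the Killing equations bound the first derivatives of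
    [K] by [5 B c], hence those of their right-hand sides by [24 B^2 c]; the derivatives of
    [F] cost at most one and a half times the latter. *)
Lemma killing_jet_bound D' K B u v c : open2 D' ->
  (forall u v, D' u v -> D u v) -> (forall a, smooth_on D' (K a)) ->
  (forall u v, D' u v -> killing_at Gam K u v) -> D' u v ->
  1 <= B -> (forall a b c, Rabs (Gam a b c u v) <= B) ->
  (forall e a b c, Rabs (pd e (Gam a b c) u v) <= B) ->
  0 <= c -> (forall i, Rabs (killing_jet K i u v) <= c) ->
  forall e i, Rabs (pd e (killing_jet K i) u v) <= (36 * B * B) * c.
Proof.
  intros HD' Hincl HK Hkill Huv HB HG HdG Hc Hj.
  assert (HG' : forall a b c, smooth_on D' (Gam a b c)).
  { intros; apply smooth_on_incl with D; trivial. }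
  assert (HGs : forall a b c, smooth_on D' (fun u v => Gam c a b u v + Gam c b a u v)).
  { intros; apply smooth_on_plus; trivial. }
  assert (HS : forall a b, smooth_on D' (killing_rhs K a b)).
  { intros; apply smooth_on_sum2; trivial; intro; apply smooth_on_mult; trivial. }
  assert (BcB : B * c <= B * B * c).
  { apply Rmult_le_compat_r; trivial.
    rewrite <- (Rmult_1_l B) at 1; apply Rmult_le_compat_r; lra. }
  assert (cB : c <= B * c).
  { rewrite <- (Rmult_1_l c) at 1; apply Rmult_le_compat_r; lra. }
  assert (HKc : forall a, Rabs (K a u v) <= c) by (intro a; exact (Hj (Some a))).
  assert (HF : Rabs (pd i1 (K i2) u v) <= c) by exact (Hj None).
  assert (BS : forall a b, Rabs (killing_rhs K a b u v) <= 4 * B * c).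
  { intros a b; unfold killing_rhs, sum2.
    replace (4 * B * c) with ((B + B) * c + (B + B) * c) by ring.
    apply Rabs_plus_le; apply Rabs_mult_le; trivial; apply Rabs_plus_le; trivial. }
  assert (E11 := fun u v H => Hkill u v H i1 i1).
  assert (E12 := fun u v H => Hkill u v H i1 i2).
  assert (E22 := fun u v H => Hkill u v H i2 i2).
  assert (BK : forall e a, Rabs (pd e (K a) u v) <= 5 * B * c).
  { assert (E : pd i1 (K i1) u v = / 2 * killing_rhs K i1 i1 u v)
      by (unfold killing_rhs; rewrite <- E11; trivial; field).
    assert (E' : pd i2 (K i2) u v = / 2 * killing_rhs K i2 i2 u v)
      by (unfold killing_rhs; rewrite <- E22; trivial; field).
    assert (E'' : pd i2 (K i1) u v = killing_rhs K i1 i2 u v + - pd i1 (K i2) u v)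
      by (unfold killing_rhs; rewrite <- E12; trivial; ring).
    assert (H2 : Rabs (/ 2) <= 1) by (rewrite Rabs_pos_eq; lra).
    assert (H4 : 0 <= B * c) by lra.
    intros [|] [|].
    - rewrite E; apply Rle_trans with (1 * (4 * B * c)); [|lra].
      apply Rabs_mult_le; trivial.
    - lra.
    - rewrite E''; apply Rle_trans with (4 * B * c + c); [|lra].
      apply Rabs_plus_le; trivial; rewrite Rabs_Ropp; trivial.
    - rewrite E'; apply Rle_trans with (1 * (4 * B * c)); [|lra].
      apply Rabs_mult_le; trivial. }
  assert (BdS : forall e a b, Rabs (pd e (killing_rhs K a b) u v) <= 24 * B * B * c).
  { intros e a b.
    assert (E : pd e (killing_rhs K a b) u v = sum2 (fun c =>
       (pd e (Gam c a b) u v + pd e (Gam c b a) u v) * K c u v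
       + (Gam c a b u v + Gam c b a u v) * pd e (K c) u v)).
    { apply is_pd_unique; unfold killing_rhs, sum2.
      assert (T : forall d, is_pd e (fun u v => (Gam d a b u v + Gam d b a u v) * K d u v) u v
        ((pd e (Gam d a b) u v + pd e (Gam d b a) u v) * K d u v
         + (Gam d a b u v + Gam d b a u v) * pd e (K d) u v)).
      { intro d; apply (is_pd_mult e (fun u v => Gam d a b u v + Gam d b a u v) (K d)).
        - apply (is_pd_plus e (Gam d a b) (Gam d b a)); apply smooth_on_is_pd with D'; trivial.
        - apply smooth_on_is_pd with D'; trivial. }
      exact (is_pd_plus e _ _ u v _ _ (T i1) (T i2)). }
    rewrite E; unfold sum2.
    apply Rle_trans with (((B + B) * c + (B + B) * (5 * B * c))
                          + ((B + B) * c + (B + B) * (5 * B * c))); [|lra].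
    repeat first [apply Rabs_plus_le | apply Rabs_mult_le]; trivial. }
  intros e [a|]; unfold killing_jet.
  - apply Rle_trans with (1 := BK e a); lra.
  - destruct e.
    + assert (E : pd i1 (pd i1 (K i2)) u v
        = pd i1 (killing_rhs K i1 i2) u v + - (/ 2 * pd i2 (killing_rhs K i1 i1) u v)).
      { apply is_pd_unique, is_pd_ext with
          (fun u v => killing_rhs K i1 i2 u v + - pd i2 (K i1) u v).
        - apply on_locally with D'; trivial; intros u' v' H.
          unfold killing_rhs; rewrite <- E12; trivial; ring.
        - apply is_pd_plus; [apply smooth_on_is_pd with D'; trivial|].
          apply is_pd_opp.
          replace (/ 2 * pd i2 (killing_rhs K i1 i1) u v) with (pd i1 (pd i2 (K i1)) u v).
          + apply smooth_on_is_pd with D'; trivial; apply smooth_on_pd; trivial.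
          + rewrite pd_comm with D' _ _ _; trivial.
            apply is_pd_unique, is_pd_ext with (fun u v => / 2 * killing_rhs K i1 i1 u v).
            * apply on_locally with D'; trivial; intros u' v' H.
              unfold killing_rhs; rewrite <- E11; trivial; field.
            * replace (/ 2 * pd i2 (killing_rhs K i1 i1) u v) with
                (0 * killing_rhs K i1 i1 u v + / 2 * pd i2 (killing_rhs K i1 i1) u v) by ring.
              apply (is_pd_mult i2 (fun _ _ => / 2)); [apply is_pd_const|].
              apply smooth_on_is_pd with D'; trivial. }
      rewrite E.
      apply Rle_trans with (24 * B * B * c + / 2 * (24 * B * B * c)); [|lra].
      apply Rabs_plus_le; trivial; rewrite Rabs_Ropp; apply Rabs_mult_le; trivial.
      rewrite Rabs_pos_eq; lra.
    + assert (E : pd i2 (pd i1 (K i2)) u v = / 2 * pd i1 (killing_rhs K i2 i2) u v).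
      { rewrite <- pd_comm with D' _ _ _; trivial.
        apply is_pd_unique, is_pd_ext with (fun u v => / 2 * killing_rhs K i2 i2 u v).
        * apply on_locally with D'; trivial; intros u' v' H.
          unfold killing_rhs; rewrite <- E22; trivial; field.
        * replace (/ 2 * pd i1 (killing_rhs K i2 i2) u v) with
            (0 * killing_rhs K i2 i2 u v + / 2 * pd i1 (killing_rhs K i2 i2) u v) by ring.
          apply (is_pd_mult i1 (fun _ _ => / 2)); [apply is_pd_const|].
          apply smooth_on_is_pd with D'; trivial. }
      rewrite E; assert (0 <= B * B * c) by lra.
      apply Rle_trans with (/ 2 * (24 * B * B * c)); [|lra].
      apply Rabs_mult_le; trivial; rewrite Rabs_pos_eq; lra.
Qed.

Variables x y : R.
Hypothesis Hxy : D x y.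

(** The bounds [B] and [m] are chosen before the size of the box, which can therefore be
    shrunk until the smallness condition of [ode_zero] holds for them. *)
Lemma killing_box K : (forall a, smooth_near (K a) x y) ->
  locally_2d (killing_at Gam K) x y ->
  exists B m, 1 <= B /\ 0 <= m /\ forall d0, 0 < d0 -> exists d, 0 < d <= d0 /\
    (forall u v, box x y d u v -> D u v) /\
    (forall a, smooth_on (box x y d) (K a)) /\
    (forall u v, box x y d u v -> killing_at Gam K u v) /\
    (forall u v, box x y d u v -> (forall a b c, Rabs (Gam a b c u v) <= B) /\
       (forall e a b c, Rabs (pd e (Gam a b c) u v) <= B) /\
       (forall i, Rabs (killing_jet K i u v) <= m)).
Proof.
  intros HK Hkill.
  destruct (smooth_near_common K x y HK) as (d1 & Hd1 & HK1).
  set (Gs := fun a b c => Rabs (Gam a b c x y)).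
  set (dGs := fun e a b c => Rabs (pd e (Gam a b c) x y)).
  assert (Gs0 : forall a b c, 0 <= Gs a b c) by (intros; apply Rabs_pos).
  assert (dGs0 : forall e a b c, 0 <= dGs e a b c) by (intros; apply Rabs_pos).
  set (s3 := fun F : idx -> idx -> idx -> R => sum2 (fun a => sum2 (fun b => sum2 (F a b)))).
  assert (Hs3 : forall F, (forall a b c, 0 <= F a b c) -> forall a b c, F a b c <= s3 F).
  { intros F HF a b c; unfold s3, sum2.
    generalize (HF i1 i1 i1) (HF i1 i1 i2) (HF i1 i2 i1) (HF i1 i2 i2)
      (HF i2 i1 i1) (HF i2 i1 i2) (HF i2 i2 i1) (HF i2 i2 i2).
    destruct a, b, c; lra. }
  assert (Hs30 : forall F, (forall a b c, 0 <= F a b c) -> 0 <= s3 F).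
  { intros F HF; apply Rle_trans with (2 := Hs3 F HF i1 i1 i1), HF. }
  exists (s3 Gs + (s3 (dGs i1) + s3 (dGs i2)) + 1).
  exists (Rabs (K i1 x y) + Rabs (K i2 x y) + Rabs (pd i1 (K i2) x y) + 1).
  assert (P1 := Rabs_pos (K i1 x y)); assert (P2 := Rabs_pos (K i2 x y)).
  assert (P3 := Rabs_pos (pd i1 (K i2) x y)).
  assert (Q1 := Hs30 Gs Gs0); assert (Q2 := Hs30 _ (dGs0 i1)); assert (Q3 := Hs30 _ (dGs0 i2)).
  split; [lra|split; [lra|]]; intros d0 Hd0.
  assert (L1 : locally_2d (fun u v => forall a b c,
     Rabs (Gam a b c u v) <= Rabs (Gam a b c x y) + 1) x y).
  { repeat (apply locally_2d_forall_idx; intro); apply smooth_on_bounded with D; trivial. }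
  assert (L2 : locally_2d (fun u v => forall e a b c,
     Rabs (pd e (Gam a b c) u v) <= Rabs (pd e (Gam a b c) x y) + 1) x y).
  { repeat (apply locally_2d_forall_idx; intro); apply smooth_on_bounded with D; trivial.
    apply smooth_on_pd; trivial. }
  assert (L3 : locally_2d (fun u v => forall a, Rabs (K a u v) <= Rabs (K a x y) + 1) x y).
  { apply locally_2d_forall_idx; intro; apply smooth_on_bounded with (box x y d1); trivial.
    apply box_center; trivial. }
  assert (L4 : locally_2d (fun u v =>
     Rabs (pd i1 (K i2) u v) <= Rabs (pd i1 (K i2) x y) + 1) x y).
  { apply smooth_on_bounded with (box x y d1); [apply smooth_on_pd; trivial|].
    apply box_center; trivial. }
  assert (L := locally_2d_and _ _ _ _ (HD x y Hxy) (locally_2d_and _ _ _ _ Hkill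
    (locally_2d_and _ _ _ _ L1 (locally_2d_and _ _ _ _ L2 (locally_2d_and _ _ _ _ L3 L4))))).
  apply locally_2d_box in L; destruct L as (d2 & Hd2 & L).
  exists (Rmin d0 (Rmin d1 d2)).
  assert (M1 := Rmin_l d0 (Rmin d1 d2)); assert (M2 := Rmin_r d0 (Rmin d1 d2)).
  assert (M3 := Rmin_l d1 d2); assert (M4 := Rmin_r d1 d2).
  split; [split; [repeat apply Rmin_pos; trivial|trivial]|].
  assert (Hin : forall u v, box x y (Rmin d0 (Rmin d1 d2)) u v -> box x y d2 u v).
  { intros u v; apply box_incl; lra. }
  split; [intros u v H; apply (L u v (Hin u v H))|].
  split.
  { intro a; apply smooth_on_incl with (box x y d1); trivial.
    intros u v; apply box_incl; lra. }
  split; [intros u v H; apply (L u v (Hin u v H))|].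
  intros u v H; destruct (L u v (Hin u v H)) as (_ & _ & B1 & B2 & B3 & B4).
  repeat split.
  - intros a b c; assert (H' : Rabs (Gam a b c x y) <= s3 Gs) by exact (Hs3 Gs Gs0 a b c).
    generalize (B1 a b c); lra.
  - intros e a b c; assert (H' : Rabs (pd e (Gam a b c) x y) <= s3 (dGs e))
      by exact (Hs3 (dGs e) (dGs0 e) a b c).
    generalize (B2 e a b c); destruct e; lra.
  - intros [[|]|]; unfold killing_jet; [generalize (B3 i1)|generalize (B3 i2)|generalize B4]; lra.
Qed.

Lemma killing_jet_zero K : (forall a, smooth_near (K a) x y) ->
  locally_2d (killing_at Gam K) x y ->
  (forall a, K a x y = 0) -> pd i1 (K i2) x y = 0 ->
  locally_2d (fun u v => forall a, K a u v = 0) x y.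
Proof.
  intros HK Hkill H0 H1.
  destruct (killing_box K HK Hkill) as (B & m & HB & Hm & Hbox).
  assert (HBB : 0 < 36 * B * B) by (repeat apply Rmult_lt_0_compat; lra).
  destruct (Hbox (/ (4 * (36 * B * B)))) as (d & [Hd Hdd] & HdD & Hs & Hk & Hb).
  { apply Rinv_0_lt_compat; lra. }
  apply locally_2d_box; exists d; split; trivial; intros u v Huv a.
  apply (linear_system_zero (killing_jet K) x y d (36 * B * B) m) with (i := Some a);
    trivial; try lra.
  - apply Rle_trans with (36 * B * B * (2 * / (4 * (36 * B * B)))).
    + apply Rmult_le_compat_l; lra.
    + apply Req_le; field; lra.
  - intros e [b|] u' v' H; unfold killing_jet; apply smooth_on_is_pd with (box x y d); trivial.
    apply smooth_on_pd; trivial.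
  - intros u' v' c H Hc Hi e i; destruct (Hb u' v' H) as (? & ? & _).
    apply killing_jet_bound with (box x y d); trivial; apply open2_box.
  - intros i u' v' H; apply Hb; trivial.
  - intros [b|]; unfold killing_jet; trivial.
Qed.

(** When [Gam^2_11 = Gam^1_22 = 0], the component [K_a] satisfies a homogeneous linear
    equation along the [a]-th coordinate lines, so it vanishes on a whole line or
    nowhere on it. *)
Lemma killing_component_line K : (forall a, smooth_near (K a) x y) ->
  locally_2d (killing_at Gam K) x y ->
  (forall u v, D u v -> Gam i2 i1 i1 u v = 0 /\ Gam i1 i2 i2 u v = 0) ->
  exists d, 0 < d /\
    (forall u u' v, box x y d u v -> box x y d u' v -> K i1 u v = 0 -> K i1 u' v = 0) /\
    (forall u v v', box x y d u v -> box x y d u v' -> K i2 u v = 0 -> K i2 u v' = 0).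
Proof.
  intros HK Hkill HG0.
  destruct (killing_box K HK Hkill) as (B & m & HB & Hm & Hbox).
  destruct (Hbox (/ (4 * B))) as (d & [Hd Hdd] & HdD & Hs & Hk & Hb).
  { apply Rinv_0_lt_compat; lra. }
  assert (Hsmall : B * (2 * d) <= 1 / 2).
  { apply Rle_trans with (B * (2 * / (4 * B))).
    - apply Rmult_le_compat_l; lra.
    - apply Req_le; field; lra. }
  assert (Hbound : forall u v c, box x y d u v ->
    (Rabs (K i1 u v) <= c -> Rabs (pd i1 (K i1) u v) <= B * c) /\
    (Rabs (K i2 u v) <= c -> Rabs (pd i2 (K i2) u v) <= B * c)).
  { intros u v c H; destruct (Hb u v H) as (HB1 & _ & _).
    destruct (HG0 u v (HdD u v H)) as [G1 G2].
    assert (E1 := Hk u v H i1 i1); assert (E2 := Hk u v H i2 i2); unfold sum2 in E1, E2.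
    rewrite G1 in E1; rewrite G2 in E2; split; intro Hc.
    - replace (pd i1 (K i1) u v) with (Gam i1 i1 i1 u v * K i1 u v) by lra.
      apply Rabs_mult_le; trivial.
    - replace (pd i2 (K i2) u v) with (Gam i2 i2 i2 u v * K i2 u v) by lra.
      apply Rabs_mult_le; trivial. }
  exists d; split; trivial; split.
  - intros u u' v [Hu Hv] [Hu' _] H0; apply Rabs_def2 in Hu; apply Rabs_def2 in Hu'.
    assert (Hin : forall t, x - d < t < x + d -> box x y d t v).
    { intros t Ht; split; trivial; apply Rabs_def1; lra. }
    apply (ode_zero (fun u (_ : unit) => K i1 u v) (fun u _ => pd i1 (K i1) u v)
             (x - d) (x + d) u B m); trivial; try exact tt; try lra.
    + intros t _ Ht; apply (smooth_on_is_pd (box x y d) i1); auto.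
    + intros t c Ht Hc Hf _; apply (Hbound t v c (Hin t Ht)); exact (Hf tt).
    + intros t _ Ht; destruct (Hb t v (Hin t Ht)) as (_ & _ & Hj); exact (Hj (Some i1)).
  - intros u v v' [Hu Hv] [_ Hv'] H0; apply Rabs_def2 in Hv; apply Rabs_def2 in Hv'.
    assert (Hin : forall t, y - d < t < y + d -> box x y d u t).
    { intros t Ht; split; trivial; apply Rabs_def1; lra. }
    apply (ode_zero (fun v (_ : unit) => K i2 u v) (fun v _ => pd i2 (K i2) u v)
             (y - d) (y + d) v B m); trivial; try exact tt; try lra.
    + intros t _ Ht; apply (smooth_on_is_pd (box x y d) i2); auto.
    + intros t c Ht Hc Hf _; apply (Hbound u t c (Hin t Ht)); exact (Hf tt).
    + intros t _ Ht; destruct (Hb u t (Hin t Ht)) as (_ & _ & Hj); exact (Hj (Some i2)).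
Qed.

(** If [K_1] is nonzero at one point then it is nonzero on the whole row through it, so
    [K_2] vanishes on that row, hence on every column crossing it. *)
Lemma killing_component_vanishes K : (forall a, smooth_near (K a) x y) ->
  locally_2d (killing_at Gam K) x y ->
  (forall u v, D u v -> Gam i2 i1 i1 u v = 0 /\ Gam i1 i2 i2 u v = 0) ->
  locally_2d (fun u v => K i1 u v = 0 \/ K i2 u v = 0) x y ->
  exists a, locally_2d (fun u v => K a u v = 0) x y.
Proof.
  intros HK Hkill HG0 Hprod.
  destruct (killing_component_line K HK Hkill HG0) as (d & Hd & H1 & H2).
  apply locally_2d_box in Hprod; destruct Hprod as (d' & Hd' & Hprod).
  pose (r := Rmin d d').
  assert (Hr : 0 < r) by (apply Rmin_pos; trivial).
  assert (Hb1 : forall u v, box x y r u v -> box x y d u v)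
    by (intros u v; apply box_incl, Rmin_l).
  assert (Hb2 : forall u v, box x y r u v -> box x y d' u v)
    by (intros u v; apply box_incl, Rmin_r).
  destruct (classic (forall u v, box x y r u v -> K i1 u v = 0)) as [H|H].
  - exists i1; apply locally_2d_box; exists r; auto.
  - exists i2; apply locally_2d_box; exists r; split; trivial.
    apply not_all_ex_not in H; destruct H as [u0 H].
    apply not_all_ex_not in H; destruct H as [v0 H].
    apply imply_to_and in H; destruct H as [[Hu0 Hv0] H].
    intros u v [Hu Hv].
    (* the point where a row of nonzero [K_1] meets the column of (u, v) *)
    assert (Hc : box x y r u v0) by (split; trivial).
    apply H2 with v0; auto; [apply Hb1; split; trivial|].
    destruct (Hprod u v0 (Hb2 _ _ Hc)) as [E|E]; trivial.
    exfalso; apply H; apply H1 with u; auto; apply Hb1; split; trivial.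
Qed.

(** An identically vanishing component makes [F = d_1 K_2] at the point a combination of
    the values of [K], so that the jet vanishes together with [K]. *)
Lemma killing_degenerate_zero K a : (forall a, smooth_near (K a) x y) ->
  locally_2d (killing_at Gam K) x y ->
  locally_2d (fun u v => K a u v = 0) x y -> (forall b, K b x y = 0) ->
  locally_2d (fun u v => forall b, K b u v = 0) x y.
Proof.
  intros HK Hkill Ha H0; apply killing_jet_zero; trivial.
  destruct a.
  - assert (E := locally_2d_singleton _ _ _ Hkill i1 i2).
    unfold sum2 in E; rewrite !H0, !Rmult_0_r, Rplus_0_r in E.
    assert (E' : pd i2 (K i1) x y = 0).
    { apply is_pd_unique, is_pd_ext with (fun _ _ => 0); [|apply is_pd_const].
      apply locally_2d_impl with (2 := Ha), locally_2d_forall; auto. }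
    lra.
  - apply is_pd_unique, is_pd_ext with (fun _ _ => 0); [|apply is_pd_const].
    apply locally_2d_impl with (2 := Ha), locally_2d_forall; auto.
Qed.
End Killing.

(** * Counting independent germs *)

Lemma sum_linear (a b : nat -> R) t n m :
  sum_n_m (fun k => a k + t * b k) n m = sum_n_m a n m + t * sum_n_m b n m.
Proof.
  generalize (sum_n_m_plus a (fun k => t * b k) n m) (sum_n_m_mult_l t b n m).
  unfold plus, mult; simpl; intros E1 E2.
  rewrite E1; f_equal; exact E2.
Qed.

Lemma sum_scal (b : nat -> R) t n m :
  sum_n_m (fun k => t * b k) n m = t * sum_n_m b n m.
Proof. exact (sum_n_m_mult_l t b n m). Qed.

Lemma sum_ext (a b : nat -> R) n m :
  (forall k, (n <= k <= m)%nat -> a k = b k) -> sum_n_m a n m = sum_n_m b n m.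
Proof. apply (sum_n_m_ext_loc a b). Qed.

Lemma sum_one (a : nat -> R) : sum_n_m a 1 1 = a 1%nat.
Proof. apply (sum_n_n a). Qed.

Lemma sum_last (a : nat -> R) n : sum_n_m a 1 (S n) = sum_n_m a 1 n + a (S n).
Proof. apply (sum_n_Sm a 1 n); lia. Qed.

Lemma sum_two (a : nat -> R) n : (2 <= n)%nat ->
  (forall k, (2 < k)%nat -> a k = 0) -> sum_n_m a 1 n = a 1%nat + a 2%nat.
Proof.
  intros Hn Ha; induction Hn as [|n Hn IH].
  - rewrite sum_last, sum_one; reflexivity.
  - rewrite sum_last, IH, (Ha (S n)) by lia. apply Rplus_0_r.
Qed.

Lemma sum_three (a : nat -> R) : sum_n_m a 1 3 = a 1%nat + a 2%nat + a 3%nat :> R.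
Proof. rewrite 2!sum_last, sum_one; reflexivity. Qed.

Lemma eventually_affine_neq d c : c <> 0 -> Rbar_locally p_infty (fun t => d + t * c <> 0).
Proof.
  intros Hc; exists (Rabs (d / c)); intros t Ht E.
  assert (H : t = - (d / c)) by (field_simplify_eq; trivial; lra).
  generalize (Rle_abs (- (d / c))); rewrite Rabs_Ropp; lra.
Qed.

Lemma eventually_finite (P : nat -> R -> Prop) n :
  (forall k, (1 <= k <= n)%nat -> Rbar_locally p_infty (P k)) ->
  Rbar_locally p_infty (fun t => forall k, (1 <= k <= n)%nat -> P k t).
Proof.
  induction n as [|n IH]; intros H.
  - apply filter_forall; intros; lia.
  - assert (H1 : Rbar_locally p_infty (fun t => forall k, (1 <= k <= n)%nat -> P k t)).
    { apply IH; intros; apply H; lia. }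
    generalize (filter_and _ _ H1 (H (S n) ltac:(lia))); apply filter_imp.
    intros t [H2 H3] k Hk; destruct (Nat.eq_dec k (S n)) as [->|]; trivial.
    apply H2; lia.
Qed.

(** The translates [w_k + t K0] can only become dependent when [K0] is a combination
    [sum alpha_k w_k] and [1 + t sum alpha_k = 0]. *)
Lemma lin_indep_translate {I : Type} n (w : nat -> I -> R -> R -> R) (K0 : I -> R -> R -> R) x y :
  lin_indep_near n w x y ->
  Rbar_locally p_infty (fun t =>
    lin_indep_near n (fun k a u v => w k a u v + t * K0 a u v) x y).
Proof.
  intros Hw.
  assert (Hsplit : forall t c,
    locally_2d (fun u v => forall a : I,
      sum_n_m (fun k => c k * (w k a u v + t * K0 a u v)) 1 n = 0) x y ->
    locally_2d (fun u v => forall a : I,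
      sum_n_m (fun k => c k * w k a u v) 1 n + t * sum_n_m c 1 n * K0 a u v = 0) x y).
  { intros t c H; apply locally_2d_impl with (2 := H), locally_2d_forall.
    intros u v E a; rewrite <- (E a).
    rewrite (sum_ext (fun k => c k * (w k a u v + t * K0 a u v))
      (fun k => c k * w k a u v + (t * K0 a u v) * c k)) by (intros; ring).
    rewrite sum_linear; ring. }
  destruct (classic (exists al, locally_2d (fun u v => forall a : I,
     K0 a u v = sum_n_m (fun k => al k * w k a u v) 1 n) x y)) as [[al Hal]|Hno].
  - assert (He : Rbar_locally p_infty (fun t => 1 + t * sum_n_m al 1 n <> 0)).
    { destruct (Req_dec (sum_n_m al 1 n) 0) as [E|E].
      - apply filter_forall; intros t; rewrite E; lra.
      - apply eventually_affine_neq; trivial. }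
    apply filter_imp with (2 := He); intros t Ht c Hc k Hk.
    set (s := sum_n_m c 1 n) in *.
    assert (E : forall k, (1 <= k <= n)%nat -> c k + (t * s) * al k = 0).
    { apply Hw.
      apply locally_2d_impl with (2 := locally_2d_and _ _ _ _ (Hsplit t c Hc) Hal).
      apply locally_2d_forall; intros u v [E1 E2] a; rewrite <- (E1 a), (E2 a).
      rewrite (sum_ext _ (fun k => c k * w k a u v + (t * s) * (al k * w k a u v)))
        by (intros; ring).
      rewrite sum_linear; reflexivity. }
    assert (Es : s * (1 + t * sum_n_m al 1 n) = 0).
    { replace (s * (1 + t * sum_n_m al 1 n)) with (s + (t * s) * sum_n_m al 1 n) by ring.
      unfold s at 1; rewrite <- sum_linear.
      rewrite (sum_ext _ (fun _ => 0 * 0)) by (intros j Hj; rewrite (E j Hj); ring).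
      rewrite sum_scal; apply Rmult_0_l. }
    apply Rmult_integral in Es; destruct Es as [Es|Es]; [|contradiction].
    generalize (E k Hk); rewrite Es; lra.
  - exists 0; intros t Ht c Hc k Hk.
    specialize (Hsplit t c Hc); set (s := sum_n_m c 1 n) in *.
    destruct (Req_dec s 0) as [E|E].
    + apply Hw; trivial.
      apply locally_2d_impl with (2 := Hsplit), locally_2d_forall.
      intros u v E1 a; rewrite <- (E1 a), E, Rmult_0_r, Rmult_0_l; symmetry; apply Rplus_0_r.
    + exfalso; apply Hno; exists (fun k => - / (t * s) * c k).
      apply locally_2d_impl with (2 := Hsplit), locally_2d_forall.
      intros u v E1 a.
      rewrite (sum_ext _ (fun k => - / (t * s) * (c k * w k a u v))) by (intros; ring).
      rewrite sum_scal; generalize (E1 a); intro E2.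
      replace (sum_n_m (fun k => c k * w k a u v) 1 n) with (- (t * s * K0 a u v)) by lra.
      field; split; lra.
Qed.

Lemma has_indep_impl {I : Type} (P Q : (I -> R -> R -> R) -> Prop) n x y :
  (forall K, P K -> Q K) -> has_indep P n x y -> has_indep Q n x y.
Proof. intros H (w & Hw & Hi); exists w; split; auto. Qed.

Lemma has_indep_map {I J : Type} (P : (I -> R -> R -> R) -> Prop)
  (Q : (J -> R -> R -> R) -> Prop) (T : (I -> R -> R -> R) -> J -> R -> R -> R) n x y :
  (forall w, P w -> Q (T w)) ->
  (forall w c, (forall k, (1 <= k <= n)%nat -> P (w k)) ->
     locally_2d (fun u v => forall b, sum_n_m (fun k => c k * T (w k) b u v) 1 n = 0) x y ->
     locally_2d (fun u v => forall a, sum_n_m (fun k => c k * w k a u v) 1 n = 0) x y) ->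
  has_indep P n x y -> has_indep Q n x y.
Proof.
  intros HPQ HT (w & Hw & Hi); exists (fun k => T (w k)); split.
  - intros k Hk; apply HPQ, Hw, Hk.
  - intros c Hc; apply Hi, HT; trivial.
Qed.

Lemma two_equations_three_unknowns p1 p2 p3 q1 q2 q3 : exists c1 c2 c3,
  (c1 <> 0 \/ c2 <> 0 \/ c3 <> 0) /\
  c1 * p1 + c2 * p2 + c3 * p3 = 0 /\ c1 * q1 + c2 * q2 + c3 * q3 = 0.
Proof.
  destruct (Req_dec (p2 * q3 - p3 * q2) 0) as [E1|E1].
  2: exists (p2 * q3 - p3 * q2), (p3 * q1 - p1 * q3), (p1 * q2 - p2 * q1);
     split; [auto|split; ring].
  destruct (Req_dec p2 0) as [H2|H2].
  - destruct (Req_dec p3 0) as [H3|H3].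
    + destruct (Req_dec q2 0) as [G2|G2].
      * exists 0, 1, 0; subst; split; [lra|split; ring].
      * exists 0, q3, (- q2); subst; split; [lra|split; ring].
    + exists 0, p3, (- p2); split; [lra|split; [ring|lra]].
  - exists 0, p3, (- p2); split; [lra|split; [ring|lra]].
Qed.

Section Count.
Variables (D : R -> R -> Prop) (Gam : idx -> idx -> idx -> R -> R -> R).
Hypothesis HD : open2 D.
Hypothesis HGam : forall a b c, smooth_on D (Gam a b c).

Definition killing_form (x y : R) (K : idx -> R -> R -> R) : Prop :=
  (forall a, smooth_near (K a) x y) /\ locally_2d (killing_at Gam K) x y.

Lemma killing_form_first_integral x y K : D x y ->
  (linear_first_integral Gam x y K <->
   killing_form x y K /\ ~ locally_2d (fun u v => forall a, K a u v = 0) x y).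
Proof.
  intro Hxy; split.
  - intros HK; assert (H := HK); destruct H as (H1 & H2 & _); repeat split; trivial.
    apply first_integral_killing with D; trivial.
  - intros [[H1 H2] H3]; apply killing_first_integral; trivial.
Qed.

Lemma killing_form_combination x y K L c e : killing_form x y K -> killing_form x y L ->
  killing_form x y (fun a u v => c * K a u v + e * L a u v).
Proof.
  intros [HK Hk] [HL Hl].
  destruct (smooth_near_common K x y HK) as (d & Hd & HKd).
  destruct (smooth_near_common L x y HL) as (d' & Hd' & HLd).
  pose (B := box x y (Rmin d d')).
  assert (HB : open2 B) by apply open2_box.
  assert (HBxy : B x y) by (apply box_center, Rmin_pos; trivial).
  assert (HK' : forall a, smooth_on B (K a)).
  { intro a; apply smooth_on_incl with (2 := HKd a); intros u v; apply box_incl, Rmin_l. }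
  assert (HL' : forall a, smooth_on B (L a)).
  { intro a; apply smooth_on_incl with (2 := HLd a); intros u v; apply box_incl, Rmin_r. }
  assert (Hpd : forall b a u v, B u v ->
    pd b (fun u v => c * K a u v + e * L a u v) u v = c * pd b (K a) u v + e * pd b (L a) u v).
  { intros b a u v Huv; apply is_pd_unique.
    replace (c * pd b (K a) u v + e * pd b (L a) u v) with
      ((0 * K a u v + c * pd b (K a) u v) + (0 * L a u v + e * pd b (L a) u v)) by ring.
    apply (is_pd_plus b (fun u v => c * K a u v) (fun u v => e * L a u v)).
    - apply (is_pd_mult b (fun _ _ => c) (K a)); [apply is_pd_const|].
      apply smooth_on_is_pd with B; trivial.
    - apply (is_pd_mult b (fun _ _ => e) (L a)); [apply is_pd_const|].
      apply smooth_on_is_pd with B; trivial. }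
  split.
  - intro a; apply smooth_on_near with B; trivial.
    apply smooth_on_plus; trivial; apply smooth_on_mult; trivial; apply smooth_on_const; trivial.
  - generalize (locally_2d_and _ _ _ _ (HB x y HBxy) (locally_2d_and _ _ _ _ Hk Hl)).
    apply locally_2d_impl, locally_2d_forall; intros u v (Huv & H1 & H2) a b.
    rewrite !Hpd by trivial.
    replace (c * pd a (K b) u v + e * pd a (L b) u v + (c * pd b (K a) u v + e * pd b (L a) u v))
      with (c * (pd a (K b) u v + pd b (K a) u v) + e * (pd a (L b) u v + pd b (L a) u v)) by ring.
    rewrite H1, H2; unfold sum2; ring.
Qed.

Lemma killing_form_pd_combination x y K L c e b a : killing_form x y K -> killing_form x y L ->
  pd b (fun u v => c * K a u v + e * L a u v) x y = c * pd b (K a) x y + e * pd b (L a) x y.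
Proof.
  intros [HK _] [HL _].
  destruct (smooth_near_common K x y HK) as (d & Hd & HKd).
  destruct (smooth_near_common L x y HL) as (d' & Hd' & HLd).
  apply is_pd_unique.
  replace (c * pd b (K a) x y + e * pd b (L a) x y) with
    ((0 * K a x y + c * pd b (K a) x y) + (0 * L a x y + e * pd b (L a) x y)) by ring.
  apply (is_pd_plus b (fun u v => c * K a u v) (fun u v => e * L a u v)).
  - apply (is_pd_mult b (fun _ _ => c) (K a)); [apply is_pd_const|].
    apply smooth_on_is_pd with (box x y d); trivial; apply box_center; trivial.
  - apply (is_pd_mult b (fun _ _ => e) (L a)); [apply is_pd_const|].
    apply smooth_on_is_pd with (box x y d'); trivial; apply box_center; trivial.
Qed.

Definition nondegenerate_killing (x y : R) (K : idx -> R -> R -> R) : Prop :=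
  killing_form x y K /\ forall a, K a x y <> 0.

Lemma nondegenerate_killing_first_integral x y K : D x y ->
  (nondegenerate_killing x y K <->
   linear_first_integral Gam x y K /\ forall a, K a x y <> 0).
Proof.
  intros Hxy; unfold nondegenerate_killing; rewrite killing_form_first_integral by trivial.
  split; [|tauto]; intros [H1 H2]; repeat split; trivial; try apply H1.
  intro H; apply (H2 i1), (locally_2d_singleton _ _ _ H).
Qed.

(** Non-degeneracy at the point is an open dense condition on a space containing one
    nondegenerate element: every family can be moved into it along that element. *)
Lemma has_indep_nondegenerate x y n : D x y -> (exists K0, nondegenerate_killing x y K0) ->
  (has_indep (linear_first_integral Gam x y) n x y <->
   has_indep (nondegenerate_killing x y) n x y).
Proof.
  intros Hxy [K0 [HK0 H0]]; split.
  2: { apply has_indep_impl; intros K HK.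
       apply nondegenerate_killing_first_integral in HK; tauto. }
  intros (w & Hw & Hi).
  assert (H1 := lin_indep_translate n w K0 x y Hi).
  assert (H2 : Rbar_locally p_infty (fun t => forall k, (1 <= k <= n)%nat ->
    w k i1 x y + t * K0 i1 x y <> 0 /\ w k i2 x y + t * K0 i2 x y <> 0)).
  { apply (eventually_finite (fun k t => w k i1 x y + t * K0 i1 x y <> 0 /\
      w k i2 x y + t * K0 i2 x y <> 0)).
    intros k _; apply filter_and; apply eventually_affine_neq, H0. }
  destruct (filter_ex _ (filter_and _ _ H1 H2)) as (t & Ht1 & Ht2).
  exists (fun k a u v => w k a u v + t * K0 a u v); split; trivial.
  intros k Hk; split.
  - assert (Hwk : killing_form x y (w k)) by (apply killing_form_first_integral; auto).
    destruct (killing_form_combination x y (w k) K0 1 t Hwk HK0) as [C1 C2].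
    destruct (smooth_near_common _ x y C1) as (d & Hd & C1').
    assert (E : forall a u v, 1 * w k a u v + t * K0 a u v = w k a u v + t * K0 a u v)
      by (intros; ring).
    split.
    + intro a; apply smooth_on_near with (box x y d);
        [apply open2_box| |apply box_center; trivial].
      apply smooth_on_ext with (fun u v => 1 * w k a u v + t * K0 a u v); auto.
      apply open2_box.
    + generalize (locally_2d_and _ _ _ _ (open2_box x y d x y (box_center x y d Hd)) C2).
      apply locally_2d_impl, locally_2d_forall; intros u v (Huv & H) a b.
      assert (Ep : forall e a, pd e (fun u v => w k a u v + t * K0 a u v) u v
        = pd e (fun u v => 1 * w k a u v + t * K0 a u v) u v).
      { intros e a'; apply pd_ext with (box x y d); auto; apply open2_box. }
      rewrite !Ep, H; unfold sum2; rewrite !E; trivial.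
  - intros [|]; apply Ht2; trivial.
Qed.

(** A vector space is not the union of two proper subspaces. *)
Lemma killing_forms_common_zero x y :
  (forall K, killing_form x y K -> K i1 x y = 0 \/ K i2 x y = 0) ->
  exists a, forall K, killing_form x y K -> K a x y = 0.
Proof.
  intros H; apply NNPP; intro N.
  assert (N' : forall a, exists K, killing_form x y K /\ K a x y <> 0).
  { intro a; apply NNPP; intro N'; apply N; exists a; intros K HK.
    apply NNPP; intro; apply N'; exists K; auto. }
  destruct (N' i1) as (K & HK & K1), (N' i2) as (L & HL & L2).
  destruct (H K HK) as [E|K2]; [contradiction|].
  destruct (H L HL) as [L1|E]; [|contradiction].
  destruct (H _ (killing_form_combination x y K L 1 1 HK HL)) as [E|E]; simpl in E; lra.
Qed.

(** If no Killing form were nondegenerate at the point, one component would vanish there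
    for all of them, leaving only two free data in the jet that determines the form. *)
Lemma three_first_integrals_nondegenerate x y : D x y ->
  has_indep (linear_first_integral Gam x y) 3 x y ->
  exists K, nondegenerate_killing x y K.
Proof.
  intros Hxy (w & Hw & Hi); apply NNPP; intro N.
  assert (Hk : forall k, (1 <= k <= 3)%nat -> killing_form x y (w k)).
  { intros k H; apply killing_form_first_integral; auto. }
  destruct (killing_forms_common_zero x y) as [a Ha].
  { intros K HK; apply NNPP; intro N'; apply N; exists K; split; trivial.
    intros [|] E; apply N'; auto. }
  pose (b := match a with i1 => i2 | i2 => i1 end).
  destruct (two_equations_three_unknowns
    (w 1%nat b x y) (w 2%nat b x y) (w 3%nat b x y)
    (pd i1 (w 1%nat i2) x y) (pd i1 (w 2%nat i2) x y) (pd i1 (w 3%nat i2) x y))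
    as (c1 & c2 & c3 & Hc & E1 & E2).
  assert (H1 := Hk 1%nat ltac:(lia)); assert (H2 := Hk 2%nat ltac:(lia)).
  assert (H3 := Hk 3%nat ltac:(lia)).
  set (L := fun a u v => c1 * w 1%nat a u v + c2 * w 2%nat a u v).
  assert (HL : killing_form x y L) by (apply killing_form_combination; trivial).
  set (M := fun a u v => 1 * L a u v + c3 * w 3%nat a u v).
  assert (HM : killing_form x y M) by (apply killing_form_combination; trivial).
  assert (HM0 : locally_2d (fun u v => forall a, M a u v = 0) x y).
  { apply killing_jet_zero with D Gam; try apply HM; trivial.
    - intro e; destruct (classic (e = a)) as [->|He]; [apply Ha; trivial|].
      replace e with b by (destruct a, e; trivial; contradiction).
      unfold M, L; lra.
    - unfold M; rewrite killing_form_pd_combination by trivial.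
      unfold L; rewrite killing_form_pd_combination by trivial; lra. }
  assert (Hall : forall k, (1 <= k <= 3)%nat ->
     match k with 1%nat => c1 | 2%nat => c2 | _ => c3 end = 0).
  { apply Hi; apply locally_2d_impl with (2 := HM0), locally_2d_forall.
    intros u v HMu e; refine (eq_trans (sum_three _) _).
    rewrite <- (HMu e); unfold M, L; ring. }
  generalize (Hall 1%nat ltac:(lia)) (Hall 2%nat ltac:(lia)) (Hall 3%nat ltac:(lia)); simpl.
  tauto.
Qed.

Hypothesis HG0 : forall u v, D u v -> Gam i2 i1 i1 u v = 0 /\ Gam i1 i2 i2 u v = 0.

Lemma nowhere_nondegenerate_component x y K : D x y ->
  locally_2d (fun u v => ~ exists K, nondegenerate_killing u v K) x y ->
  killing_form x y K -> exists a, locally_2d (fun u v => K a u v = 0) x y.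
Proof.
  intros Hxy HN [HK Hk].
  apply killing_component_vanishes with D Gam; trivial.
  generalize (locally_2d_and _ _ _ _ HN (locally_2d_and _ _ _ _ Hk
    (locally_2d_and _ _ _ _ (HK i1) (HK i2)))).
  apply locally_2d_impl_strong, locally_2d_forall; intros u v H.
  apply NNPP; intro N.
  destruct (locally_2d_singleton _ _ _ H) as [HN' _]; apply HN'; exists K.
  split; [split|].
  - intros [|]; apply locally_2d_impl with (2 := H), locally_2d_forall; tauto.
  - apply locally_2d_impl with (2 := H), locally_2d_forall; tauto.
  - intros [|] E; apply N; auto.
Qed.

(** Every Killing form then has an identically vanishing component, which two independent
    forms [w_1], [w_2] must share, and such a form is determined by the value at the point
    of its other component: the combination cancelling that value is a linear relation. *)
Lemma nowhere_nondegenerate x y n : D x y ->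
  locally_2d (fun u v => ~ exists K, nondegenerate_killing u v K) x y ->
  (1 <= n)%nat -> has_indep (linear_first_integral Gam x y) n x y ->
  n = 1%nat /\ degenerate_integral Gam x y.
Proof.
  intros Hxy HN Hn (w & Hw & Hi).
  assert (Hcomp := fun K => nowhere_nondegenerate_component x y K Hxy HN).
  destruct (Nat.eq_dec n 1) as [->|Hn1].
  - split; trivial; exists (w 1%nat); assert (H1 := Hw 1%nat ltac:(lia)); split; trivial.
    apply Hcomp; apply killing_form_first_integral; trivial.
  - exfalso.
    destruct (proj1 (killing_form_first_integral x y _ Hxy) (Hw 1%nat ltac:(lia))) as [K1 N1].
    destruct (proj1 (killing_form_first_integral x y _ Hxy) (Hw 2%nat ltac:(lia))) as [K2 N2].
    set (w1 := w 1%nat) in *; set (w2 := w 2%nat) in *.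
    assert (Hcommon : exists a, locally_2d (fun u v => w1 a u v = 0) x y /\
                                locally_2d (fun u v => w2 a u v = 0) x y).
    { destruct (Hcomp w1 K1) as [a1 A1], (Hcomp w2 K2) as [a2 A2].
      destruct (Hcomp _ (killing_form_combination x y w1 w2 1 1 K1 K2)) as [a3 A3].
      assert (Hor : a3 = a1 \/ a3 = a2 \/ a1 = a2) by (destruct a1, a2, a3; auto).
      destruct Hor as [Ea|[Ea|Ea]]; subst.
      - exists a1; split; trivial.
        generalize (locally_2d_and _ _ _ _ A1 A3); apply locally_2d_impl, locally_2d_forall.
        intros u v [? ?]; lra.
      - exists a2; split; trivial.
        generalize (locally_2d_and _ _ _ _ A2 A3); apply locally_2d_impl, locally_2d_forall.
        intros u v [? ?]; lra.
      - exists a2; auto. }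
    destruct Hcommon as (a & A1 & A2).
    pose (b := match a with i1 => i2 | i2 => i1 end).
    set (c1 := w2 b x y); set (c2 := - w1 b x y).
    assert (HM := killing_form_combination x y w1 w2 c1 c2 K1 K2).
    assert (HM0 : locally_2d (fun u v => forall e, c1 * w1 e u v + c2 * w2 e u v = 0) x y).
    { apply (killing_degenerate_zero D Gam HD HGam x y Hxy _ a (proj1 HM) (proj2 HM)).
      - generalize (locally_2d_and _ _ _ _ A1 A2); apply locally_2d_impl, locally_2d_forall.
        intros u v [E1 E2]; rewrite E1, E2; ring.
      - intro e; destruct (classic (e = a)) as [->|He].
        + rewrite (locally_2d_singleton _ _ _ A1), (locally_2d_singleton _ _ _ A2); ring.
        + replace e with b by (destruct a, e; trivial; contradiction).
          unfold c1, c2; ring. }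
    assert (Hz : forall k, (1 <= k <= n)%nat ->
       match k with 1%nat => c1 | 2%nat => c2 | _ => 0 end = 0).
    { apply Hi; apply locally_2d_impl with (2 := HM0), locally_2d_forall.
      intros u v HMu e; rewrite sum_two; [exact (HMu e)|lia|].
      intros [|[|[|k]]] Hk; try lia; ring. }
    assert (E2 := Hz 2%nat ltac:(lia)); simpl in E2.
    apply N1, (killing_degenerate_zero D Gam HD HGam x y Hxy w1 a (proj1 K1) (proj2 K1) A1).
    intro e; destruct (classic (e = a)) as [->|He].
    + exact (locally_2d_singleton _ _ _ A1).
    + replace e with b by (destruct a, e; trivial; contradiction).
      unfold c2 in E2; lra.
Qed.
End Count.

(** * From Hamiltonian formulations to Killing forms *)

Section PartialDerivatives.
Variable D : R -> R -> Prop.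
Hypothesis HD : open2 D.

Lemma pd_plus a f g u v : smooth_on D f -> smooth_on D g -> D u v ->
  pd a (fun u v => f u v + g u v) u v = pd a f u v + pd a g u v.
Proof.
  intros Hf Hg Huv; apply is_pd_unique, is_pd_plus; apply smooth_on_is_pd with D; trivial.
Qed.

Lemma pd_mult a f g u v : smooth_on D f -> smooth_on D g -> D u v ->
  pd a (fun u v => f u v * g u v) u v = pd a f u v * g u v + f u v * pd a g u v.
Proof.
  intros Hf Hg Huv; apply is_pd_unique, is_pd_mult; apply smooth_on_is_pd with D; trivial.
Qed.

Lemma pd_locally_const a f c u v : (forall u v, D u v -> f u v = c) -> D u v ->
  pd a f u v = 0.
Proof.
  intros Hf Huv; apply is_pd_unique, is_pd_ext with (fun _ _ => c); [|apply is_pd_const].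
  apply on_locally with D; trivial; intros; symmetry; auto.
Qed.
End PartialDerivatives.

Lemma generates_system_iff D lam g b h u v : open2 D -> smooth_on D h -> D u v ->
  (generates_system_at lam g b h u v <->
   forall a c, sum2 (fun e => g (a, e) u v * pd c (pd e h) u v + b a e c u v * pd e h u v)
     = lam a u v * delta a c).
Proof.
  intros HD Hh Huv.
  assert (Hvar : forall X s, X i1 s = u -> X i2 s = v -> (forall c, ex_derive (X c) s) ->
    forall e, Derive (var_deriv h X e) s
      = pd i1 (pd e h) u v * Derive (X i1) s + pd i2 (pd e h) u v * Derive (X i2) s).
  { intros X s E1 E2 HX e; apply is_derive_unique.
    assert (H := is_derive_along D (pd e h) X s (Derive (X i1) s) (Derive (X i2) s) HD
      (smooth_on_pd D e h Hh)).
    rewrite E1, E2 in H; apply H; trivial; apply Derive_correct, HX. }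
  split.
  - intros Hgen a c.
    set (X := fun (e : idx) (s : R) =>
      (match e with i1 => u | i2 => v end) + delta e c * s).
    assert (HX : forall e, is_derive (X e) 0 (delta e c)).
    { intro e; unfold X; auto_derive; trivial; ring. }
    assert (E1 : X i1 0 = u) by (unfold X; ring).
    assert (E2 : X i2 0 = v) by (unfold X; ring).
    assert (HX' : forall e, ex_derive (X e) 0) by (intro e; eexists; apply HX).
    assert (H := Hgen X 0 E1 E2 HX' a).
    unfold Omega, sum2 in H; rewrite !Hvar in H by trivial.
    unfold var_deriv in H; rewrite !(is_derive_unique _ _ _ (HX _)), E1, E2 in H.
    rewrite H; unfold sum2; destruct c; simpl; ring.
  - intros H X s E1 E2 HX a.
    unfold Omega, sum2; rewrite !Hvar by trivial; unfold var_deriv; rewrite E1, E2.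
    assert (H1 := H a i1); assert (H2 := H a i2); unfold sum2 in H1, H2.
    assert (Hl : lam a u v * Derive (X a) s =
      lam a u v * delta a i1 * Derive (X i1) s + lam a u v * delta a i2 * Derive (X i2) s).
    { destruct a; simpl; ring. }
    rewrite Hl, <- H1, <- H2; ring.
Qed.

(** [H] stands for the covariant Hessian of the density.  Lowering an index in the four
    equations gives [H_ac = gl_ac lam^c]; as [H] and [gl] are symmetric and the two
    velocities differ, [gl] is diagonal. *)
Lemma hessian_diagonal (g gl H : idx -> idx -> R) (l : idx -> R) :
  l i1 <> l i2 ->
  (forall a c, sum2 (fun e => gl a e * g e c) = delta a c) ->
  (forall a e, g a e = g e a) ->
  (forall a c, sum2 (fun d => g a d * H d c) = l a * delta a c) ->
  H i1 i2 = H i2 i1 ->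
  (gl i1 i2 = 0 /\ gl i2 i1 = 0 /\ g i1 i2 = 0 /\ g i2 i1 = 0 /\
   gl i1 i1 * g i1 i1 = 1 /\ gl i2 i2 * g i2 i2 = 1) /\
  H i1 i1 = l i1 * gl i1 i1 /\ H i1 i2 = 0 /\ H i2 i2 = l i2 * gl i2 i2.
Proof.
  intros Hl Hinv Hsym Hgen HH.
  assert (N11 := Hinv i1 i1); assert (N12 := Hinv i1 i2).
  assert (N21 := Hinv i2 i1); assert (N22 := Hinv i2 i2).
  assert (Hs := Hsym i2 i1); unfold sum2, delta in *.
  rewrite Hs in N11, N21.
  assert (HHe : forall f c, H f c = gl f c * l c).
  { intros f c; assert (E1 := Hgen i1 c); assert (E2 := Hgen i2 c); rewrite Hs in E2.
    assert (E : gl f i1 * (g i1 i1 * H i1 c + g i1 i2 * H i2 c)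
              + gl f i2 * (g i1 i2 * H i1 c + g i2 i2 * H i2 c) =
      (gl f i1 * g i1 i1 + gl f i2 * g i1 i2) * H i1 c
      + (gl f i1 * g i1 i2 + gl f i2 * g i2 i2) * H i2 c) by ring.
    rewrite E1, E2 in E.
    destruct f; [rewrite N11, N12 in E|rewrite N21, N22 in E]; destruct c; lra. }
  assert (Hgs : gl i1 i2 = gl i2 i1).
  { replace (gl i1 i2) with (gl i1 i2 * (gl i2 i1 * g i1 i2 + gl i2 i2 * g i2 i2))
      by (rewrite N22; ring).
    replace (gl i2 i1) with (gl i2 i1 * (gl i1 i1 * g i1 i1 + gl i1 i2 * g i1 i2)) at 2
      by (rewrite N11; ring).
    replace (gl i1 i2 * (gl i2 i1 * g i1 i2 + gl i2 i2 * g i2 i2))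
      with (gl i2 i1 * gl i1 i2 * g i1 i2 + gl i2 i2 * (gl i1 i2 * g i2 i2)) by ring.
    replace (gl i2 i1 * (gl i1 i1 * g i1 i1 + gl i1 i2 * g i1 i2))
      with (gl i1 i1 * (gl i2 i1 * g i1 i1) + gl i2 i1 * gl i1 i2 * g i1 i2) by ring.
    replace (gl i1 i2 * g i2 i2) with (- (gl i1 i1 * g i1 i2)) by lra.
    replace (gl i2 i1 * g i1 i1) with (- (gl i2 i2 * g i1 i2)) by lra.
    ring. }
  assert (G12 : gl i1 i2 = 0).
  { apply Rmult_eq_reg_r with (l i1 - l i2); [|lra].
    assert (E1 := HHe i1 i2); assert (E2 := HHe i2 i1); rewrite <- Hgs in E2; lra. }
  assert (G21 : gl i2 i1 = 0) by lra.
  rewrite G12 in N11, N12; rewrite G21 in N21, N22.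
  assert (Q12 : g i1 i2 = 0).
  { apply Rmult_eq_reg_l with (gl i1 i1); [lra|]; intro E; rewrite E in N11; lra. }
  repeat split; trivial; try lra.
  - rewrite HHe; ring.
  - rewrite HHe, G12; ring.
  - rewrite HHe; ring.
Qed.

Section System.
Variables (D : R -> R -> Prop) (lam : idx -> R -> R -> R).
Hypothesis HD : open2 D.
Hypothesis Hlam : forall a, smooth_on D (lam a).
Hypothesis Hdist : forall u v, D u v -> lam i1 u v <> lam i2 u v.
Hypothesis HA0 : forall u v, D u v -> coefA lam u v <> 0.
Hypothesis HB0 : forall u v, D u v -> coefB lam u v <> 0.

Let A := coefA lam.
Let B := coefB lam.

Lemma smooth_coefA : smooth_on D A.
Proof.
  apply smooth_on_div; trivial.
  - apply smooth_on_pd, Hlam.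
  - apply smooth_on_minus; trivial.
  - intros u v H; generalize (Hdist u v H); lra.
Qed.

Lemma smooth_coefB : smooth_on D B.
Proof.
  apply smooth_on_div; trivial.
  - apply smooth_on_pd, Hlam.
  - apply smooth_on_minus; trivial.
  - intros u v H; generalize (Hdist u v H); lra.
Qed.

Lemma coefA_eq u v : D u v -> pd i2 (lam i1) u v = A u v * (lam i2 u v - lam i1 u v).
Proof. intro H; unfold A, coefA; field; generalize (Hdist u v H); lra. Qed.

Lemma coefB_eq u v : D u v -> pd i1 (lam i2) u v = B u v * (lam i1 u v - lam i2 u v).
Proof. intro H; unfold B, coefB; field; generalize (Hdist u v H); lra. Qed.

Lemma smooth_connection a b c : smooth_on D (connection lam a b c).
Proof.
  assert (HlA : forall e, smooth_on D (dln e A)).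
  { intro e; apply smooth_on_mult; trivial.
    - apply smooth_on_inv; trivial; apply smooth_coefA.
    - apply smooth_on_pd, smooth_coefA. }
  assert (HlB : forall e, smooth_on D (dln e B)).
  { intro e; apply smooth_on_mult; trivial.
    - apply smooth_on_inv; trivial; apply smooth_coefB.
    - apply smooth_on_pd, smooth_coefB. }
  assert (H1 : smooth_on D (fun u v => - (1 / 2 * dln i2 A u v + A u v))).
  { apply smooth_on_opp, smooth_on_plus; trivial; [apply smooth_on_mult; trivial|apply smooth_coefA].
    apply smooth_on_const; trivial. }
  assert (H2 : smooth_on D (fun u v => - (1 / 2 * dln i1 B u v + B u v))).
  { apply smooth_on_opp, smooth_on_plus; trivial; [apply smooth_on_mult; trivial|apply smooth_coefB].
    apply smooth_on_const; trivial. }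
  assert (H3 : smooth_on D (fun u v => dln i1 A u v - 2 * B u v)).
  { apply smooth_on_minus; trivial; apply smooth_on_mult; trivial;
      [apply smooth_on_const; trivial|apply smooth_coefB]. }
  assert (H4 : smooth_on D (fun u v => dln i2 B u v - 2 * A u v)).
  { apply smooth_on_minus; trivial; apply smooth_on_mult; trivial;
      [apply smooth_on_const; trivial|apply smooth_coefA]. }
  assert (H5 := smooth_on_const D HD 0).
  destruct a, b, c; assumption.
Qed.

(** The equations on a diagonal contravariant metric [P = g^11], [Q = g^22]: the first two
    say that [A] and [B] are the Christoffel symbols [Gamma^1_12] and [Gamma^2_12] of the
    metric, the third is its flatness. *)
Definition flat_diagonal_at (P Q : R -> R -> R) (u v : R) : Prop :=
  pd i1 Q u v = - 2 * B u v * Q u v /\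
  pd i2 P u v = - 2 * A u v * P u v /\
  B u v * pd i1 P u v + A u v * pd i2 Q u v
    + 2 * (pd i1 B u v + B u v * B u v) * P u v
    + 2 * (pd i2 A u v + A u v * A u v) * Q u v = 0.

Definition form_of_metric (P Q : R -> R -> R) (a : idx) (u v : R) : R :=
  match a with i1 => A u v * Q u v | i2 => B u v * P u v end.

(** The factors [A] and [B] in the form are absorbed by the logarithmic derivatives in the
    connection: the diagonal Killing equations become the first two equations on the
    metric, and the mixed one becomes flatness. *)
Lemma killing_form_of_metric D' P Q u v : open2 D' -> (forall u v, D' u v -> D u v) ->
  smooth_on D' P -> smooth_on D' Q -> D' u v ->
  (killing_at (connection lam) (form_of_metric P Q) u v <-> flat_diagonal_at P Q u v).
Proof.
  intros HD' Hincl HP HQ Huv.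
  assert (HA : smooth_on D' A) by (apply smooth_on_incl with D; trivial; apply smooth_coefA).
  assert (HB : smooth_on D' B) by (apply smooth_on_incl with D; trivial; apply smooth_coefB).
  assert (E1 : forall a, pd a (form_of_metric P Q i1) u v = pd a A u v * Q u v + A u v * pd a Q u v).
  { intro a; apply (pd_mult D' a A Q); trivial. }
  assert (E2 : forall a, pd a (form_of_metric P Q i2) u v = pd a B u v * P u v + B u v * pd a P u v).
  { intro a; apply (pd_mult D' a B P); trivial. }
  assert (NA : A u v <> 0) by (apply HA0; auto).
  assert (NB : B u v <> 0) by (apply HB0; auto).
  unfold flat_diagonal_at; split.
  - intros Hk; assert (K11 := Hk i1 i1); assert (K12 := Hk i1 i2); assert (K22 := Hk i2 i2).
    unfold sum2, connection, dln in K11, K12, K22; fold A B in K11, K12, K22.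
    rewrite E1 in K11; rewrite E1, E2 in K12; rewrite E2 in K22.
    unfold form_of_metric in K11, K12, K22.
    repeat split.
    + apply Rmult_eq_reg_l with (A u v); trivial.
      match type of K11 with _ = ?r => replace r with
        (2 * (pd i1 A u v * Q u v - 2 * B u v * (A u v * Q u v))) in K11 by (field; trivial) end.
      lra.
    + apply Rmult_eq_reg_l with (B u v); trivial.
      match type of K22 with _ = ?r => replace r with
        (2 * (pd i2 B u v * P u v - 2 * A u v * (B u v * P u v))) in K22 by (field; trivial) end.
      lra.
    + match type of K12 with _ = ?r => replace r with
        (- (pd i2 A u v * Q u v + 2 * A u v * A u v * Q u v)
         - (pd i1 B u v * P u v + 2 * B u v * B u v * P u v)) in K12 by (field; split; trivial) end.
      lra.
  - intros (F1 & F2 & F3) a b.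
    assert (K11 : pd i1 A u v * Q u v + A u v * pd i1 Q u v
      = (/ A u v * pd i1 A u v - 2 * B u v) * (A u v * Q u v)) by (rewrite F1; field; trivial).
    assert (K22 : pd i2 B u v * P u v + B u v * pd i2 P u v
      = (/ B u v * pd i2 B u v - 2 * A u v) * (B u v * P u v)) by (rewrite F2; field; trivial).
    assert (K12 : pd i1 B u v * P u v + B u v * pd i1 P u v
                  + (pd i2 A u v * Q u v + A u v * pd i2 Q u v)
      = 2 * (- (1 / 2 * (/ A u v * pd i2 A u v) + A u v)) * (A u v * Q u v)
        + 2 * (- (1 / 2 * (/ B u v * pd i1 B u v) + B u v)) * (B u v * P u v)).
    { match goal with |- _ = ?r => replace r with
        (- (pd i2 A u v * Q u v + 2 * A u v * A u v * Q u v)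
         - (pd i1 B u v * P u v + 2 * B u v * B u v * P u v)) by (field; split; trivial) end.
      lra. }
    destruct a, b; rewrite ?E1, ?E2; unfold sum2, connection, dln; fold A B;
      unfold form_of_metric; lra.
Qed.

(** Codazzi: the covariant derivative of the Hessian is totally symmetric because the
    connection is flat.  Off the diagonal this is [d_b lam^a = Gamma^a_ab (lam^b - lam^a)],
    which identifies the mixed Christoffel symbols of the metric with [A] and [B]. *)
Lemma hessian_codazzi D' (h : R -> R -> R) (gl : idx -> idx -> R -> R -> R)
  (gam : idx -> idx -> idx -> R -> R -> R) :
  open2 D' -> (forall u v, D' u v -> D u v) -> smooth_on D' h ->
  (forall a b, smooth_on D' (gl a b)) -> (forall a b c, smooth_on D' (gam a b c)) ->
  (forall u v, D' u v -> parallel_at gam gl u v) ->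
  (forall u v, D' u v -> torsion_free_at gam u v) ->
  (forall u v, D' u v -> flat_at gam u v) ->
  (forall u v, D' u v -> gl i1 i2 u v = 0 /\ gl i2 i1 u v = 0) ->
  (forall u v, D' u v -> gl i1 i1 u v <> 0 /\ gl i2 i2 u v <> 0) ->
  (forall u v, D' u v ->
     pd i1 (pd i1 h) u v = gam i1 i1 i1 u v * pd i1 h u v + gam i2 i1 i1 u v * pd i2 h u v
       + lam i1 u v * gl i1 i1 u v) ->
  (forall u v, D' u v ->
     pd i1 (pd i2 h) u v = gam i1 i2 i1 u v * pd i1 h u v + gam i2 i2 i1 u v * pd i2 h u v) ->
  (forall u v, D' u v ->
     pd i2 (pd i2 h) u v = gam i1 i2 i2 u v * pd i1 h u v + gam i2 i2 i2 u v * pd i2 h u v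
       + lam i2 u v * gl i2 i2 u v) ->
  forall u v, D' u v -> gam i1 i2 i1 u v = A u v /\ gam i2 i2 i1 u v = B u v.
Proof.
  intros HD' Hincl Hh Hgl Hgam Hpar Htor Hflat Hoff Hnz H11 H12 H22 u v Huv.
  assert (Hl : forall a, smooth_on D' (lam a)) by (intro; apply smooth_on_incl with D; trivial).
  assert (Hdh : forall a, smooth_on D' (pd a h)) by (intro; apply smooth_on_pd; trivial).
  destruct (Hnz u v Huv) as [N1 N2]; destruct (Hoff u v Huv) as [O1 O2].
  assert (Z12 : forall a, pd a (gl i1 i2) u v = 0).
  { intro; apply (pd_locally_const D' HD') with 0; trivial; intros; apply Hoff; trivial. }
  assert (T1 := Htor u v Huv i1 i1 i2); assert (T2 := Htor u v Huv i2 i1 i2).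
  assert (P112 := Hpar u v Huv i1 i1 i2); assert (P221 := Hpar u v Huv i2 i2 i1).
  assert (P121 := Hpar u v Huv i1 i2 i1); assert (P122 := Hpar u v Huv i1 i2 i2).
  unfold sum2 in P112, P221, P121, P122; rewrite Z12 in P121, P122.
  rewrite ?O1, ?O2, ?T1, ?T2 in P112;
    rewrite ?O1, ?O2, ?T1, ?T2 in P221;
    rewrite ?O1, ?O2, ?T1, ?T2 in P121;
    rewrite ?O1, ?O2, ?T1, ?T2 in P122.
  assert (C12 := H12 u v Huv).
  assert (D12 : pd i2 (pd i1 h) u v
    = gam i1 i2 i1 u v * pd i1 h u v + gam i2 i2 i1 u v * pd i2 h u v).
  { rewrite <- C12; symmetry; apply pd_comm with D'; trivial. }
  assert (X3 : forall e (p q r s : R -> R -> R), smooth_on D' p -> smooth_on D' q ->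
     smooth_on D' r -> smooth_on D' s ->
     pd e (fun u v => p u v * pd i1 h u v + q u v * pd i2 h u v + r u v * s u v) u v
     = pd e p u v * pd i1 h u v + p u v * pd e (pd i1 h) u v
       + (pd e q u v * pd i2 h u v + q u v * pd e (pd i2 h) u v)
       + (pd e r u v * s u v + r u v * pd e s u v)).
  { intros e p q r s Hp Hq Hr Hs.
    assert (Hph := smooth_on_mult D' HD' p (pd i1 h) Hp (Hdh i1)).
    assert (Hqh := smooth_on_mult D' HD' q (pd i2 h) Hq (Hdh i2)).
    assert (Hrs := smooth_on_mult D' HD' r s Hr Hs).
    rewrite (pd_plus D' e (fun u v => p u v * pd i1 h u v + q u v * pd i2 h u v)
      (fun u v => r u v * s u v)); trivial; [|apply smooth_on_plus; trivial].
    rewrite (pd_plus D' e (fun u v => p u v * pd i1 h u v) (fun u v => q u v * pd i2 h u v));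
      trivial.
    rewrite (pd_mult D' e p), (pd_mult D' e q), (pd_mult D' e r); trivial. }
  assert (X2 : forall e (p q : R -> R -> R), smooth_on D' p -> smooth_on D' q ->
     pd e (fun u v => p u v * pd i1 h u v + q u v * pd i2 h u v) u v
     = pd e p u v * pd i1 h u v + p u v * pd e (pd i1 h) u v
       + (pd e q u v * pd i2 h u v + q u v * pd e (pd i2 h) u v)).
  { intros e p q Hp Hq.
    assert (Hph := smooth_on_mult D' HD' p (pd i1 h) Hp (Hdh i1)).
    assert (Hqh := smooth_on_mult D' HD' q (pd i2 h) Hq (Hdh i2)).
    rewrite (pd_plus D' e (fun u v => p u v * pd i1 h u v) (fun u v => q u v * pd i2 h u v));
      trivial.
    rewrite (pd_mult D' e p), (pd_mult D' e q); trivial. }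
  assert (S11 : pd i2 (pd i1 (pd i1 h)) u v = pd i2 (fun u v => gam i1 i1 i1 u v * pd i1 h u v
     + gam i2 i1 i1 u v * pd i2 h u v + lam i1 u v * gl i1 i1 u v) u v).
  { symmetry; apply pd_ext with D'; trivial; apply smooth_on_pd, Hdh. }
  assert (S12 : pd i1 (pd i2 (pd i1 h)) u v = pd i1 (fun u v =>
     gam i1 i2 i1 u v * pd i1 h u v + gam i2 i2 i1 u v * pd i2 h u v) u v).
  { symmetry; apply pd_ext with D'; trivial; [|apply smooth_on_pd, Hdh].
    intros u' v' H; rewrite <- (pd_comm D' HD') by trivial; auto. }
  assert (S21 : pd i2 (pd i1 (pd i2 h)) u v = pd i2 (fun u v =>
     gam i1 i2 i1 u v * pd i1 h u v + gam i2 i2 i1 u v * pd i2 h u v) u v).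
  { symmetry; apply pd_ext with D'; trivial; apply smooth_on_pd, Hdh. }
  assert (S22 : pd i1 (pd i2 (pd i2 h)) u v = pd i1 (fun u v => gam i1 i2 i2 u v * pd i1 h u v
     + gam i2 i2 i2 u v * pd i2 h u v + lam i2 u v * gl i2 i2 u v) u v).
  { symmetry; apply pd_ext with D'; trivial; apply smooth_on_pd, Hdh. }
  rewrite X3 in S11, S22 by trivial; rewrite X2 in S12, S21 by trivial.
  assert (W1 := pd_comm D' HD' (pd i1 h) u v (Hdh i1) Huv).
  assert (W2 := pd_comm D' HD' (pd i2 h) u v (Hdh i2) Huv).
  rewrite S12, S11, (H11 u v Huv), C12, D12, (H22 u v Huv) in W1.
  rewrite S22, S21, (H11 u v Huv), (H22 u v Huv), C12, D12 in W2.
  assert (F1 := Hflat u v Huv i1 i1 i1 i2); assert (F2 := Hflat u v Huv i2 i1 i1 i2).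
  assert (F3 := Hflat u v Huv i1 i2 i1 i2); assert (F4 := Hflat u v Huv i2 i2 i1 i2).
  unfold sum2 in F1, F2, F3, F4.
  assert (Ttor : forall e c, pd e (gam c i1 i2) u v = pd e (gam c i2 i1) u v).
  { intros e c; apply pd_ext with D'; trivial; intros u' v' H; apply (Htor u' v' H). }
  rewrite ?(Ttor i1 i1), ?(Ttor i1 i2), ?T1, ?T2 in F1;
    rewrite ?(Ttor i1 i1), ?(Ttor i1 i2), ?T1, ?T2 in F2;
    rewrite ?(Ttor i1 i1), ?(Ttor i1 i2), ?T1, ?T2 in F3;
    rewrite ?(Ttor i1 i1), ?(Ttor i1 i2), ?T1, ?T2 in F4.
  set (h1 := pd i1 h u v) in *; set (h2 := pd i2 h u v) in *.
  assert (Y1 : pd i2 (lam i1) u v * gl i1 i1 u v + lam i1 u v * pd i2 (gl i1 i1) u v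
     + gam i2 i1 i1 u v * (lam i2 u v * gl i2 i2 u v)
     = gam i1 i2 i1 u v * (lam i1 u v * gl i1 i1 u v)).
  { apply (f_equal (fun r => r * h1)) in F1; apply (f_equal (fun r => r * h2)) in F2; lra. }
  assert (Y2 : pd i1 (lam i2) u v * gl i2 i2 u v + lam i2 u v * pd i1 (gl i2 i2) u v
     + gam i1 i2 i2 u v * (lam i1 u v * gl i1 i1 u v)
     = gam i2 i2 i1 u v * (lam i2 u v * gl i2 i2 u v)).
  { apply (f_equal (fun r => r * h1)) in F3; apply (f_equal (fun r => r * h2)) in F4; lra. }
  assert (G112 : pd i2 (gl i1 i1) u v = 2 * gam i1 i2 i1 u v * gl i1 i1 u v) by lra.
  assert (G221 : pd i1 (gl i2 i2) u v = 2 * gam i2 i2 i1 u v * gl i2 i2 u v) by lra.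
  assert (G211 : gam i2 i1 i1 u v * gl i2 i2 u v = - (gam i1 i2 i1 u v * gl i1 i1 u v)) by lra.
  assert (G122 : gam i1 i2 i2 u v * gl i1 i1 u v = - (gam i2 i2 i1 u v * gl i2 i2 u v)) by lra.
  rewrite (coefA_eq u v), G112 in Y1 by auto; rewrite (coefB_eq u v), G221 in Y2 by auto.
  replace (gam i2 i1 i1 u v * (lam i2 u v * gl i2 i2 u v)) with
    (lam i2 u v * (gam i2 i1 i1 u v * gl i2 i2 u v)) in Y1 by ring; rewrite G211 in Y1.
  replace (gam i1 i2 i2 u v * (lam i1 u v * gl i1 i1 u v)) with
    (lam i1 u v * (gam i1 i2 i2 u v * gl i1 i1 u v)) in Y2 by ring; rewrite G122 in Y2.
  assert (Hd := Hdist u v (Hincl u v Huv)).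
  split.
  - apply Rmult_eq_reg_r with (gl i1 i1 u v * (lam i2 u v - lam i1 u v)); [lra|].
    apply Rmult_integral_contrapositive; lra.
  - apply Rmult_eq_reg_r with (gl i2 i2 u v * (lam i1 u v - lam i2 u v)); [lra|].
    apply Rmult_integral_contrapositive; lra.
Qed.

(** The third equation is [- 2 Q] times the curvature component [R^1_212], rewritten with
    [Gamma^1_22 Q = - B P]. *)
Lemma flat_metric_equations D' (gl : idx -> idx -> R -> R -> R)
  (gam : idx -> idx -> idx -> R -> R -> R) (P Q : R -> R -> R) :
  open2 D' -> (forall u v, D' u v -> D u v) ->
  (forall a b, smooth_on D' (gl a b)) -> (forall a b c, smooth_on D' (gam a b c)) ->
  smooth_on D' P -> smooth_on D' Q ->
  (forall u v, D' u v -> parallel_at gam gl u v) ->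
  (forall u v, D' u v -> torsion_free_at gam u v) ->
  (forall u v, D' u v -> flat_at gam u v) ->
  (forall u v, D' u v -> gl i1 i2 u v = 0 /\ gl i2 i1 u v = 0) ->
  (forall u v, D' u v -> gl i1 i1 u v * P u v = 1 /\ gl i2 i2 u v * Q u v = 1) ->
  (forall u v, D' u v -> gam i1 i2 i1 u v = A u v /\ gam i2 i2 i1 u v = B u v) ->
  forall u v, D' u v -> flat_diagonal_at P Q u v.
Proof.
  intros HD' Hincl Hgl Hgam HP HQ Hpar Htor Hflat Hoff Hinv HAB.
  assert (HA : smooth_on D' A) by (apply smooth_on_incl with D; trivial; apply smooth_coefA).
  assert (HB : smooth_on D' B) by (apply smooth_on_incl with D; trivial; apply smooth_coefB).
  assert (Hpq : forall u v, D' u v ->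
    (forall e, pd e (gl i1 i1) u v * P u v * P u v = - pd e P u v) /\
    (forall e, pd e (gl i2 i2) u v * Q u v * Q u v = - pd e Q u v)).
  { intros u v Huv; destruct (Hinv u v Huv) as [I1 I2]; split; intro e.
    - assert (E := pd_mult D' e (gl i1 i1) P u v (Hgl _ _) HP Huv).
      rewrite (pd_locally_const D' HD' e _ 1) in E; trivial; [|intros; apply Hinv; trivial].
      replace (pd e (gl i1 i1) u v * P u v) with (- (gl i1 i1 u v * pd e P u v)) by lra.
      replace (- (gl i1 i1 u v * pd e P u v) * P u v)
        with (- ((gl i1 i1 u v * P u v) * pd e P u v)) by ring; rewrite I1; ring.
    - assert (E := pd_mult D' e (gl i2 i2) Q u v (Hgl _ _) HQ Huv).
      rewrite (pd_locally_const D' HD' e _ 1) in E; trivial; [|intros; apply Hinv; trivial].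
      replace (pd e (gl i2 i2) u v * Q u v) with (- (gl i2 i2 u v * pd e Q u v)) by lra.
      replace (- (gl i2 i2 u v * pd e Q u v) * Q u v)
        with (- ((gl i2 i2 u v * Q u v) * pd e Q u v)) by ring; rewrite I2; ring. }
  assert (Hchr : forall u v, D' u v ->
    pd i1 Q u v = - 2 * B u v * Q u v /\ pd i2 P u v = - 2 * A u v * P u v /\
    pd i1 P u v = - 2 * gam i1 i1 i1 u v * P u v /\
    pd i2 Q u v = - 2 * gam i2 i2 i2 u v * Q u v /\
    gam i1 i2 i2 u v * Q u v = - (B u v * P u v)).
  { intros u v Huv; destruct (Hpq u v Huv) as [EP EQ]; destruct (Hinv u v Huv) as [I1 I2].
    destruct (Hoff u v Huv) as [O1 O2]; destruct (HAB u v Huv) as [EA EB].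
    assert (T1 := Htor u v Huv i1 i1 i2); assert (T2 := Htor u v Huv i2 i1 i2).
    assert (Z12 : forall a, pd a (gl i1 i2) u v = 0).
    { intro; apply (pd_locally_const D' HD') with 0; trivial; intros; apply Hoff; trivial. }
    assert (P111 := Hpar u v Huv i1 i1 i1); assert (P112 := Hpar u v Huv i1 i1 i2).
    assert (P221 := Hpar u v Huv i2 i2 i1); assert (P222 := Hpar u v Huv i2 i2 i2).
    assert (P122 := Hpar u v Huv i1 i2 i2).
    unfold sum2 in *; rewrite Z12 in P122.
    rewrite ?O1, ?O2, ?T1, ?T2, ?EA, ?EB in P111;
      rewrite ?O1, ?O2, ?T1, ?T2, ?EA, ?EB in P112;
      rewrite ?O1, ?O2, ?T1, ?T2, ?EA, ?EB in P221;
      rewrite ?O1, ?O2, ?T1, ?T2, ?EA, ?EB in P222;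
      rewrite ?O1, ?O2, ?T1, ?T2, ?EA, ?EB in P122.
    assert (Hmul : forall c g p q, g * p = 1 -> c * p * p = - q ->
       forall k, c = 2 * k * g -> q = - 2 * k * p).
    { intros c g0 p q Hg Hq k Hc; rewrite Hc in Hq.
      replace (2 * k * g0 * p * p) with (2 * k * (g0 * p) * p) in Hq by ring.
      rewrite Hg in Hq; lra. }
    split; [apply (Hmul _ _ _ _ I2 (EQ i1)); lra|].
    split; [apply (Hmul _ _ _ _ I1 (EP i2)); lra|].
    split; [apply (Hmul _ _ _ _ I1 (EP i1)); lra|].
    split; [apply (Hmul _ _ _ _ I2 (EQ i2)); lra|].
    replace (gam i1 i2 i2 u v * Q u v)
      with ((gam i1 i2 i2 u v * gl i1 i1 u v) * P u v * Q u v
            + gam i1 i2 i2 u v * Q u v * (1 - gl i1 i1 u v * P u v)) by ring.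
    rewrite I1.
    replace (gam i1 i2 i2 u v * gl i1 i1 u v) with (- (B u v * gl i2 i2 u v)) by lra.
    replace (- (B u v * gl i2 i2 u v) * P u v * Q u v) with
      (- (B u v * P u v * (gl i2 i2 u v * Q u v))) by ring.
    rewrite I2; ring. }
  intros u v Huv; destruct (Hchr u v Huv) as (E1 & E2 & E3 & E4 & E5).
  destruct (HAB u v Huv) as [EA EB].
  split; [trivial|split; trivial].
  assert (T1 := Htor u v Huv i1 i1 i2); assert (T2 := Htor u v Huv i2 i1 i2).
  assert (F := Hflat u v Huv i1 i2 i1 i2); unfold sum2 in F; rewrite T1, EA, EB in F.
  assert (EdA : pd i2 (gam i1 i2 i1) u v = pd i2 A u v).
  { apply pd_ext with D'; trivial; intros; symmetry; apply HAB; trivial. }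
  assert (E6 : pd i1 (gam i1 i2 i2) u v * Q u v + gam i1 i2 i2 u v * pd i1 Q u v
     = - (pd i1 B u v * P u v + B u v * pd i1 P u v)).
  { rewrite <- (pd_mult D') by trivial.
    apply is_pd_unique, is_pd_ext with (fun u v => - (B u v * P u v)).
    - apply on_locally with D'; trivial; intros u' v' H; symmetry; apply Hchr; trivial.
    - apply (is_pd_opp i1 (fun u v => B u v * P u v)), (is_pd_mult i1 B P);
        apply smooth_on_is_pd with D'; trivial. }
  rewrite EdA in F; apply (f_equal (fun r => r * Q u v)) in F.
  rewrite E1 in E6.
  replace (gam i1 i2 i2 u v * (-2 * B u v * Q u v)) with
    (-2 * B u v * (gam i1 i2 i2 u v * Q u v)) in E6 by ring; rewrite E5 in E6.
  match type of F with ?l = _ => replace l with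
    (pd i1 (gam i1 i2 i2) u v * Q u v - pd i2 A u v * Q u v
     + gam i1 i1 i1 u v * (gam i1 i2 i2 u v * Q u v) + A u v * (gam i2 i2 i2 u v * Q u v)
     - (A u v * A u v * Q u v + (gam i1 i2 i2 u v * Q u v) * B u v)) in F by ring end.
  rewrite E5 in F.
  replace (gam i1 i1 i1 u v * - (B u v * P u v)) with
    (B u v * (- (gam i1 i1 i1 u v * P u v))) in F by ring.
  replace (- (gam i1 i1 i1 u v * P u v)) with (/ 2 * pd i1 P u v) in F by lra.
  replace (gam i2 i2 i2 u v * Q u v) with (- / 2 * pd i2 Q u v) in F by lra.
  lra.
Qed.

Lemma hamiltonian_flat_diagonal x y g : D x y -> hamiltonian_formulation lam x y g ->
  exists d, 0 < d /\ (forall u v, box x y d u v -> D u v) /\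
    (forall p, smooth_on (box x y d) (g p)) /\
    forall u v, box x y d u v ->
      g (i1, i2) u v = 0 /\ g (i2, i1) u v = 0 /\
      g (i1, i1) u v <> 0 /\ g (i2, i2) u v <> 0 /\
      flat_diagonal_at (g (i1, i1)) (g (i2, i2)) u v.
Proof.
  intros Hxy (Hg & b & h & Hb & Hh & (gl & gam & Hgl & Hgam & Hpois) & Hgen).
  assert (L1 : locally_2d (fun u v => forall a e n, ex_diff_n (g (a, e)) n u v) x y).
  { repeat (apply locally_2d_forall_idx; intro); apply Hg. }
  assert (L2 : locally_2d (fun u v => forall a e n, ex_diff_n (gl a e) n u v) x y).
  { repeat (apply locally_2d_forall_idx; intro); apply Hgl. }
  assert (L3 : locally_2d (fun u v => forall a e c n, ex_diff_n (gam a e c) n u v) x y).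
  { repeat (apply locally_2d_forall_idx; intro); apply Hgam. }
  assert (L := locally_2d_and _ _ _ _ (HD x y Hxy) (locally_2d_and _ _ _ _ Hpois
    (locally_2d_and _ _ _ _ Hgen (locally_2d_and _ _ _ _ Hh
    (locally_2d_and _ _ _ _ L1 (locally_2d_and _ _ _ _ L2 L3)))))).
  apply locally_2d_box in L; destruct L as (d & Hd & L).
  exists d; split; trivial.
  assert (Hincl : forall u v, box x y d u v -> D u v) by (intros u v H; apply (L u v H)).
  assert (HD' := open2_box x y d).
  assert (Sh : smooth_on (box x y d) h) by (intros n u v H; apply (L u v H)).
  assert (Sg : forall p, smooth_on (box x y d) (g p)) by (intros [a e] n u v H; apply (L u v H)).
  assert (Sgl : forall a e, smooth_on (box x y d) (gl a e)) by (intros a e n u v H; apply (L u v H)).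
  assert (Sgam : forall a e c, smooth_on (box x y d) (gam a e c))
    by (intros a e c n u v H; apply (L u v H)).
  assert (Hdiag : forall u v, box x y d u v ->
    (gl i1 i2 u v = 0 /\ gl i2 i1 u v = 0 /\ g (i1, i2) u v = 0 /\ g (i2, i1) u v = 0 /\
     gl i1 i1 u v * g (i1, i1) u v = 1 /\ gl i2 i2 u v * g (i2, i2) u v = 1) /\
    pd i1 (pd i1 h) u v - sum2 (fun e => gam e i1 i1 u v * pd e h u v) = lam i1 u v * gl i1 i1 u v /\
    pd i2 (pd i1 h) u v - sum2 (fun e => gam e i1 i2 u v * pd e h u v) = 0 /\
    pd i2 (pd i2 h) u v - sum2 (fun e => gam e i2 i2 u v * pd e h u v) = lam i2 u v * gl i2 i2 u v).
  { intros u v Huv; destruct (L u v Huv) as (_ & (Hinv & Hbg & Hsym & _ & Htor & _) & Hgen' & _).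
    assert (Heq := proj1 (generates_system_iff (box x y d) lam g b h u v HD' Sh Huv) Hgen').
    apply (hessian_diagonal (fun a e => g (a, e) u v) (fun a e => gl a e u v)
      (fun d c => pd c (pd d h) u v - sum2 (fun e => gam e d c u v * pd e h u v))
      (fun a => lam a u v)); auto.
    - intros a c; rewrite <- (Heq a c); unfold sum2; rewrite !Hbg; unfold sum2; ring.
    - rewrite (pd_comm (box x y d)) by trivial; unfold sum2.
      rewrite !(fun c => Htor c i1 i2); trivial. }
  split; [trivial|split; [trivial|]].
  intros u v Huv.
  assert (Hchris : forall u v, box x y d u v ->
    gam i1 i2 i1 u v = A u v /\ gam i2 i2 i1 u v = B u v).
  { apply hessian_codazzi with h gl; trivial;
      try (intros u' v' H; destruct (L u' v' H) as (_ & (_ & _ & _ & ? & ? & ?) & _); trivial; fail);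
      intros u' v' H; destruct (Hdiag u' v' H) as ((G1 & G2 & _ & _ & G5 & G6) & E1 & E2 & E3);
      unfold sum2 in E1, E2, E3.
    - split; trivial.
    - split; intro E; rewrite E in *; lra.
    - lra.
    - destruct (L u' v' H) as (_ & (_ & _ & _ & _ & Htor & _) & _).
      rewrite (pd_comm (box x y d)) by trivial.
      rewrite !(fun c => Htor c i1 i2) in E2; lra.
    - lra. }
  destruct (Hdiag u v Huv) as ((G1 & G2 & G3 & G4 & G5 & G6) & _).
  repeat (split; [trivial; intro E; rewrite E in *; lra|]).
  apply flat_metric_equations with (box x y d) gl gam; trivial;
    try (intros u' v' H; destruct (L u' v' H) as (_ & (_ & _ & _ & ? & ? & ?) & _); trivial; fail);
    intros u' v' H; destruct (Hdiag u' v' H) as ((? & ? & _ & _ & ? & ?) & _); split; trivial.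
Qed.
End System.

(** * From Killing forms to Hamiltonian formulations *)

Lemma is_pd_of D f : smooth_on D f -> forall a u v, D u v -> is_pd a f u v (pd a f u v).
Proof. intros; apply smooth_on_is_pd with D; trivial. Qed.

Lemma is_pd_eq a f u v l l' : is_pd a f u v l -> l = l' -> is_pd a f u v l'.
Proof. intros H <-; exact H. Qed.

(** Differentiates an expression built from functions whose partial derivatives are known
    from the context. *)
Ltac is_pd_compute :=
  lazymatch goal with
  | |- is_pd ?a (fun u v => @?f u v + @?g u v) ?x ?y _ =>
      eapply (is_pd_plus a f g); is_pd_compute
  | |- is_pd ?a (fun u v => @?f u v * @?g u v) ?x ?y _ =>
      eapply (is_pd_mult a f g); is_pd_compute
  | |- is_pd ?a (fun u v => - @?f u v) ?x ?y _ =>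
      eapply (is_pd_opp a f); is_pd_compute
  | |- is_pd ?a (fun u v => / @?f u v) ?x ?y _ =>
      eapply (is_pd_inv a f); [cbv beta; auto|is_pd_compute]
  | |- is_pd ?a (fun _ _ => ?c) ?x ?y _ => eapply is_pd_const
  | |- is_pd ?a ?f ?x ?y _ =>
      match goal with
      | H : forall b w z, _ -> is_pd b ?g w z _ |- _ =>
          unify f g; eapply (H a x y); eassumption
      | H : forall w z, _ -> is_pd a ?g w z _ |- _ =>
          unify f g; eapply (H x y); eassumption
      end
  end.

Ltac pd_compute a :=
  match goal with |- context [pd a ?f ?x ?y] =>
    let H := fresh in
    eassert (H : is_pd a f x y _) by (cbv beta iota; unfold Rminus, Rdiv; is_pd_compute);
    rewrite (is_pd_unique _ _ _ _ _ H); clear H; cbv beta iota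
  end.

(** Circular functions rotate an orthonormal frame of a definite metric ([sigma = 1]),
    hyperbolic ones that of an indefinite metric ([sigma = -1]). *)
Lemma rotation_functions sigma : sigma = 1 \/ sigma = -1 ->
  exists C S : R -> R, (forall t, is_derive C t (- sigma * S t)) /\
    (forall t, is_derive S t (C t)) /\ forall t, C t * C t + sigma * (S t * S t) = 1.
Proof.
  intros [->| ->].
  - exists cos, sin; split; [|split]; intro t.
    + auto_derive; trivial; ring.
    + auto_derive; trivial; ring.
    + generalize (sin2_cos2 t); unfold Rsqr; lra.
  - exists cosh, sinh; split; [|split]; intro t.
    + apply is_derive_Reals; replace (- -1 * sinh t) with (sinh t) by ring.
      apply derivable_pt_lim_cosh.
    + apply is_derive_Reals, derivable_pt_lim_sinh.
    + assert (E : exp t * exp (- t) = 1) by (rewrite <- exp_plus, Rplus_opp_r; apply exp_0).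
      unfold cosh, sinh.
      replace ((exp t + exp (- t)) / 2 * ((exp t + exp (- t)) / 2)
        + -1 * ((exp t - exp (- t)) / 2 * ((exp t - exp (- t)) / 2)))
        with (exp t * exp (- t)) by field; trivial.
Qed.

Section Construction.
Variables (lam : idx -> R -> R -> R) (x y d : R).
Let D := box x y d.
Hypothesis Hd : 0 < d.
Hypothesis Hlam : forall a, smooth_on D (lam a).
Hypothesis Hdist : forall u v, D u v -> lam i1 u v <> lam i2 u v.
Variables P Q : R -> R -> R.
Hypothesis HP : smooth_on D P.
Hypothesis HQ : smooth_on D Q.
Hypothesis Hflat : forall u v, D u v -> flat_diagonal_at lam P Q u v.
Variables s1 s2 : R.
Hypothesis Hs1 : s1 * s1 = 1.
Hypothesis Hs2 : s2 * s2 = 1.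
Hypothesis HP0 : forall u v, D u v -> 0 < s1 * P u v.
Hypothesis HQ0 : forall u v, D u v -> 0 < s2 * Q u v.

Let A := coefA lam.
Let B := coefB lam.
Let HD : open2 D := open2_box x y d.

(** The orthonormal coframe [E_a dX^a] of the metric [dX1^2 / P + dX2^2 / Q]. *)
Definition frame (i : idx) (u v : R) : R :=
  match i with i1 => / sqrt (s1 * P u v) | i2 => / sqrt (s2 * Q u v) end.

Lemma P_neq_0 u v : D u v -> P u v <> 0.
Proof. intros H H0; generalize (HP0 u v H); rewrite H0; lra. Qed.

Lemma Q_neq_0 u v : D u v -> Q u v <> 0.
Proof. intros H H0; generalize (HQ0 u v H); rewrite H0; lra. Qed.

Lemma frame_square u v : D u v ->
  s1 * (frame i1 u v * frame i1 u v) = / P u v /\ s2 * (frame i2 u v * frame i2 u v) = / Q u v.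
Proof.
  intro H; assert (N1 := P_neq_0 u v H); assert (N2 := Q_neq_0 u v H); simpl.
  rewrite <- !Rinv_mult, !sqrt_def by (apply Rlt_le; auto).
  split; apply Rmult_eq_reg_r with (P u v * Q u v);
    try (apply Rmult_integral_contrapositive; split; trivial).
  - replace (s1 * / (s1 * P u v) * (P u v * Q u v)) with
      (s1 * s1 * / (s1 * s1) * Q u v); [rewrite Hs1; field; trivial|].
    field; split; trivial; intro Z; rewrite Z in Hs1; lra.
  - replace (s2 * / (s2 * Q u v) * (P u v * Q u v)) with
      (s2 * s2 * / (s2 * s2) * P u v); [rewrite Hs2; field; trivial|].
    field; split; trivial; intro Z; rewrite Z in Hs2; lra.
Qed.

Lemma frame_neq_0 i u v : D u v -> frame i u v <> 0.
Proof.
  intro H; destruct (frame_square u v H) as [F1 F2].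
  generalize (Rinv_neq_0_compat _ (P_neq_0 u v H)) (Rinv_neq_0_compat _ (Q_neq_0 u v H)).
  intros N1 N2 Z; destruct i; rewrite Z in *; [apply N1; rewrite <- F1|apply N2; rewrite <- F2]; ring.
Qed.

Lemma is_pd_inv_sqrt s f a u v : s * s = 1 -> 0 < s * f u v -> is_pd a f u v (pd a f u v) ->
  is_pd a (fun u v => / sqrt (s * f u v)) u v
    (- (1 / 2) * (pd a f u v / f u v) * / sqrt (s * f u v)).
Proof.
  intros Hs Hp Hf.
  assert (Nf : f u v <> 0) by (intro Z; rewrite Z in Hp; lra).
  assert (Nq : sqrt (s * f u v) <> 0) by (apply Rgt_not_eq, sqrt_lt_R0; trivial).
  apply is_pd_eq with
    (- (1 / 2) * (/ f u v) * / sqrt (s * f u v) * pd a f u v); [|field; split; trivial].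
  apply (is_pd_comp a (fun r => / sqrt (s * r))); trivial.
  auto_derive; [repeat split; trivial|].
  apply Rmult_eq_reg_r with (f u v * (sqrt (s * f u v) * sqrt (s * f u v)));
    [|repeat (apply Rmult_integral_contrapositive; split; trivial)].
  replace (- (1 / 2) * / f u v * / sqrt (s * f u v)
    * (f u v * (sqrt (s * f u v) * sqrt (s * f u v)))) with (- (1 / 2) * sqrt (s * f u v))
    by (field; split; trivial).
  match goal with |- ?l = _ => replace l with
    (- (1 / 2) * (s * f u v) * / sqrt (s * f u v)) by (field; trivial) end.
  rewrite <- (sqrt_def (s * f u v)) at 1 by lra; field; trivial.
Qed.

Lemma is_pd_frame i a u v : D u v ->
  is_pd a (frame i) u v
    (match i with i1 => - (1 / 2) * (pd a P u v / P u v)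
                | i2 => - (1 / 2) * (pd a Q u v / Q u v) end * frame i u v).
Proof.
  intro H; destruct i; apply is_pd_inv_sqrt; auto; apply smooth_on_is_pd with D; trivial.
Qed.

Lemma smooth_inv_P : smooth_on D (fun u v => / P u v).
Proof. apply smooth_on_inv; trivial; apply P_neq_0. Qed.

Lemma smooth_inv_Q : smooth_on D (fun u v => / Q u v).
Proof. apply smooth_on_inv; trivial; apply Q_neq_0. Qed.

Lemma smooth_frame i : smooth_on D (frame i).
Proof.
  intro n; revert i; apply (diff_on_linear_system D HD n frame (fun a i j u v =>
    match i, j with
    | i1, i1 => - (1 / 2) * (pd a P u v / P u v)
    | i2, i2 => - (1 / 2) * (pd a Q u v / Q u v)
    | _, _ => 0 end)).
  - intros a [|] [|]; try (apply smooth_on_const; trivial);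
      (apply smooth_on_mult; [trivial|apply smooth_on_const; trivial|]);
      apply smooth_on_mult; trivial; try (apply smooth_on_pd; trivial).
    + apply smooth_inv_P.
    + apply smooth_inv_Q.
  - assert (Hc : forall s f u v, smooth_on D f -> D u v -> 0 < s * f u v ->
      continuity_2d_pt (fun u v => / sqrt (s * f u v)) u v).
    { intros s f u v Hf H Hp; apply (continuity_2d_pt_inv (fun u v => sqrt (s * f u v))).
      - apply (continuity_1d_2d_pt_comp sqrt (fun u v => s * f u v)).
        + apply continuity_pt_sqrt; lra.
        + apply (continuity_2d_pt_mult (fun _ _ => s) f); [apply continuity_2d_pt_const|].
          apply smooth_on_continuous with D; trivial.
      - apply Rgt_not_eq, sqrt_lt_R0; trivial. }
    intros [|] u v H; apply Hc; auto.
  - intros a i u v H; eapply is_pd_eq; [apply is_pd_frame; trivial|].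
    unfold sum2; destruct i; ring.
Qed.

Lemma orthonormal_coframe : exists e1 e2 : R -> R -> R,
  smooth_on D e1 /\ smooth_on D e2 /\
  (forall u v, D u v -> e1 u v <> 0) /\ (forall u v, D u v -> e2 u v <> 0) /\
  (forall u v, D u v -> e1 u v * e1 u v = s1 * / P u v) /\
  (forall u v, D u v -> e2 u v * e2 u v = s2 * / Q u v) /\
  (forall a u v, D u v -> is_pd a e1 u v (- (1 / 2) * (pd a P u v * / P u v) * e1 u v)) /\
  (forall a u v, D u v -> is_pd a e2 u v (- (1 / 2) * (pd a Q u v * / Q u v) * e2 u v)).
Proof.
  exists (frame i1), (frame i2).
  split; [apply smooth_frame|split; [apply smooth_frame|]].
  split; [intros; apply frame_neq_0; trivial|split; [intros; apply frame_neq_0; trivial|]].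
  split; [|split; [|split]].
  - intros u v H; destruct (frame_square u v H) as [<- _].
    rewrite <- Rmult_assoc, Hs1; ring.
  - intros u v H; destruct (frame_square u v H) as [_ <-].
    rewrite <- Rmult_assoc, Hs2; ring.
  - intros a u v H; exact (is_pd_frame i1 a u v H).
  - intros a u v H; exact (is_pd_frame i2 a u v H).
Qed.

Hypothesis HA : smooth_on D A.
Hypothesis HB : smooth_on D B.

(** The connection form of the metric in the orthonormal coframe is [d theta]: its
    closedness is the flatness of the metric. *)
Lemma rotation_angle e1 e2 : smooth_on D e1 -> smooth_on D e2 ->
  (forall u v, D u v -> e1 u v <> 0) -> (forall u v, D u v -> e2 u v <> 0) ->
  (forall u v, D u v -> e1 u v * e1 u v = s1 * / P u v) ->
  (forall u v, D u v -> e2 u v * e2 u v = s2 * / Q u v) ->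
  (forall a u v, D u v -> is_pd a e1 u v (- (1 / 2) * (pd a P u v * / P u v) * e1 u v)) ->
  (forall a u v, D u v -> is_pd a e2 u v (- (1 / 2) * (pd a Q u v * / Q u v) * e2 u v)) ->
  exists theta, smooth_on D theta /\ forall a u v, D u v -> is_pd a theta u v
    (match a with i1 => A u v * e1 u v * / e2 u v
                | i2 => - (s1 * s2) * B u v * e2 u v * / e1 u v end).
Proof.
  intros Se1 Se2 N1 N2 Q1 Q2 D1 D2.
  assert (DA := is_pd_of D A HA); assert (DB := is_pd_of D B HB).
  apply (poincare x y d (fun a u v => match a with i1 => A u v * e1 u v * / e2 u v
                | i2 => - (s1 * s2) * B u v * e2 u v * / e1 u v end) Hd).
  - intros [|].
    + apply smooth_on_mult; [trivial|apply smooth_on_mult|apply smooth_on_inv]; trivial.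
    + apply smooth_on_mult; [trivial|apply smooth_on_mult|apply smooth_on_inv]; trivial.
      apply smooth_on_mult; trivial; apply smooth_on_const; trivial.
  - intros u v Huv; fold D in Huv.
    assert (M1 := N1 u v Huv); assert (M2 := N2 u v Huv).
    assert (NP := P_neq_0 u v Huv); assert (NQ := Q_neq_0 u v Huv).
    destruct (Hflat u v Huv) as (F1 & F2 & F3); fold A B in F1, F2, F3.
    pd_compute i2.
    pd_compute i1.
    rewrite F1, F2.
    apply Rmult_eq_reg_r with (e1 u v * e2 u v);
      [|apply Rmult_integral_contrapositive; split; trivial].
    match goal with |- ?l = ?r => transitivity
      ((e1 u v * e1 u v) * (pd i2 A u v + A u v * A u v
         + 1 / 2 * A u v * (pd i2 Q u v * / Q u v)));
      [field; repeat split; trivial|transitivity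
      (- (s1 * s2) * (e2 u v * e2 u v) * (pd i1 B u v + B u v * B u v
         + 1 / 2 * B u v * (pd i1 P u v * / P u v)));
      [|field; repeat split; trivial]] end.
    rewrite Q1, Q2 by trivial.
    replace (- (s1 * s2) * (s2 * / Q u v)) with (- s1 * (s2 * s2) * / Q u v) by ring.
    rewrite Hs2; apply Rminus_diag_uniq.
    match goal with |- ?l = 0 => replace l with (s1 * / 2 * / P u v * / Q u v *
      (B u v * pd i1 P u v + A u v * pd i2 Q u v
       + 2 * (pd i1 B u v + B u v * B u v) * P u v
       + 2 * (pd i2 A u v + A u v * A u v) * Q u v)) by (field; split; trivial) end.
    rewrite F3; ring.
Qed.

(** The entries of the rotation by [theta].  Their derivatives and the relation
    [c^2 + s1 s2 s^2 = 1] are common to the circular and the hyperbolic case. *)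
Lemma rotation_matrix e1 e2 : smooth_on D e1 -> smooth_on D e2 ->
  (forall u v, D u v -> e1 u v <> 0) -> (forall u v, D u v -> e2 u v <> 0) ->
  (forall u v, D u v -> e1 u v * e1 u v = s1 * / P u v) ->
  (forall u v, D u v -> e2 u v * e2 u v = s2 * / Q u v) ->
  (forall a u v, D u v -> is_pd a e1 u v (- (1 / 2) * (pd a P u v * / P u v) * e1 u v)) ->
  (forall a u v, D u v -> is_pd a e2 u v (- (1 / 2) * (pd a Q u v * / Q u v) * e2 u v)) ->
  exists c s : R -> R -> R, smooth_on D c /\ smooth_on D s /\
  (forall u v, D u v -> c u v * c u v + s1 * s2 * (s u v * s u v) = 1) /\
  (forall u v, D u v -> is_pd i1 c u v (- (s1 * s2) * s u v * (A u v * e1 u v * / e2 u v))) /\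
  (forall u v, D u v -> is_pd i2 c u v (s u v * (B u v * e2 u v * / e1 u v))) /\
  (forall u v, D u v -> is_pd i1 s u v (c u v * (A u v * e1 u v * / e2 u v))) /\
  (forall u v, D u v -> is_pd i2 s u v (- (s1 * s2) * c u v * (B u v * e2 u v * / e1 u v))).
Proof.
  intros Se1 Se2 N1 N2 Q1 Q2 D1 D2.
  destruct (rotation_angle e1 e2) as (th & Hth & Dth); trivial.
  assert (Hss : (s1 * s2) * (s1 * s2) = 1).
  { replace ((s1 * s2) * (s1 * s2)) with ((s1 * s1) * (s2 * s2)) by ring.
    rewrite Hs1, Hs2; ring. }
  destruct (rotation_functions (s1 * s2)) as (C & S & HC & HS & HCS).
  { assert (Z : (s1 * s2 - 1) * (s1 * s2 + 1) = 0) by lra.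
    apply Rmult_integral in Z; destruct Z; [left|right]; lra. }
  pose (w := fun (a : idx) u v => match a with i1 => A u v * e1 u v * / e2 u v
                | i2 => - (s1 * s2) * B u v * e2 u v * / e1 u v end).
  pose (f := fun (i : idx) u v => match i with i1 => C (th u v) | i2 => S (th u v) end).
  assert (Df : forall a i u v, D u v -> is_pd a (f i) u v
    (match i with i1 => - (s1 * s2) * f i2 u v | i2 => f i1 u v end * w a u v)).
  { intros a [|] u v H; apply (is_pd_comp a _ th); auto; apply Dth; trivial. }
  assert (Sw : forall a, smooth_on D (w a)).
  { intros [|].
    + apply smooth_on_mult; [trivial|apply smooth_on_mult|apply smooth_on_inv]; trivial.
    + apply smooth_on_mult; [trivial|apply smooth_on_mult|apply smooth_on_inv]; trivial.
      apply smooth_on_mult; trivial; apply smooth_on_const; trivial. }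
  assert (Sf : forall i, smooth_on D (f i)).
  { intros i n; revert i; apply (diff_on_linear_system D HD n f (fun a i j u v =>
      match i, j with
      | i1, i2 => - (s1 * s2) * w a u v
      | i2, i1 => w a u v
      | _, _ => 0 end)).
    - intros a [|] [|]; try (apply smooth_on_const; trivial); try apply Sw.
      apply smooth_on_mult; trivial; apply smooth_on_const; trivial.
    - intros i u v H.
      assert (Hc : forall F : R -> R, (forall t, ex_derive F t) ->
        continuity_2d_pt (fun u v => F (th u v)) u v).
      { intros F HF; apply continuity_1d_2d_pt_comp.
        - apply continuity_pt_filterlim, (ex_derive_continuous F), HF.
        - apply smooth_on_continuous with D; trivial. }
      destruct i; apply Hc; intro t; eexists; [apply HC|apply HS].
    - intros a i u v H; eapply is_pd_eq; [apply Df; trivial|].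
      unfold sum2; destruct i; ring. }
  exists (f i1), (f i2).
  split; [trivial|split; [trivial|]].
  split; [intros; apply HCS|].
  split; [intros; apply (Df i1 i1); trivial|].
  split; [|split; [intros; apply (Df i1 i2); trivial|]].
  - intros u v H; eapply is_pd_eq; [apply (Df i2 i1); trivial|]; unfold w.
    match goal with |- ?l = _ => replace l with
      ((s1 * s2) * (s1 * s2) * (f i2 u v * (B u v * e2 u v * / e1 u v))) by ring end.
    rewrite Hss; ring.
  - intros u v H; eapply is_pd_eq; [apply (Df i2 i2); trivial|]; unfold w; ring.
Qed.

(** In a parallel coframe, obtained by rotating the orthonormal one by [theta], the
    system [nabla_a p_b = delta_ab lam^a g_aa] gives the differentials of the two
    components of [p]; the definitions of [A] and [B] say that they are closed. *)
Lemma hessian_potential : exists p1 p2 : R -> R -> R,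
  smooth_on D p1 /\ smooth_on D p2 /\ forall u v, D u v ->
  pd i1 p1 u v = - (1 / 2) * (pd i1 P u v / P u v) * p1 u v
    - A u v * (Q u v / P u v) * p2 u v + lam i1 u v / P u v /\
  pd i2 p1 u v = A u v * p1 u v + B u v * p2 u v /\
  pd i1 p2 u v = A u v * p1 u v + B u v * p2 u v /\
  pd i2 p2 u v = - (1 / 2) * (pd i2 Q u v / Q u v) * p2 u v
    - B u v * (P u v / Q u v) * p1 u v + lam i2 u v / Q u v.
Proof.
  destruct orthonormal_coframe as (e1 & e2 & Se1 & Se2 & N1 & N2 & Q1 & Q2 & D1 & D2).
  destruct (rotation_matrix e1 e2) as (c & s & Sc & Ss & Hcs & Dc1 & Dc2 & Ds1 & Ds2); trivial.
  assert (DA := is_pd_of D A HA); assert (DB := is_pd_of D B HB).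
  assert (Dl1 := is_pd_of D (lam i1) (Hlam i1)); assert (Dl2 := is_pd_of D (lam i2) (Hlam i2)).
  assert (Hss : (s1 * s2) * (s1 * s2) = 1).
  { replace ((s1 * s2) * (s1 * s2)) with ((s1 * s1) * (s2 * s2)) by ring.
    rewrite Hs1, Hs2; ring. }
  assert (Sk : forall k : R, smooth_on D (fun _ _ => k)) by (intro; apply smooth_on_const; trivial).
  assert (El1 : forall u v, D u v -> pd i2 (lam i1) u v = A u v * (lam i2 u v - lam i1 u v)).
  { intros; apply (coefA_eq D lam); trivial. }
  assert (El2 : forall u v, D u v -> pd i1 (lam i2) u v = B u v * (lam i1 u v - lam i2 u v)).
  { intros; apply (coefB_eq D lam); trivial. }
  destruct (poincare x y d (fun a => match a with
    | i1 => fun u v => c u v * lam i1 u v * (s1 * e1 u v)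
    | i2 => fun u v => s1 * s2 * s u v * lam i2 u v * (s2 * e2 u v) end) Hd)
    as (m1 & Sm1 & Dm1).
  { intros [|]; fold D; repeat first [apply Sk | apply smooth_on_mult]; trivial. }
  { intros u v Huv; fold D in Huv.
    assert (M1 := N1 u v Huv); assert (M2 := N2 u v Huv).
    assert (NP := P_neq_0 u v Huv); assert (NQ := Q_neq_0 u v Huv).
    destruct (Hflat u v Huv) as (F1 & F2 & _); fold A B in F1, F2.
    pd_compute i2.
    pd_compute i1.
    rewrite F1, F2, El1, El2 by trivial; apply Rminus_diag_uniq.
    match goal with |- ?l = 0 => replace l with
      (s u v * lam i1 u v * B u v * e2 u v * s1 * (1 - s2 * s2)
       + c u v * lam i2 u v * A u v * e1 u v * s1 * (1 - s2 * s2))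
      by (field; repeat split; trivial) end.
    rewrite Hs2; ring. }
  destruct (poincare x y d (fun a => match a with
    | i1 => fun u v => - s u v * lam i1 u v * (s1 * e1 u v)
    | i2 => fun u v => c u v * lam i2 u v * (s2 * e2 u v) end) Hd)
    as (m2 & Sm2 & Dm2).
  { intros [|]; fold D; repeat first [apply Sk | apply smooth_on_opp | apply smooth_on_mult]; trivial. }
  { intros u v Huv; fold D in Huv.
    assert (M1 := N1 u v Huv); assert (M2 := N2 u v Huv).
    assert (NP := P_neq_0 u v Huv); assert (NQ := Q_neq_0 u v Huv).
    destruct (Hflat u v Huv) as (F1 & F2 & _); fold A B in F1, F2.
    pd_compute i2.
    pd_compute i1.
    rewrite F1, F2, El1, El2 by trivial; apply Rminus_diag_uniq.
    match goal with |- ?l = 0 => replace l with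
      (c u v * lam i1 u v * B u v * e2 u v * s2 * (s1 * s1 - 1)
       - s u v * lam i2 u v * A u v * e1 u v * s1 * (1 - s2 * s2))
      by (field; repeat split; trivial) end.
    rewrite Hs1, Hs2; ring. }
  fold D in Sm1, Dm1, Sm2, Dm2.
  assert (Dm11 := Dm1 i1); assert (Dm12 := Dm1 i2); assert (Dm21 := Dm2 i1);
  assert (Dm22 := Dm2 i2); clear Dm1 Dm2; cbv beta iota in Dm11, Dm12, Dm21, Dm22.
  exists (fun u v => e1 u v * (c u v * m1 u v + - (s1 * s2) * s u v * m2 u v)),
         (fun u v => e2 u v * (s u v * m1 u v + c u v * m2 u v)).
  split; [repeat first [apply Sk | apply smooth_on_plus | apply smooth_on_mult]; trivial|].
  split; [repeat first [apply Sk | apply smooth_on_plus | apply smooth_on_mult]; trivial|].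
  intros u v Huv.
  assert (M1 := N1 u v Huv); assert (M2 := N2 u v Huv).
  assert (NP := P_neq_0 u v Huv); assert (NQ := Q_neq_0 u v Huv).
  assert (Hcs' := Hcs u v Huv).
  destruct (Hflat u v Huv) as (F1 & F2 & _); fold A B in F1, F2.
  assert (Hr1 : s1 * (e1 u v * e1 u v) = / P u v) by (rewrite Q1, <- Rmult_assoc, Hs1 by trivial; ring).
  assert (Hr2 : s2 * (e2 u v * e2 u v) = / Q u v) by (rewrite Q2, <- Rmult_assoc, Hs2 by trivial; ring).
  set (q1 := c u v * m1 u v + - (s1 * s2) * s u v * m2 u v).
  set (q2 := s u v * m1 u v + c u v * m2 u v).
  split; [|split; [|split]].
  - pd_compute i1; apply Rminus_diag_uniq; fold q1 q2.
    match goal with |- ?l = 0 => replace l with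
      (lam i1 u v * (s1 * (e1 u v * e1 u v)) * (c u v * c u v + s1 * s2 * (s u v * s u v))
       - A u v * q2 * (s1 * s2 * (e1 u v * e1 u v) * / e2 u v - e2 u v * Q u v * / P u v)
       - lam i1 u v * / P u v) by (unfold q1, q2; field; repeat split; trivial) end.
    rewrite Hcs', Hr1.
    replace (s1 * s2 * (e1 u v * e1 u v) * / e2 u v - e2 u v * Q u v * / P u v)
      with ((s1 * (e1 u v * e1 u v)) * s2 * / e2 u v
            - e2 u v * Q u v * / P u v) by ring.
    rewrite Hr1.
    replace (/ P u v * s2 * / e2 u v) with (/ P u v * / e2 u v * s2 * (Q u v * / Q u v))
      by (field; repeat split; trivial).
    rewrite <- Hr2.
    replace (/ P u v * / e2 u v * s2 * (Q u v * (s2 * (e2 u v * e2 u v)))) with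
      (/ P u v * e2 u v * Q u v * (s2 * s2)) by (field; split; trivial).
    rewrite Hs2; ring.
  - pd_compute i2; apply Rminus_diag_uniq; fold q1 q2.
    rewrite F2.
    match goal with |- ?l = 0 => replace l with
      ((s u v * B u v * e2 u v * m1 u v + c u v * B u v * e2 u v * m2 u v * ((s1 * s2) * (s1 * s2)))
       - B u v * e2 u v * q2) by (unfold q1, q2; field; repeat split; trivial) end.
    rewrite Hss; unfold q2; ring.
  - pd_compute i1; apply Rminus_diag_uniq; fold q1 q2.
    rewrite F1; unfold q1, q2; field; repeat split; trivial.
  - pd_compute i2; apply Rminus_diag_uniq; fold q1 q2.
    match goal with |- ?l = 0 => replace l with
      (lam i2 u v * (s2 * (e2 u v * e2 u v)) * (c u v * c u v + s1 * s2 * (s u v * s u v))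
       - B u v * q1 * (s1 * s2 * (e2 u v * e2 u v) * / e1 u v - e1 u v * P u v * / Q u v)
       - lam i2 u v * / Q u v
       + e2 u v * s u v * (B u v * e2 u v * / e1 u v) * m2 u v * (1 - s1 * s2 * (s1 * s2)))
      by (unfold q1, q2; field; repeat split; trivial) end.
    rewrite Hss, Hcs', Hr2.
    replace (s1 * s2 * (e2 u v * e2 u v) * / e1 u v - e1 u v * P u v * / Q u v)
      with ((s2 * (e2 u v * e2 u v)) * s1 * / e1 u v
            - e1 u v * P u v * / Q u v) by ring.
    rewrite Hr2.
    replace (/ Q u v * s1 * / e1 u v) with (/ Q u v * / e1 u v * s1 * (P u v * / P u v))
      by (field; repeat split; trivial).
    rewrite <- Hr1.
    replace (/ Q u v * / e1 u v * s1 * (P u v * (s1 * (e1 u v * e1 u v)))) with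
      (/ Q u v * e1 u v * P u v * (s1 * s1)) by (field; split; trivial).
    rewrite Hs1; ring.
Qed.
End Construction.

Definition diagonal_metric (P Q : R -> R -> R) (p : idx * idx) : R -> R -> R :=
  match p with
  | (i1, i1) => P
  | (i2, i2) => Q
  | _ => fun _ _ => 0
  end.

(** The Levi-Civita connection of [dX1^2 / P + dX2^2 / Q] when [A = Gamma^1_12] and
    [B = Gamma^2_12]. *)
Definition diagonal_christoffel (A B P Q : R -> R -> R) (e a c : idx) : R -> R -> R :=
  match e, a, c with
  | i1, i1, i1 => fun u v => - (1 / 2) * (pd i1 P u v * / P u v)
  | i1, i2, i2 => fun u v => - (B u v * (P u v * / Q u v))
  | i2, i1, i1 => fun u v => - (A u v * (Q u v * / P u v))
  | i2, i2, i2 => fun u v => - (1 / 2) * (pd i2 Q u v * / Q u v)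
  | i1, _, _ => A
  | i2, _, _ => B
  end.

Section Diagonal.
Variables (lam : idx -> R -> R -> R) (D : R -> R -> Prop).
Hypothesis HD : open2 D.
Variables P Q : R -> R -> R.
Hypothesis HP : smooth_on D P.
Hypothesis HQ : smooth_on D Q.
Hypothesis NP : forall u v, D u v -> P u v <> 0.
Hypothesis NQ : forall u v, D u v -> Q u v <> 0.
Hypothesis HA : smooth_on D (coefA lam).
Hypothesis HB : smooth_on D (coefB lam).
Hypothesis Hflat : forall u v, D u v -> flat_diagonal_at lam P Q u v.

Let A := coefA lam.
Let B := coefB lam.
Let gam := diagonal_christoffel A B P Q.
Let gl (a e : idx) : R -> R -> R :=
  diagonal_metric (fun u v => / P u v) (fun u v => / Q u v) (a, e).

Lemma smooth_diagonal_christoffel e a c : smooth_on D (gam e a c).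
Proof.
  assert (IP := smooth_on_inv D HD P HP NP); assert (IQ := smooth_on_inv D HD Q HQ NQ).
  assert (S1 : smooth_on D (gam i1 i1 i1)).
  { apply smooth_on_mult; [trivial|apply smooth_on_const; trivial|].
    apply smooth_on_mult; trivial; apply smooth_on_pd; trivial. }
  assert (S2 : smooth_on D (gam i2 i2 i2)).
  { apply smooth_on_mult; [trivial|apply smooth_on_const; trivial|].
    apply smooth_on_mult; trivial; apply smooth_on_pd; trivial. }
  assert (S3 : smooth_on D (gam i1 i2 i2)).
  { apply smooth_on_opp; trivial; apply smooth_on_mult; trivial; apply smooth_on_mult; trivial. }
  assert (S4 : smooth_on D (gam i2 i1 i1)).
  { apply smooth_on_opp; trivial; apply smooth_on_mult; trivial; apply smooth_on_mult; trivial. }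
  destruct e, a, c; trivial.
Qed.

Lemma diagonal_parallel u v : D u v -> parallel_at gam gl u v.
Proof.
  intros Huv; destruct (Hflat u v Huv) as (F1 & F2 & _); fold A B in F1, F2.
  assert (MP := NP u v Huv); assert (MQ := NQ u v Huv).
  assert (DP := is_pd_of D P HP); assert (DQ := is_pd_of D Q HQ).
  assert (Z : forall c, pd c (fun _ _ => 0) u v = 0).
  { intro c; apply is_pd_unique, is_pd_const. }
  assert (E1 : forall c, pd c (fun u v => / P u v) u v = - pd c P u v * / P u v * / P u v).
  { intro c; pd_compute c; trivial. }
  assert (E2 : forall c, pd c (fun u v => / Q u v) u v = - pd c Q u v * / Q u v * / Q u v).
  { intro c; pd_compute c; trivial. }
  intros [|] [|] [|]; unfold gl, gam, sum2, diagonal_metric, diagonal_christoffel;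
    rewrite ?Z, ?E1, ?E2, ?F1, ?F2; field; repeat split; trivial.
Qed.

Lemma diagonal_flat u v : D u v -> flat_at gam u v.
Proof.
  intros Huv; destruct (Hflat u v Huv) as (F1 & F2 & F3); fold A B in F1, F2, F3.
  assert (MP := NP u v Huv); assert (MQ := NQ u v Huv).
  assert (DP := is_pd_of D P HP); assert (DQ := is_pd_of D Q HQ).
  assert (DA := is_pd_of D A HA); assert (DB := is_pd_of D B HB).
  assert (DP1 := is_pd_of D (pd i1 P) (smooth_on_pd D i1 P HP)).
  assert (DQ2 := is_pd_of D (pd i2 Q) (smooth_on_pd D i2 Q HQ)).
  assert (X1 : pd i2 (pd i1 P) u v = - 2 * (pd i1 A u v * P u v + A u v * pd i1 P u v)).
  { rewrite <- (pd_comm D HD) by trivial.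
    apply is_pd_unique, is_pd_ext with (fun u v => - 2 * (A u v * P u v)).
    - apply on_locally with D; trivial; intros u' v' H.
      destruct (Hflat u' v' H) as (_ & E & _); rewrite E; unfold A; ring.
    - eapply is_pd_eq; [is_pd_compute|]; ring. }
  assert (X2 : pd i1 (pd i2 Q) u v = - 2 * (pd i2 B u v * Q u v + B u v * pd i2 Q u v)).
  { rewrite (pd_comm D HD) by trivial.
    apply is_pd_unique, is_pd_ext with (fun u v => - 2 * (B u v * Q u v)).
    - apply on_locally with D; trivial; intros u' v' H.
      destruct (Hflat u' v' H) as (E & _); rewrite E; unfold B; ring.
    - eapply is_pd_eq; [is_pd_compute|]; ring. }
  assert (G111 : pd i2 (gam i1 i1 i1) u v = pd i1 A u v).
  { unfold gam, diagonal_christoffel; pd_compute i2.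
    rewrite X1, F2; field; trivial. }
  assert (G222 : pd i1 (gam i2 i2 i2) u v = pd i2 B u v).
  { unfold gam, diagonal_christoffel; pd_compute i1.
    rewrite X2, F1; field; trivial. }
  assert (G122 : pd i1 (gam i1 i2 i2) u v = - (pd i1 B u v * P u v + B u v * pd i1 P u v
     + 2 * B u v * B u v * P u v) * / Q u v).
  { unfold gam, diagonal_christoffel; pd_compute i1.
    rewrite F1; field; trivial. }
  assert (G211 : pd i2 (gam i2 i1 i1) u v = - (pd i2 A u v * Q u v + A u v * pd i2 Q u v
     + 2 * A u v * A u v * Q u v) * / P u v).
  { unfold gam, diagonal_christoffel; pd_compute i2.
    rewrite F2; field; trivial. }
  set (W := B u v * pd i1 P u v + A u v * pd i2 Q u v
    + 2 * (pd i1 B u v + B u v * B u v) * P u v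
    + 2 * (pd i2 A u v + A u v * A u v) * Q u v) in F3.
  (* the curvature is antisymmetric in its last two slots *)
  assert (F : forall a c, pd i1 (gam a c i2) u v - pd i2 (gam a c i1) u v
    + sum2 (fun e => gam a e i1 u v * gam e c i2 u v)
    - sum2 (fun e => gam a e i2 u v * gam e c i1 u v) = 0).
  { intros [|] [|]; unfold sum2; rewrite ?G111, ?G222, ?G122, ?G211.
    - unfold gam, diagonal_christoffel; field; split; trivial.
    - transitivity (- (1 / 2) * / Q u v * W); [|rewrite F3; ring].
      unfold W, gam, diagonal_christoffel; field; split; trivial.
    - transitivity ((1 / 2) * / P u v * W); [|rewrite F3; ring].
      unfold W, gam, diagonal_christoffel; field; split; trivial.
    - unfold gam, diagonal_christoffel; field; split; trivial. }
  intros a c [|] [|]; try (assert (Fac := F a c); lra); ring.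
Qed.

End Diagonal.

Lemma locally_sign f D x y : smooth_on D f -> D x y -> f x y <> 0 ->
  exists s, s * s = 1 /\ locally_2d (fun u v => 0 < s * f u v) x y.
Proof.
  intros Hf Hxy H0.
  assert (Hpos : forall s, 0 < s * f x y -> Rabs s = 1 ->
    locally_2d (fun u v => 0 < s * f u v) x y).
  { intros s Hs Has.
    apply locally_2d_impl with
      (2 := smooth_on_continuous D f x y Hf Hxy (mkposreal _ Hs)).
    apply locally_2d_forall; simpl; intros u v H.
    assert (H' : Rabs (s * f u v - s * f x y) < s * f x y).
    { rewrite <- Rmult_minus_distr_l, Rabs_mult, Has; lra. }
    apply Rabs_def2 in H'; lra. }
  destruct (Rtotal_order (f x y) 0) as [H|[H|H]]; [|contradiction|].
  - exists (-1); split; [ring|]; apply Hpos; [lra|]; rewrite Rabs_left; lra.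
  - exists 1; split; [ring|]; apply Hpos; [lra|]; apply Rabs_R1.
Qed.

(** * Counting Hamiltonian formulations *)

Section System.
Variables (D : R -> R -> Prop) (lam : idx -> R -> R -> R).
Hypothesis HD : open2 D.
Hypothesis Hlam : forall a, smooth_on D (lam a).
Hypothesis Hdist : forall u v, D u v -> lam i1 u v <> lam i2 u v.
Hypothesis HA0 : forall u v, D u v -> coefA lam u v <> 0.
Hypothesis HB0 : forall u v, D u v -> coefB lam u v <> 0.

Let A := coefA lam.
Let B := coefB lam.

(** The density is a primitive of the form [p_a dX^a] given by [hessian_potential], which
    is closed because its covariant derivative is symmetric.  The box is first shrunk
    until [P] and [Q] have constant signs, so that the orthonormal coframe exists. *)
Lemma flat_diagonal_hamiltonian x y d P Q : 0 < d -> (forall u v, box x y d u v -> D u v) ->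
  smooth_on (box x y d) P -> smooth_on (box x y d) Q -> P x y <> 0 -> Q x y <> 0 ->
  (forall u v, box x y d u v -> flat_diagonal_at lam P Q u v) ->
  hamiltonian_formulation lam x y (diagonal_metric P Q).
Proof.
  intros Hd0 Hincl0 HP0 HQ0 NP0 NQ0 Hfl0.
  assert (Hc0 := box_center x y d Hd0).
  destruct (locally_sign P _ x y HP0 Hc0 NP0) as (s1 & Hs1 & L1).
  destruct (locally_sign Q _ x y HQ0 Hc0 NQ0) as (s2 & Hs2 & L2).
  assert (L := locally_2d_and _ _ _ _ (open2_box x y d x y Hc0) (locally_2d_and _ _ _ _ L1 L2)).
  apply locally_2d_box in L; destruct L as (r & Hr & L).
  assert (Hsub : forall u v, box x y r u v -> box x y d u v) by (intros u v H; apply (L u v H)).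
  assert (HP : smooth_on (box x y r) P) by (apply smooth_on_incl with (box x y d); trivial).
  assert (HQ : smooth_on (box x y r) Q) by (apply smooth_on_incl with (box x y d); trivial).
  assert (PP : forall u v, box x y r u v -> 0 < s1 * P u v) by (intros u v H; apply (L u v H)).
  assert (PQ : forall u v, box x y r u v -> 0 < s2 * Q u v) by (intros u v H; apply (L u v H)).
  assert (NP : forall u v, box x y r u v -> P u v <> 0).
  { intros u v H E; generalize (PP u v H); rewrite E; lra. }
  assert (NQ : forall u v, box x y r u v -> Q u v <> 0).
  { intros u v H E; generalize (PQ u v H); rewrite E; lra. }
  assert (Hfl : forall u v, box x y r u v -> flat_diagonal_at lam P Q u v) by auto.
  assert (Hincl : forall u v, box x y r u v -> D u v) by auto.
  assert (Hl : forall a, smooth_on (box x y r) (lam a)).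
  { intro a; apply smooth_on_incl with D; trivial. }
  assert (Hdi : forall u v, box x y r u v -> lam i1 u v <> lam i2 u v) by auto.
  assert (HA : smooth_on (box x y r) A).
  { apply smooth_on_incl with D; trivial; apply smooth_coefA; trivial. }
  assert (HB : smooth_on (box x y r) B).
  { apply smooth_on_incl with D; trivial; apply smooth_coefB; trivial. }
  assert (HDr := open2_box x y r); assert (Hc := box_center x y r Hr).
  destruct (hessian_potential lam x y r Hr Hl Hdi P Q HP HQ Hfl s1 s2 Hs1 Hs2 PP PQ HA HB)
    as (p1 & p2 & Sp1 & Sp2 & Hp).
  destruct (poincare x y r (fun a => match a with i1 => p1 | i2 => p2 end) Hr) as (h & Sh & Dh).
  { intros [|]; trivial. }
  { intros u v H; destruct (Hp u v H) as (_ & E1 & E2 & _); rewrite E1, E2; trivial. }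
  assert (Hgam := smooth_diagonal_christoffel lam (box x y r) HDr P Q HP HQ NP NQ HA HB).
  assert (Hgl : forall a e, smooth_on (box x y r)
    (diagonal_metric (fun u v => / P u v) (fun u v => / Q u v) (a, e))).
  { assert (IP := smooth_on_inv _ HDr P HP NP); assert (IQ := smooth_on_inv _ HDr Q HQ NQ).
    intros [|] [|]; trivial; exact (smooth_on_const _ HDr 0). }
  assert (Hg : forall p, smooth_on (box x y r) (diagonal_metric P Q p)).
  { intros [[|] [|]]; trivial; exact (smooth_on_const _ HDr 0). }
  set (gam := diagonal_christoffel A B P Q) in *.
  set (gl := fun a e : idx => diagonal_metric (fun u v => / P u v) (fun u v => / Q u v) (a, e)) in *.
  set (b := fun a e c u v => - sum2 (fun d => diagonal_metric P Q (a, d) u v * gam e d c u v)).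
  assert (Hb : forall a e c, smooth_on (box x y r) (b a e c)).
  { intros; apply smooth_on_opp; trivial; apply smooth_on_sum2; trivial; intro.
    apply smooth_on_mult; trivial; apply Hgam. }
  split; [intro p; apply smooth_on_near with (box x y r); trivial|].
  exists b, h.
  split; [intros; apply smooth_on_near with (box x y r); trivial|].
  split; [apply smooth_on_near with (box x y r); trivial|].
  split.
  - exists gl, gam.
    split; [intros; apply smooth_on_near with (box x y r); trivial; apply Hgl|].
    split; [intros; apply smooth_on_near with (box x y r); trivial; apply Hgam|].
    apply on_locally with (box x y r); trivial; intros u v H.
    assert (MP := NP u v H); assert (MQ := NQ u v H).
    split; [|split; [trivial|split; [|split; [|split]]]].
    + intros [|] [|]; unfold gl, sum2, diagonal_metric, delta; field; trivial.
    + intros [|] [|]; trivial.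
    + apply diagonal_parallel with (D := box x y r); trivial.
    + intros [|] [|] [|]; trivial.
    + apply diagonal_flat with (D := box x y r); trivial.
  - apply on_locally with (box x y r); trivial; intros u v H.
    apply (generates_system_iff (box x y r)); trivial.
    assert (MP := NP u v H); assert (MQ := NQ u v H).
    assert (E : forall u v, box x y r u v -> forall e,
      match e with i1 => p1 | i2 => p2 end u v = pd e h u v).
    { intros u' v' H' e; symmetry; apply is_pd_unique; specialize (Dh e u' v' H').
      destruct e; trivial. }
    assert (E1 : pd i1 h u v = p1 u v) by (rewrite <- (E u v H i1); trivial).
    assert (E2 : pd i2 h u v = p2 u v) by (rewrite <- (E u v H i2); trivial).
    assert (EE1 : forall c, pd c (pd i1 h) u v = pd c p1 u v).
    { intro c; apply pd_ext with (box x y r); trivial; intros u' v' H'; apply (E u' v' H' i1). }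
    assert (EE2 : forall c, pd c (pd i2 h) u v = pd c p2 u v).
    { intro c; apply pd_ext with (box x y r); trivial; intros u' v' H'; apply (E u' v' H' i2). }
    destruct (Hp u v H) as (H11 & H12 & H21 & H22); fold A B in H11, H12, H21, H22.
    intros [|] [|]; unfold b, sum2; rewrite ?EE1, ?EE2, ?E1, ?E2, ?H11, ?H12, ?H21, ?H22;
      unfold diagonal_metric, gam, diagonal_christoffel, delta; field; auto.
Qed.

Definition integral_of_metric (g : idx * idx -> R -> R -> R) : idx -> R -> R -> R :=
  form_of_metric lam (g (i1, i1)) (g (i2, i2)).

Definition metric_of_integral (K : idx -> R -> R -> R) : idx * idx -> R -> R -> R :=
  diagonal_metric (fun u v => K i2 u v * / B u v) (fun u v => K i1 u v * / A u v).

Lemma hamiltonian_nondegenerate_killing x y g : D x y -> hamiltonian_formulation lam x y g ->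
  nondegenerate_killing (connection lam) x y (integral_of_metric g).
Proof.
  intros Hxy Hg.
  destruct (hamiltonian_flat_diagonal D lam HD Hlam Hdist x y g Hxy Hg)
    as (d & Hd & Hincl & Sg & H).
  assert (Hc := box_center x y d Hd); assert (HDd := open2_box x y d).
  assert (HA : smooth_on (box x y d) A).
  { apply smooth_on_incl with D; trivial; apply smooth_coefA; trivial. }
  assert (HB : smooth_on (box x y d) B).
  { apply smooth_on_incl with D; trivial; apply smooth_coefB; trivial. }
  split; [split|].
  - intros [|]; apply smooth_on_near with (box x y d); trivial;
      apply smooth_on_mult; trivial.
  - apply on_locally with (box x y d); trivial; intros u v Huv.
    apply (killing_form_of_metric D) with (D' := box x y d); trivial.
    apply (H u v Huv).
  - destruct (H x y Hc) as (_ & _ & N1 & N2 & _).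
    intros [|]; apply Rmult_integral_contrapositive; split; trivial; [apply HA0|apply HB0]; trivial.
Qed.

Lemma nondegenerate_killing_hamiltonian x y K : D x y ->
  nondegenerate_killing (connection lam) x y K ->
  hamiltonian_formulation lam x y (metric_of_integral K).
Proof.
  intros Hxy [[HK Hkill] N].
  assert (L := locally_2d_and _ _ _ _ (HD x y Hxy)
    (locally_2d_and _ _ _ _ Hkill (locally_2d_and _ _ _ _ (HK i1) (HK i2)))).
  apply locally_2d_box in L; destruct L as (d & Hd & L).
  assert (Hincl : forall u v, box x y d u v -> D u v) by (intros u v H; apply (L u v H)).
  assert (HDd := open2_box x y d).
  assert (SK : forall a, smooth_on (box x y d) (K a)).
  { intros [|] n u v H; apply (L u v H). }
  assert (HA : smooth_on (box x y d) A).
  { apply smooth_on_incl with D; trivial; apply smooth_coefA; trivial. }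
  assert (HB : smooth_on (box x y d) B).
  { apply smooth_on_incl with D; trivial; apply smooth_coefB; trivial. }
  assert (SP : smooth_on (box x y d) (fun u v => K i2 u v * / B u v)).
  { apply smooth_on_mult; trivial; apply smooth_on_inv; trivial; intros; apply HB0; auto. }
  assert (SQ : smooth_on (box x y d) (fun u v => K i1 u v * / A u v)).
  { apply smooth_on_mult; trivial; apply smooth_on_inv; trivial; intros; apply HA0; auto. }
  apply flat_diagonal_hamiltonian with d; trivial.
  - apply Rmult_integral_contrapositive; split; trivial; apply Rinv_neq_0_compat, HB0; trivial.
  - apply Rmult_integral_contrapositive; split; trivial; apply Rinv_neq_0_compat, HA0; trivial.
  - intros u v H; apply (killing_form_of_metric D) with (D' := box x y d); trivial.
    destruct (L u v H) as (_ & Hk & _).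
    set (F := form_of_metric lam (fun u v => K i2 u v * / B u v) (fun u v => K i1 u v * / A u v)).
    assert (E : forall a u v, box x y d u v -> F a u v = K a u v).
    { intros [|] u' v' H'; unfold F, form_of_metric; [fold A|fold B]; field;
        [apply HA0|apply HB0]; auto. }
    assert (EF : forall e a, pd e (F a) u v = pd e (K a) u v).
    { intros e a; apply pd_ext with (box x y d); trivial; intros; symmetry; auto. }
    intros a c; rewrite !EF, Hk; unfold sum2; rewrite !E by trivial; reflexivity.
Qed.

Lemma locally_2d_finite (Pr : nat -> R -> R -> Prop) n x y :
  (forall k, (1 <= k <= n)%nat -> locally_2d (Pr k) x y) ->
  locally_2d (fun u v => forall k, (1 <= k <= n)%nat -> Pr k u v) x y.
Proof.
  induction n as [|n IH]; intros H.
  - apply locally_2d_forall; intros; lia.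
  - generalize (locally_2d_and _ _ _ _ (IH (fun k Hk => H k ltac:(lia))) (H (S n) ltac:(lia))).
    apply locally_2d_impl, locally_2d_forall; intros u v [H1 H2] k Hk.
    destruct (Nat.eq_dec k (S n)) as [->|]; trivial; apply H1; lia.
Qed.

Lemma sum_zero_factor (a b : nat -> R) t n : t <> 0 ->
  (forall k, (1 <= k <= n)%nat -> a k = t * b k) ->
  sum_n_m a 1 n = 0 -> sum_n_m b 1 n = 0.
Proof.
  intros Ht Hab H; rewrite (sum_ext a (fun k => t * b k)), sum_scal in H by trivial.
  apply Rmult_integral in H; tauto.
Qed.

(** Both correspondences multiply components by nonvanishing functions that are the same
    for all members of a family, so linear relations go back and forth. *)
Lemma has_indep_hamiltonian x y n : D x y ->
  (has_indep (hamiltonian_formulation lam x y) n x y <->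
   has_indep (nondegenerate_killing (connection lam) x y) n x y).
Proof.
  intros Hxy; split.
  - apply has_indep_map with integral_of_metric.
    + intros g Hg; apply hamiltonian_nondegenerate_killing; trivial.
    + intros w c Hw HT.
      assert (Hoff : locally_2d (fun u v => forall k, (1 <= k <= n)%nat ->
        w k (i1, i2) u v = 0 /\ w k (i2, i1) u v = 0) x y).
      { apply (locally_2d_finite (fun k u v => w k (i1, i2) u v = 0 /\ w k (i2, i1) u v = 0)).
        intros k Hk.
        destruct (hamiltonian_flat_diagonal D lam HD Hlam Hdist x y (w k) Hxy (Hw k Hk))
          as (d & Hd & _ & _ & H).
        apply locally_2d_box; exists d; split; trivial.
        intros u v Huv; destruct (H u v Huv) as (E1 & E2 & _); auto. }
      generalize (locally_2d_and _ _ _ _ (HD x y Hxy) (locally_2d_and _ _ _ _ HT Hoff)).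
      apply locally_2d_impl, locally_2d_forall; intros u v (Huv & H1 & H2) [[|] [|]].
      * apply (sum_zero_factor (fun k => c k * integral_of_metric (w k) i2 u v) _ (B u v));
          [apply HB0; trivial| |apply H1].
        intros k _; unfold integral_of_metric, form_of_metric; fold B; ring.
      * apply (sum_zero_factor (fun _ => 0 * 0) _ 1); [lra| |rewrite sum_scal; apply Rmult_0_l].
        intros k Hk; destruct (H2 k Hk) as [E _]; rewrite E; ring.
      * apply (sum_zero_factor (fun _ => 0 * 0) _ 1); [lra| |rewrite sum_scal; apply Rmult_0_l].
        intros k Hk; destruct (H2 k Hk) as [_ E]; rewrite E; ring.
      * apply (sum_zero_factor (fun k => c k * integral_of_metric (w k) i1 u v) _ (A u v));
          [apply HA0; trivial| |apply H1].
        intros k _; unfold integral_of_metric, form_of_metric; fold A; ring.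
  - apply has_indep_map with metric_of_integral.
    + intros K HK; apply nondegenerate_killing_hamiltonian; trivial.
    + intros w c Hw HT.
      generalize (locally_2d_and _ _ _ _ (HD x y Hxy) HT).
      apply locally_2d_impl, locally_2d_forall; intros u v (Huv & H1) [|].
      * apply (sum_zero_factor (fun k => c k * metric_of_integral (w k) (i2, i2) u v) _ (/ A u v));
          [apply Rinv_neq_0_compat, HA0; trivial| |apply H1].
        intros k _; unfold metric_of_integral, diagonal_metric; ring.
      * apply (sum_zero_factor (fun k => c k * metric_of_integral (w k) (i1, i1) u v) _ (/ B u v));
          [apply Rinv_neq_0_compat, HB0; trivial| |apply H1].
        intros k _; unfold metric_of_integral, diagonal_metric; ring.
Qed.
End System.

Theorem theorem1p2
  (U : R * R -> Prop) (lam : idx -> R -> R -> R)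
  (U_open : open U)
  (lam_smooth : forall a x y, U (x, y) -> smooth_near (lam a) x y)
  (lam_distinct : forall x y, U (x, y) -> lam i1 x y <> lam i2 x y)
  (A_nonzero : forall x y, U (x, y) -> coefA lam x y <> 0)
  (B_nonzero : forall x y, U (x, y) -> coefB lam x y <> 0) :
  forall x y, U (x, y) ->
    (forall n, (1 <= n <= 3)%nat ->
       (hamiltonian_number lam n x y <->
        first_integral_number (connection lam) n x y /\
        nondegenerate_integral (connection lam) x y)) /\
    (* the non-degeneracy proviso is void for n = 3 *)
    (first_integral_number (connection lam) 3 x y ->
       nondegenerate_integral (connection lam) x y) /\
    (* for n = 1, 2 it holds at points arbitrarily close to (x, y), except when
       n = 1 and the first integral has an identically vanishing component *)
    (forall n, (1 <= n <= 3)%nat ->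
       first_integral_number (connection lam) n x y ->
       (n = 1%nat -> ~ degenerate_integral (connection lam) x y) ->
       ~ locally_2d (fun u v => ~ nondegenerate_integral (connection lam) u v) x y).
Proof.
  intros x y Hxy.
  set (D := fun u v => U (u, v)).
  assert (HD : open2 D).
  { intros u v Huv; apply locally_2d_locally.
    generalize (U_open (u, v) Huv); apply filter_imp; intros [a b]; trivial. }
  assert (Hlam : forall a, smooth_on D (lam a)).
  { intros a n u v Huv; apply (locally_2d_singleton _ _ _ (lam_smooth a u v Huv)). }
  assert (HG : forall a b c, smooth_on D (connection lam a b c)).
  { intros; apply smooth_connection; trivial. }
  assert (Hnd : forall u v, D u v -> (nondegenerate_integral (connection lam) u v <->
     exists K, nondegenerate_killing (connection lam) u v K)).
  { intros u v Huv; split; intros [K HK]; exists K;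
      apply (nondegenerate_killing_first_integral D (connection lam) HD HG); trivial. }
  assert (Hham := fun n => has_indep_hamiltonian D lam HD Hlam lam_distinct A_nonzero B_nonzero x y n Hxy).
  assert (Hfi : nondegenerate_integral (connection lam) x y -> forall n,
    has_indep (hamiltonian_formulation lam x y) n x y <->
    has_indep (linear_first_integral (connection lam) x y) n x y).
  { intros H n; rewrite Hham.
    rewrite (has_indep_nondegenerate D (connection lam) HD HG x y n Hxy); [tauto|].
    apply Hnd; trivial. }
  split; [|split].
  - intros n Hn; unfold hamiltonian_number, first_integral_number, exactly_indep; split.
    + intros [H1 H2].
      assert (Hx : nondegenerate_integral (connection lam) x y).
      { apply Hnd; trivial; apply Hham in H1; destruct H1 as (w & Hw & _).
        exists (w 1%nat); apply Hw; lia. }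
      rewrite <- !(Hfi Hx); auto.
    + intros [[H1 H2] Hx]; rewrite !(Hfi Hx); auto.
  - intros [H _]; apply Hnd; trivial.
    apply three_first_integrals_nondegenerate with D; trivial.
  - intros n Hn [H _] Hdeg Hloc.
    destruct (nowhere_nondegenerate D (connection lam) HD HG) with x y n as [E1 E2]; trivial.
    + intros; split; reflexivity.
    + generalize (locally_2d_and _ _ _ _ (HD x y Hxy) Hloc).
      apply locally_2d_impl, locally_2d_forall; intros u v [Huv HN].
      rewrite <- Hnd by trivial; trivial.
    + lia.
    + exact (Hdeg E1 E2).
Qed.
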